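(* Let $\Gamma$ be a semigroup which is Markov with respect to a finite generating set $O$. Assume that $\Gamma$ acts on a probability space $(X,\nu)$ by measure-preserving transformations, $g\mapsto T_g$. For $n\ge 0$ let $S_O(n)=\{g\in\Gamma: |g|_O=n\}$ and, for $\varphi\in L^1(X,\nu)$, put $$c_N(\varphi)=\frac1N\sum_{n=0}^{N-1}\frac{1}{\#S_O(n)}\sum_{g\in S_O(n)}\varphi\circ T_g$$ (with the inner average interpreted as $0$ if $S_O(n)=\varnothing$). Then for every $p$ with $1\le p<\infty$ and every $\varphi\in L^p(X,\nu)$ the sequence $c_N(\varphi)$ converges in $L^p(X,\nu)$ as $N\to\infty$. If moreover $\varphi\in L^\infty(X,\nu)$, then $c_N(\varphi)$ converges $\nu$-almost everywhere as $N\to\infty$.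
   Context: For a semigroup $\Gamma$ with finite generating set $O$, $|g|_O$ denotes the length of the shortest word over the alphabet $O$ representing $g$. $\Gamma$ is called Markov with respect to $O$ if there exist a finite directed graph $\mathcal G$ (loops and multiple arcs allowed), a vertex $v_0$ of $\mathcal G$, and a labelling $\xi$ from the set of arcs of $\mathcal G$ to $O$ such that, extending $\xi$ to finite paths $p=e_1\dots e_n$ starting at $v_0$ by $\xi(p)=\xi(e_1)\cdots\xi(e_n)$ (the empty path being sent to the identity element), the map $\xi$ from the set of all finite paths in $\mathcal G$ starting at $v_0$ to $\Gamma$ is a bijection, and $|\xi(p)|_O=n$ for every such path $p$ of length $n$. $\#$ denotes cardinality. *)

(* Defs.v *)
From HB Require Import structures.
From mathcomp Require Import all_boot all_order all_algebra.
From mathcomp Require Import all_classical all_reals all_analysis.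
Set Implicit Arguments. Unset Strict Implicit. Unset Printing Implicit Defensive.
Import Order.TTheory GRing.Theory Num.Theory.

Section Words.
(* A monoid (semigroup with identity) given by its operations; the carrier is
   endowed with classical decidable equality via {classic G}. *)
Variables (G : Type) (mul : G -> G -> G) (one : G).
Local Notation CG := {classic G}.

Definition wprod (w : seq G) : G := foldr mul one w.

Fixpoint words (O : seq G) (n : nat) : seq (seq G) :=
  if n is m.+1 then [seq a :: w | a <- O, w <- words O m] else [:: [::]].

Definition reprs (O : seq G) (n : nat) : seq CG := [seq wprod w | w <- words O n].

Definition wlen_is (O : seq G) (g : CG) (n : nat) : bool :=
  (g \in reprs O n) && all (fun m => g \notin reprs O m) (iota 0 n).

Definition sphere (O : seq G) (n : nat) : seq CG :=
  [seq g <- undup (reprs O n) | wlen_is O g n].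

Definition generates (O : seq G) : Prop := forall g : CG, exists n, g \in reprs O n.

(* Markov property: a finite directed graph (vertices V, arcs E, with
   source/target maps, so loops and multiple arcs are allowed), a vertex v0 and
   a labelling lab : E -> O such that the label map from finite paths starting
   at v0 to G is a bijection and preserves length. *)
Definition path_from {V E : finType} (src tgt : E -> V) (v0 : V) (p : seq E) : bool :=
  if p is e :: p' then (src e == v0) && path (fun e f => tgt e == src f) e p' else true.

Definition is_markov (O : seq G) : Prop :=
  exists (V E : finType) (src tgt : E -> V) (v0 : V) (lab : E -> G),
    [/\ forall e, lab e \in (O : seq CG),
        (forall g : G, exists p, path_from src tgt v0 p /\ wprod (map lab p) = g),
        (forall p q, path_from src tgt v0 p -> path_from src tgt v0 q ->
            wprod (map lab p) = wprod (map lab q) -> p = q) &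
        (forall p, path_from src tgt v0 p -> wlen_is O (wprod (map lab p)) (size p))].
End Words.

Local Open Scope classical_set_scope.
Local Open Scope ring_scope.

Definition mp_action (G : Type) (mul : G -> G -> G) (one : G)
  d (X : measurableType d) (R : realType) (nu : {measure set X -> \bar R})
  (T : G -> X -> X) : Prop :=
  [/\ T one = id,
      (forall g h, T (mul g h) = T g \o T h),
      (forall g, measurable_fun setT (T g)) &
      (forall g A, measurable A -> nu (T g @^-1` A) = nu A)].

Definition sph_avg (G : Type) (mul : G -> G -> G) (one : G) (O : seq G)
  (X : Type) (R : realType) (T : G -> X -> X) (phi : X -> R) (n : nat) : X -> R :=
  fun x => let S := sphere mul one O n in
    if S is [::] then 0 else (size S)%:R^-1 * \sum_(g <- S) phi (T g x).

Definition cesaro_sph (G : Type) (mul : G -> G -> G) (one : G) (O : seq G)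
  (X : Type) (R : realType) (T : G -> X -> X) (phi : X -> R) (N : nat) : X -> R :=
  fun x => N%:R^-1 * \sum_(n < N) sph_avg mul one O T phi n x.

(* Main.v *)
Require Import Defs.
From HB Require Import structures.
From mathcomp Require Import all_boot all_order all_algebra.
From mathcomp Require Import all_classical all_reals all_analysis.
From mathcomp Require Import measurable_realfun.
From mathcomp Require Import ring lra zify.
Set Implicit Arguments. Unset Strict Implicit. Unset Printing Implicit Defensive.
Import Order.TTheory GRing.Theory Num.Theory numFieldNormedType.Exports.
Local Open Scope classical_set_scope.
Local Open Scope ring_scope.

(* It suffices to prove a.e. convergence for bounded functions: L^p convergence then
   follows by truncating, since the averages are contractions of L^p.

   Through the Markov graph, spherical sums become iterates of a positive operator [Op] on
   families of functions indexed by the vertices, whose mass matrix is the adjacency matrix.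
   After passing to a power (and to residue classes of the level n) every vertex lying on a
   cycle has a loop.  Let the spectral radius of the reachable part be normalized to 1.  Going
   through the strongly connected components along the condensation order, one shows that
   each vertex is reached by a summable number of (normalized) paths or by c * n^k (1 + o(1))
   of them, and that the partial sums of the functions, divided by n^(k+1), converge a.e.
   In a component of spectral radius 1 the Perron-Frobenius eigenvectors turn [Op] into a
   measure-preserving situation, where the maximal ergodic argument of Garsia applies even
   with a source term of order n^k; components of smaller radius are contractions.
   Summation by parts finally converts convergence of partial sums over vertices into Cesaro
   convergence of the ratios sphere sum / sphere size. *)

(** * Upper limits and binomial weights *)

(** Every limit comes from one-sided estimates. At radius 1 the integral of an upper limit is
    bounded, for a source and for its negative: the gap between upper and lower limit is then
    nonnegative with nonpositive integral. Below radius 1 the gap is contracted to 0 instead. In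
    neither case need the limit be identified. Convergence of numerators is not enough: dividing by
    sphere sizes needs counts asymptotic to [c * n ^ k] with [c > 0]. Counts are constant families,
    so the same recursion theorems give their limits, and irreducibility spreads positivity over a
    component. The exception is a component of radius 1 fed only by a summable amount: there the
    ergodic argument, which averages over time, says nothing about the counts themselves, and
    periodicity could make them oscillate. This is where loops are needed and where an energy
    argument replaces the ergodic one. Bounds are carried by the Perron-Frobenius eigenvectors: the
    left one supplies constants that dominate families, the right one an integral that the operator
    preserves at radius 1. *)

Section LimSup.
Context {R : realType}.
Implicit Types (u v : nat -> R).

Lemma eq_cvgn u v (l m : R) : v @ \oo --> m -> (forall n, u n = v n) -> l = m ->
  u @ \oo --> l.
Proof. by move=> vm uv ->; rewrite (_ : u = v)//; apply/funext. Qed.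

Lemma cvgn_sum (I : Type) (r : seq I) (P : pred I) (F : I -> nat -> R) (l : I -> R) :
  (forall i, P i -> F i @ \oo --> l i) ->
  (fun n => \sum_(i <- r | P i) F i n) @ \oo --> \sum_(i <- r | P i) l i.
Proof.
move=> Fl; elim: r => [|i r IH].
  by rewrite (_ : (fun n => _) = (fun=> \sum_(i <- [::] | P i) l i)); [exact: cvg_cst|
    apply/funext => n; rewrite !big_nil].
rewrite (_ : (fun n => _) = (fun n => (if P i then F i n else 0) +
    \sum_(i <- r | P i) F i n)); last first.
  by apply/funext => n; rewrite big_cons; case: (P i); rewrite ?add0r.
have -> : \sum_(j <- i :: r | P j) l j = (if P i then l i else 0) + \sum_(j <- r | P j) l j.
  by rewrite big_cons; case: (P i); rewrite ?add0r.
by apply: cvgD => //; case: ifP => Pi; [exact: Fl|exact: cvg_cst].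
Qed.

Definition sbnd u := exists M, forall n, `|u n| <= M.

Lemma sbnd_ub u : sbnd u -> has_ubound (range u).
Proof. by case=> M uM; exists M => _ [n _ <-]; exact: le_trans (ler_norm _) (uM n). Qed.

Lemma sbnd_lb u : sbnd u -> has_lbound (range u).
Proof.
by case=> M uM; exists (- M) => _ [n _ <-]; have := uM n; rewrite ler_norml => /andP[].
Qed.

Lemma sbndN u : sbnd u -> sbnd (fun n => - u n).
Proof. by case=> M uM; exists M => n; rewrite normrN. Qed.

Lemma sups_ge u n m : sbnd u -> (n <= m)%N -> u m <= sups u n.
Proof.
by move=> bu nm; apply: ub_le_sup; [exact/has_ubound_sdrop/sbnd_ub|exists m].
Qed.

Lemma sups_le u n a : (forall m, (n <= m)%N -> u m <= a) -> sups u n <= a.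
Proof.
move=> ua; apply: ge_sup; first by exists (u n); exists n => /=.
by move=> _ [m /= nm <-]; exact: ua.
Qed.

Lemma cvg_sups_limsup u : sbnd u -> sups u @ \oo --> limn_sup u.
Proof.
move=> bu; have := cvg_sups_inf (sbnd_ub bu) (sbnd_lb bu).
by move=> h; rewrite /limn_sup (cvg_lim _ h).
Qed.

Lemma limsup_le_sups u n : sbnd u -> limn_sup u <= sups u n.
Proof.
move=> bu; have h := cvg_sups_inf (sbnd_ub bu) (sbnd_lb bu).
rewrite /limn_sup (cvg_lim _ h)//; apply: ge_inf; last by exists n.
case: (bu) => M uM; exists (- M) => _ [m _ <-]; apply: le_trans (sups_ge bu (leqnn m)).
by have := uM m; rewrite ler_norml => /andP[].
Qed.

Lemma limsup_le_near u a : sbnd u -> (\forall n \near \oo, u n <= a) -> limn_sup u <= a.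
Proof.
move=> bu [N _ uN]; apply: le_trans (limsup_le_sups N bu) _.
by apply: sups_le => m Nm; exact: uN.
Qed.

Lemma limsup_lt_near u (a : R) : sbnd u -> limn_sup u < a -> \forall n \near \oo, u n < a.
Proof.
move=> bu ua; have /cvgr_lt/(_ _ ua)[N _ sN] := cvg_sups_limsup bu.
exists N => // n /= Nn; apply: le_lt_trans (sups_ge bu Nn) _.
exact: (sN N (leqnn N)).
Qed.

Lemma limsup_le_eps u a : sbnd u ->
  (forall e : R, 0 < e -> \forall n \near \oo, u n <= a + e) -> limn_sup u <= a.
Proof.
by move=> bu h; apply/ler_addgt0Pr => e e0; apply: limsup_le_near => //; exact: h.
Qed.

Lemma limsup_abs u (M : R) : (forall n, `|u n| <= M) -> `|limn_sup u| <= M.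
Proof.
move=> uM; have bu : sbnd u by exists M.
rewrite ler_norml; apply/andP; split.
  have cs := cvg_sups_limsup bu.
  rewrite -(cvg_lim _ cs)//; apply: limr_ge; first by apply/cvg_ex; exists (limn_sup u).
  apply: nearW => n; apply: le_trans (sups_ge bu (leqnn n)).
  by have := uM n; rewrite ler_norml => /andP[].
apply: limsup_le_near => //; apply: nearW => n; exact: le_trans (ler_norm _) (uM n).
Qed.

(** [limn_sup] of [- u] is minus the lower limit, so the hypothesis says that the upper limit does
    not exceed the lower one. In this form lower limits are handled by applying upper bounds to
    [- u]. *)
Lemma limsup_cvg u : sbnd u -> limn_sup u + limn_sup (fun n => - u n) <= 0 ->
  u @ \oo --> limn_sup u.
Proof.
move=> bu h; apply/cvgrPdist_lt => e e0.
have h1 : limn_sup u < limn_sup u + e by rewrite ltrDl.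
have h2 : limn_sup (fun n => - u n) < - limn_sup u + e by lra.
have {}h1 := limsup_lt_near bu h1.
have {}h2 := limsup_lt_near (sbndN bu) h2.
near=> n.
have k1 : u n < limn_sup u + e by near: n.
have k2 : - u n < - limn_sup u + e by near: n.
by rewrite distrC ltr_norml; apply/andP; split; lra.
Unshelve. all: by end_near. Qed.

Lemma limsup_ge0 u : sbnd u -> 0 <= limn_sup u + limn_sup (fun n => - u n).
Proof.
move=> bu; rewrite leNgt; apply/negP => h.
pose e := - (limn_sup u + limn_sup (fun n => - u n)) / 2.
have e0 : 0 < e by rewrite /e; lra.
have h1 : limn_sup u < limn_sup u + e by rewrite ltrDl.
have h2 : limn_sup (fun n => - u n) < limn_sup (fun n => - u n) + e by rewrite ltrDl.
have [N _ {}h1] := limsup_lt_near bu h1.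
have [K _ {}h2] := limsup_lt_near (sbndN bu) h2.
have := h1 (maxn N K) (leq_maxl _ _); have := h2 (maxn N K) (leq_maxr _ _) => /=.
rewrite /e; lra.
Qed.

Lemma cvg_limsup u (l : R) : u @ \oo --> l -> limn_sup u = l.
Proof. by move=> /cvg_limn_inf_sup[]. Qed.

Lemma eq_limsup_near u v : sbnd u -> sbnd v -> (\forall n \near \oo, u n <= v n) ->
  limn_sup u <= limn_sup v.
Proof.
move=> bu bv uv; apply: limsup_le_eps => // e e0.
have /(limsup_lt_near bv) h : limn_sup v < limn_sup v + e by rewrite ltrDl.
near=> n; apply/ltW; apply: (@le_lt_trans _ _ (v n)); by near: n.
Unshelve. all: by end_near. Qed.

Lemma cvg_sbnd u (l : R) : u @ \oo --> l -> sbnd u.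
Proof.
move=> ul; have /cvg_seq_bounded [M [_ hM]] : cvgn u by apply/cvg_ex; exists l.
by exists (M + 1) => n; apply: hM => //; rewrite ltrDl.
Qed.

End LimSup.

Section Binom.
Context {R : realType}.

(* Binomial substitute for [N ^ k / k!], closed under summation: [\sum_(j <= N) bk k j = bk k.+1 N]. *)
Definition bk (k N : nat) : R := 'C(N + k, k)%:R.

Lemma bk_ge1 k N : 1 <= bk k N.
Proof. by rewrite ler1n bin_gt0 leq_addl. Qed.

Lemma bk_gt0 k N : 0 < bk k N.
Proof. exact: lt_le_trans ltr01 (bk_ge1 _ _). Qed.

Lemma bk_neq0 k N : bk k N != 0.
Proof. by rewrite gt_eqF// bk_gt0. Qed.

Lemma bk0 N : bk 0 N = 1.
Proof. by rewrite /bk bin0. Qed.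

Lemma bk_0 k : bk k 0 = 1.
Proof. by rewrite /bk add0n binn. Qed.

Lemma bkS k N : bk k.+1 N.+1 = bk k.+1 N + bk k N.+1.
Proof. by rewrite /bk -natrD addSn addnS binS addSn. Qed.

Lemma bk_sum k N : \sum_(j < N.+1) bk k j = bk k.+1 N.
Proof.
elim: N => [|N IH]; first by rewrite big_ord1 !bk_0.
by rewrite big_ord_recr /= IH bkS.
Qed.

Lemma bk_mulS k N : bk k.+1 N * k.+1%:R = bk k N * (N + k.+1)%:R.
Proof.
by rewrite /bk -!natrM; congr _%:R; have := mul_bin_diag (N + k.+1) k; rewrite addnS /= ; lia.
Qed.

Lemma bk_succ k N : bk k N.+1 * N.+1%:R = bk k N * (N.+1 + k)%:R.
Proof.
rewrite /bk -!natrM; congr _%:R.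
have := mul_bin_left (N + k).+1 k; have := mul_bin_diag (N + k).+1 k => /=.
have := bin_sub (leq_addl N k); have := bin_sub (leq_addl N.+1 k); rewrite !addnK => <- <-.
by have := mul_bin_diag (N.+1 + k) N => /=; rewrite addSn /=; lia.
Qed.

Lemma bk_leS k N : bk k N <= bk k N.+1.
Proof. by rewrite ler_nat addSn leq_bin2l. Qed.

Lemma bk_ge k N : N.+1%:R <= bk k.+1 N.
Proof.
rewrite -bk_sum; apply: (@le_trans _ _ (\sum_(j < N.+1) 1)).
  by rewrite sumr_const card_ord.
by apply: ler_sum => i _; exact: bk_ge1.
Qed.

Lemma cvg_natV : (fun N : nat => N.+1%:R^-1 : R) @ \oo --> (0 : R).
Proof. exact: cvg_harmonic. Qed.

Lemma bk_inv_cvg k : (fun N => (bk k.+1 N)^-1) @ \oo --> (0 : R).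
Proof.
apply: (@squeeze_cvgr _ _ _ _ (fun _ => 0) (fun N => N.+1%:R^-1)).
- apply: nearW => N; rewrite invr_ge0 ltW ?bk_gt0//= lef_pV2 ?posrE ?bk_gt0//.
  exact: bk_ge.
- exact: cvg_cst.
- exact: cvg_natV.
Qed.

Lemma bk_ratio k : (fun N => bk k N / bk k N.+1) @ \oo --> (1 : R).
Proof.
have E N : bk k N / bk k N.+1 = 1 - (k%:R * (N.+1 + k)%:R^-1).
  have h : (N.+1 + k)%:R != 0 :> R by rewrite pnatr_eq0.
  apply: (mulIf (bk_neq0 k N.+1)); rewrite divfK ?bk_neq0//.
  apply: (mulIf h); rewrite -bk_succ mulrBl mulrBl mul1r.
  rewrite [_ / _ * _]mulrAC divfK// -[k%:R * _]mulrC -mulrBr; congr (_ * _).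
  by rewrite natrD addrK.
apply: (eq_cvgn (m := 1 - 0) _ E (esym (subr0 1))); apply: cvgB; first exact: cvg_cst.
rewrite -[X in _ --> X](mulr0 (k%:R)); apply: cvgMl_tmp.
apply: (@squeeze_cvgr _ _ _ _ (fun _ => 0) (fun N => N.+1%:R^-1)).
- apply: nearW => N; rewrite invr_ge0 ler0n/= lef_pV2 ?posrE ?ltr0n ?addSn// ler_nat.
  by rewrite ltnS leq_addr.
- exact: cvg_cst.
- exact: cvg_natV.
Qed.

Lemma bk_low k (K : nat) : (k < K)%N -> (fun N => bk k N / bk K N) @ \oo --> (0 : R).
Proof.
move=> kK.
have E1 j N : bk j N / bk j.+1 N <= j.+1%:R * N.+1%:R^-1 :> R.
  have h : (N + j.+1)%:R != 0 :> R by rewrite pnatr_eq0 addnS.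
  have -> : bk j N / bk j.+1 N = j.+1%:R * (N + j.+1)%:R^-1 :> R.
    apply: (mulIf (bk_neq0 j.+1 N)); rewrite divfK ?bk_neq0//; apply: (mulIf h).
    by rewrite -bk_mulS mulrAC divfK// mulrC.
  by rewrite ler_pM2l ?ltr0n// lef_pV2 ?posrE ?ltr0n ?addnS// ler_nat ltnS leq_addr.
have E2 j N : bk j N <= bk j.+1 N :> R.
  rewrite -bk_sum big_ord_recr /= lerDr; apply: sumr_ge0 => i _; exact/ltW/bk_gt0.
have E3 N : bk k.+1 N <= bk K N :> R.
  elim: K kK => // K IH; rewrite ltnS leq_eqVlt => /orP[/eqP->//|/IH h].
  exact: le_trans h (E2 _ _).
apply: (@squeeze_cvgr _ _ _ _ (fun _ => 0) (fun N => k.+1%:R * N.+1%:R^-1)).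
- apply: nearW => N; rewrite divr_ge0 ?(ltW (bk_gt0 _ _))//=.
  apply: le_trans (E1 k N); rewrite ler_pM2l ?bk_gt0// lef_pV2 ?posrE ?bk_gt0//.
- exact: cvg_cst.
- rewrite -[X in _ --> X](mulr0 (k.+1%:R)); apply: cvgMl_tmp; exact: cvg_natV.
Qed.

(** One-sided Stolz-Cesaro. As [bk k.+1] is the exact sum of [bk k], the good terms add up to at
    most [(L + e / 2) * bk k.+1 N]; the finitely many others cost a constant, negligible against
    [bk k.+1]. *)
Lemma stolz_limsup k (a : nat -> R) (L : R) :
  sbnd (fun N => (\sum_(j < N.+1) a j) / bk k.+1 N) ->
  (forall e : R, 0 < e -> \forall n \near \oo, a n <= (L + e) * bk k n) ->
  limn_sup (fun N => (\sum_(j < N.+1) a j) / bk k.+1 N) <= L.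
Proof.
move=> bd ha; apply: limsup_le_eps => // e e0.
have e20 : 0 < e / 2 by lra.
have [J _ aJ] := ha _ e20.
pose C := \sum_(j < J) `|a j - (L + e / 2) * bk k j|.
have C0 : 0 <= C by apply: sumr_ge0 => i _.
have le1 N : \sum_(j < N.+1) a j <= C + (L + e / 2) * bk k.+1 N.
  rewrite -bk_sum mulr_sumr -lerBlDr -sumrB.
  have -> : C = \sum_(0 <= j < J) `|a j - (L + e / 2) * bk k j| by rewrite big_mkord.
  rewrite -(big_mkord xpredT (fun j => a j - (L + e / 2) * bk k j)).
  have [NJ|JN] := leqP N.+1 J.
    rewrite [leRHS](big_cat_nat _ NJ)//= -[leLHS]addr0 lerD//.
      by apply: ler_sum => i _; exact: ler_norm.
    by apply: sumr_ge0 => i _.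
  rewrite (big_cat_nat _ (ltnW JN))//= -[leRHS]addr0 lerD//.
    by apply: ler_sum => i _; exact: ler_norm.
  rewrite big_nat; apply: sumr_le0 => i /andP[Ji _].
  by rewrite subr_le0; exact: aJ.
have cC : (fun N => C * (bk k.+1 N)^-1) @ \oo --> (0 : R).
  by rewrite -[X in _ --> X](mulr0 C); apply: cvgMl_tmp; exact: bk_inv_cvg.
have {cC} [M _ hM] : \forall n \near \oo, C * (bk k.+1 n)^-1 < e / 2 by exact: (cvgr_lt _ cC).
exists M => // N /= MN; rewrite ler_pdivrMr ?bk_gt0//.
apply: (le_trans (le1 N)).
have := hM _ MN; rewrite /= ltr_pdivrMr ?bk_gt0// => h.
have -> : (L + e) * bk k.+1 N = e / 2 * bk k.+1 N + (L + e / 2) * bk k.+1 N by field.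
by rewrite lerD2r ltW.
Qed.

End Binom.

(** * Positive operators on vector functions *)

Section BoundedMeasurable.
Context d (X : measurableType d) (R : realType) (nu : probability X R).
Implicit Types (f g : X -> R).

(** The bound holds everywhere, not just almost everywhere, so that upper limits are finite at every
    point; integrability over a probability is then automatic. *)
Definition bm f := measurable_fun setT f /\ exists M, forall x, `|f x| <= M.

Definition EE f : R := \int[nu]_x f x.

Definition aecvg (u : nat -> X -> R) g := {ae nu, forall x, u ^~ x @ \oo --> g x}.

Lemma bm_cst (c : R) : bm (fun=> c).
Proof. by split; [exact: measurable_cst|exists `|c|]. Qed.

Lemma bmD f g : bm f -> bm g -> bm (fun x => f x + g x).
Proof.
move=> [mf [M fM]] [mg [N gN]]; split; first exact: measurable_funD.
by exists (M + N) => x; exact: le_trans (ler_normD _ _) (lerD (fM x) (gN x)).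
Qed.

Lemma bmM f g : bm f -> bm g -> bm (fun x => f x * g x).
Proof.
move=> [mf [M fM]] [mg [N gN]]; split; first exact: measurable_funM.
by exists (M * N) => x; rewrite normrM ler_pM.
Qed.

Lemma bmZ (a : R) f : bm f -> bm (fun x => a * f x).
Proof. by move=> bf; apply: bmM => //; exact: bm_cst. Qed.

Lemma bmN f : bm f -> bm (fun x => - f x).
Proof.
by move=> /(bmZ (-1)); rewrite (_ : (fun x => -1 * f x) = (fun x => - f x))//;
  apply/funext => x; rewrite mulN1r.
Qed.

Lemma bmB f g : bm f -> bm g -> bm (fun x => f x - g x).
Proof. by move=> bf bg; apply: bmD => //; exact: bmN. Qed.

Lemma bm_max f g : bm f -> bm g -> bm (fun x => Num.max (f x) (g x)).
Proof.
move=> [mf [M fM]] [mg [N gN]]; split; first exact: measurable_maxr.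
by exists (Num.max M N) => x; case: (leP (f x) (g x)) => _; rewrite le_max ?fM ?gN ?orbT.
Qed.

Lemma bm_sum (I : Type) (r : seq I) (F : I -> X -> R) :
  (forall i, bm (F i)) -> bm (fun x => \sum_(i <- r) F i x).
Proof.
move=> bF; elim: r => [|i r IH].
  by under eq_fun do rewrite big_nil; exact: bm_cst.
by under eq_fun do rewrite big_cons; exact: bmD.
Qed.

Lemma bm_limsup (u : nat -> X -> R) (M : R) :
  (forall n, measurable_fun setT (u n)) -> (forall n x, `|u n x| <= M) ->
  bm (fun x => limn_sup (u ^~ x)).
Proof.
move=> mu uM; split.
  apply: measurable_fun_limn_sup => // x _; [apply: sbnd_ub|apply: sbnd_lb]; by exists M.
by exists M => x; apply: limsup_abs.
Qed.

Lemma bm_sups (u : nat -> X -> R) (M : R) J :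
  (forall n, measurable_fun setT (u n)) -> (forall n x, `|u n x| <= M) ->
  bm (fun x => sups (u ^~ x) J).
Proof.
move=> mu uM; split.
  by apply: measurable_fun_sups => // x _; apply: sbnd_ub; exists M.
exists M => x; rewrite ler_norml; apply/andP; split.
  apply: (@le_trans _ _ (u J x)); last by apply: sups_ge => //; exists M.
  by have := uM J x; rewrite ler_norml => /andP[].
by apply: sups_le => m _; exact: le_trans (ler_norm _) (uM m x).
Qed.

Lemma bm_pos f : bm f -> bm (fun x => (0 < f x)%R%:R).
Proof.
move=> [mf _]; split; last by exists 1 => x; case: (0 < f x); rewrite ?normr1 ?normr0.
have := measurable_fun_ltr (measurable_cst (0 : R)) mf => mb.
have -> : (fun x => (0 < f x)%R%:R) = (fun x => if (0 < f x)%R then 1 else 0 : R).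
  by apply/funext => x; case: (0 < f x).
by apply: measurable_fun_ifT => //; exact: measurable_cst.
Qed.

Lemma bm_int f : bm f -> nu.-integrable setT (EFin \o f).
Proof.
move=> [mf [M fM]]; apply: measurable_bounded_integrable => //.
  exact: le_lt_trans (probability_le1 nu measurableT) (ltry _).
exists M; split; first exact: num_real.
by move=> y My x _; exact: le_trans (fM x) (ltW My).
Qed.

Lemma EED f g : bm f -> bm g -> EE (fun x => f x + g x) = EE f + EE g.
Proof. by move=> bf bg; rewrite /EE RintegralD//; exact: bm_int. Qed.

Lemma EEZ (a : R) f : bm f -> EE (fun x => a * f x) = a * EE f.
Proof. by move=> bf; rewrite /EE RintegralZl//; exact: bm_int. Qed.

Lemma EEB f g : bm f -> bm g -> EE (fun x => f x - g x) = EE f - EE g.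
Proof. by move=> bf bg; rewrite /EE RintegralB//; exact: bm_int. Qed.

Lemma EEN f : bm f -> EE (fun x => - f x) = - EE f.
Proof.
move=> bf; rewrite -[RHS]mulN1r -EEZ//; congr EE; apply/funext => x; by rewrite mulN1r.
Qed.

Lemma EE_cst (c : R) : EE (fun=> c) = c.
Proof.
rewrite /EE Rintegral_cst//; transitivity (c * fine 1%E); last by rewrite mulr1.
by congr (_ * fine _); exact: probability_setT.
Qed.

Lemma EE_le f g : bm f -> bm g -> (forall x, f x <= g x) -> EE f <= EE g.
Proof. by move=> bf bg fg; apply: le_Rintegral => //; exact: bm_int. Qed.

Lemma EE_ge0 f : (forall x, 0 <= f x) -> 0 <= EE f.
Proof. by move=> f0; apply: Rintegral_ge0. Qed.

Lemma EE_ae f g : bm f -> bm g -> {ae nu, forall x, f x = g x} -> EE f = EE g.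
Proof.
move=> [mf _] [mg _] fg; rewrite /EE /Rintegral; congr fine.
apply: ae_eq_integral => //; [exact/measurable_EFinP|exact/measurable_EFinP|].
by apply: filterS fg => x -> .
Qed.

Lemma EE_le_ae f g : bm f -> bm g -> {ae nu, forall x, f x <= g x} -> EE f <= EE g.
Proof.
move=> bf bg fg.
have bm' : bm (fun x => Num.max (f x) (g x)) by exact: bm_max.
rewrite -(EE_ae (g := g) bm')//; last by apply: filterS fg => x /max_idPr.
by apply: EE_le => // x; rewrite le_max lexx.
Qed.

Lemma EE_dct (u : nat -> X -> R) g (M : R) :
  (forall n, measurable_fun setT (u n)) -> (forall n x, `|u n x| <= M) ->
  measurable_fun setT g -> aecvg u g -> (fun n => EE (u n)) @ \oo --> EE g.
Proof.
move=> mu uM mg ug.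
have [ig _ h] : [/\ nu.-integrable setT (EFin \o g),
  [sequence (\int[nu]_x `|(EFin \o u n) x - (EFin \o g) x|)%E]_n @ \oo --> 0%E &
  [sequence (\int[nu]_x ((EFin \o u n) x))%E]_n @ \oo --> (\int[nu]_x ((EFin \o g) x))%E].
  apply: (@dominated_convergence _ _ _ nu setT measurableT (fun n => EFin \o u n) _
    (EFin \o (fun=> M))) => //.
  - by move=> n; exact/measurable_EFinP.
  - exact/measurable_EFinP.
  - by apply: filterS ug => x h _; apply/cvg_EFin; [exact: nearW|exact: h].
  - exact/bm_int/bm_cst.
  - by apply: aeW => x n _; rewrite lee_fin.
rewrite /EE /Rintegral.
have fi : (\int[nu]_x ((EFin \o g) x))%E \is a fin_num by apply: integrable_fin_num.
apply: fine_cvg; rewrite fineK//; exact: h.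
Qed.

Lemma EE_eq0 f : bm f -> {ae nu, forall x, 0 <= f x} -> EE f <= 0 ->
  {ae nu, forall x, f x = 0}.
Proof.
move=> bf f0 Ef.
have bg : bm (fun x => Num.max 0 (f x)) by apply: bm_max => //; exact: bm_cst.
have fg : {ae nu, forall x, Num.max 0 (f x) = f x} by apply: filterS f0 => x /max_idPr.
have Eg : EE (fun x => Num.max 0 (f x)) <= 0 by rewrite (EE_ae (g := f) bg bf).
suff : ae_eq nu setT (EFin \o (fun x => Num.max 0 (f x))) (cst 0%E).
  by apply: filterS2 fg => x e1 /(_ I); rewrite /= e1 => -[].
apply/ae_eq_integral_abs => //; first by apply/measurable_EFinP; case: bg.
under eq_integral => x _ do rewrite /= ger0_norm ?le_max ?lexx//.
have := integrable_fin_num measurableT (bm_int bg) => /= fi.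
rewrite -(fineK fi); congr EFin; apply/eqP; rewrite eq_le Eg/=.
by apply: EE_ge0 => x; rewrite le_max lexx.
Qed.

Lemma ae_cst (P : Prop) : {ae nu, X -> P} -> P.
Proof.
move=> h; have [x px] : exists x : X, P.
  apply: (@filter_ex _ (almost_everywhere nu)) => //.
  apply: ae_properfilter_algebraOfSetsType.
  apply: (@lt_le_trans _ _ 1%E); first exact: lte01.
  by rewrite le_eqVlt; apply/orP; left; apply/eqP/esym; exact: probability_setT.
exact: px.
Qed.

Section VectorOperators.
Variable V : finType.
Implicit Types (F G : V -> X -> R).

(* Abstracts the operators [F w x |-> \sum_e F (src e) (T_e x)], the sum over the arcs [e] into [w];
   [A v w] counts the arcs from [v] to [w]. *)
Record vop (A : V -> V -> R) (Op : (V -> X -> R) -> V -> X -> R) : Prop := Vop {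
  vop_ge0 : forall v w, 0 <= A v w;
  vop_lin : forall a F G w x,
    Op (fun v x => a * F v x + G v x) w x = a * Op F w x + Op G w x;
  vop_mono : forall F G, (forall v x, F v x <= G v x) -> forall w x, Op F w x <= Op G w x;
  vop_cst : forall (u : V -> R) w x, Op (fun v _ => u v) w x = \sum_v u v * A v w;
  vop_meas : forall F, (forall v, measurable_fun setT (F v)) ->
    forall w, measurable_fun setT (Op F w);
  vop_int : forall F, (forall v, bm (F v)) ->
    forall w, EE (Op F w) = \sum_v EE (F v) * A v w;
  vop_cvg : forall (u : nat -> V -> X -> R) G, (forall v, aecvg (u ^~ v) (G v)) ->
    forall w, aecvg (fun n => Op (u n) w) (Op G w) }.

Context (A : V -> V -> R) (Op : (V -> X -> R) -> V -> X -> R) (H : vop A Op).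

Lemma vop0 w x : Op (fun _ _ => 0) w x = 0.
Proof. by rewrite (vop_cst H (fun=> 0)) big1// => v _; rewrite mul0r. Qed.

Lemma vopD F G w x : Op (fun v x => F v x + G v x) w x = Op F w x + Op G w x.
Proof.
have := vop_lin H 1 F G w x; rewrite mul1r => <-; congr (Op _ w x).
by apply/funext => v; apply/funext => y; rewrite mul1r.
Qed.

Lemma vopZ (a : R) F w x : Op (fun v x => a * F v x) w x = a * Op F w x.
Proof.
have := vop_lin H a F (fun _ _ => 0) w x; rewrite vop0 addr0 => <-; congr (Op _ w x).
by apply/funext => v; apply/funext => y; rewrite addr0.
Qed.

Lemma vopN F w x : Op (fun v x => - F v x) w x = - Op F w x.
Proof.
rewrite -mulN1r -vopZ; congr (Op _ w x).
by apply/funext => v; apply/funext => y; rewrite mulN1r.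
Qed.

Lemma vop_pos F : (forall v x, 0 <= F v x) -> forall w x, 0 <= Op F w x.
Proof. by move=> F0 w x; rewrite -(vop0 w x); apply: (vop_mono H). Qed.

Lemma vop_abs F (u : V -> R) : (forall v x, `|F v x| <= u v) ->
  forall w x, `|Op F w x| <= \sum_v u v * A v w.
Proof.
move=> Fu w x; rewrite -(vop_cst H u w x) ler_norml -vopN; apply/andP; split;
  apply: (vop_mono H) => v y; have := Fu v y; by rewrite ler_norml => /andP[].
Qed.

Lemma bm_unif F : (forall v, bm (F v)) -> exists2 M, 0 <= M & forall v x, `|F v x| <= M.
Proof.
move=> bF.
have /choice[M hM] : forall v, exists M, forall x, `|F v x| <= M by move=> v; case: (bF v).
exists (\sum_v `|M v|); first by apply: sumr_ge0.
move=> v x; apply: (le_trans (hM v x)); apply: (le_trans (ler_norm _)).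
by rewrite (bigD1 v)//= lerDl; apply: sumr_ge0.
Qed.

Lemma vop_bm F : (forall v, bm (F v)) -> forall w, bm (Op F w).
Proof.
move=> bF w; split; first by apply: (vop_meas H) => v; case: (bF v).
have [M _ FM] := bm_unif bF.
by eexists => x; exact: (vop_abs (u := fun=> M)).
Qed.

(** [Op] acts on functions rather than on classes. That it respects null sets is [vop_cvg] for the
    constant sequence [F], followed by uniqueness of limits. *)
Lemma vop_ae_eq F G : (forall v, {ae nu, forall x, F v x = G v x}) ->
  forall w, {ae nu, forall x, Op F w x = Op G w x}.
Proof.
move=> FG w; have : aecvg (fun=> Op F w) (Op G w).
  apply: (vop_cvg H (u := fun=> F)) => v; apply: filterS (FG v) => x ->; exact: cvg_cst.
apply: filterS => x h; apply: (cvg_unique _ _ h) => //; exact: cvg_cst.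
Qed.

(** [vop_mono] asks for an inequality everywhere: the maximum of [F] and [G] dominates [F]
    everywhere and equals [G] almost everywhere. *)
Lemma vop_ae_le F G : (forall v, {ae nu, forall x, F v x <= G v x}) ->
  forall w, {ae nu, forall x, Op F w x <= Op G w x}.
Proof.
move=> FG w.
have h : {ae nu, forall x, Op (fun v x => Num.max (F v x) (G v x)) w x = Op G w x}.
  by apply: vop_ae_eq => v; apply: filterS (FG v) => x /max_idPr.
apply: filterS h => x <-; apply: (vop_mono H) => v y; by rewrite le_max lexx.
Qed.

(** A reverse Fatou lemma: [Op (u n)] is eventually below [Op] of the tail supremum from [m], and
    the tail suprema converge to the upper limit, so [vop_cvg] applies. *)
Lemma vop_limsup (u : nat -> V -> X -> R) (M : R) : (forall n v x, `|u n v x| <= M) ->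
  forall w, {ae nu, forall x, limn_sup (fun n => Op (u n) w x) <=
    Op (fun v x => limn_sup (fun n => u n v x)) w x}.
Proof.
move=> uM w; have bu v x : sbnd (fun n => u n v x) by exists M.
pose g m v x := sups (fun n => u n v x) m.
have : aecvg (fun m => Op (g m) w) (Op (fun v x => limn_sup (fun n => u n v x)) w).
  by apply: (vop_cvg H) => v; apply: aeW => x; exact: cvg_sups_limsup.
apply: filterS => x hx; rewrite -(cvg_lim _ hx)//; apply: limr_ge.
  by apply/cvg_ex; eexists; exact: hx.
apply: nearW => m; apply: limsup_le_near.
  by eexists => n; apply: (vop_abs (u := fun=> M)).
exists m => // n /= mn; apply: (vop_mono H) => v y; exact: sups_ge.
Qed.

(** Passing to upper limits in a recursion leaves only an inequality, since [vop_limsup] is one. It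
    becomes an equality through an invariant integral in [limsup_shift_eq], and is iterated in
    [subcritical_source]. *)
Lemma limsup_step (u r : nat -> V -> X -> R) (b : nat -> R) (rl : V -> X -> R) (M : R) :
  (forall n v x, `|u n v x| <= M) -> b @ \oo --> (1 : R) ->
  (forall v, aecvg (r ^~ v) (rl v)) ->
  (forall n v x, u n.+1 v x = b n * Op (u n) v x + r n v x) ->
  forall v, {ae nu, forall x, limn_sup (fun n => u n v x) <=
    Op (fun v x => limn_sup (fun n => u n v x)) v x + rl v x}.
Proof.
move=> uM b1 rrl ustep v.
have bu x : sbnd (fun n => u n v x) by exists M.
have OpM n x : `|Op (u n) v x| <= \sum_w M * A w v by apply: (vop_abs (u := fun=> M)).
set Q := \sum_w _ in OpM.
apply: filterS2 (rrl v) (vop_limsup uM v) => x rx lx.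
set U := Op _ v x in lx *.
apply: limsup_le_eps => // e e0.
have e20 : 0 < e / 2 by lra.
(* Replacing [b n] by 1 costs [(b n - 1) * Op (u n)], which vanishes because [Op (u n)] is bounded
   by [Q]. *)
have h1 : (fun n => (b n - 1) * Op (u n) v x + r n v x) @ \oo --> rl v x.
  apply: (eq_cvgn (m := 0 + rl v x) _ (fun=> erefl)); last by rewrite add0r.
  apply: cvgD => //; apply: norm_cvg0.
  apply: (@squeeze_cvgr _ _ _ _ (fun _ => 0) (fun n => `|b n - 1| * Q)).
  - by apply: nearW => n; rewrite normr_ge0/= normrM ler_wpM2l.
  - exact: cvg_cst.
  - rewrite -[X in _ --> X](mul0r Q); apply: cvgMr_tmp; rewrite -[X in _ --> X](@normr0 _ R).
    apply: cvg_norm; rewrite -[X in _ --> X](subrr 1); apply: cvgB => //; exact: cvg_cst.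
have [N1 _ h2] : \forall n \near \oo,
    (b n - 1) * Op (u n) v x + r n v x < rl v x + e / 2.
  by apply: (cvgr_lt _ h1); rewrite ltrDl.
have [N2 _ h3] : \forall n \near \oo, Op (u n) v x < U + e / 2.
  apply: limsup_lt_near; first by exists Q.
  by apply: (le_lt_trans lx); rewrite ltrDl.
exists (maxn N1 N2).+1 => // -[//|n] /=; rewrite ltnS geq_max => /andP[n1 n2].
rewrite ustep; have := h2 _ n1; have := h3 _ n2 => /=; lra.
Qed.

End VectorOperators.
End BoundedMeasurable.

Arguments vop {d X R} nu {V} A Op.

(** * Ergodic theorem for recursions with a source *)

Section Sources.
Context d (X : measurableType d) (R : realType) (nu : probability X R) (V : finType).
Context (A : V -> V -> R) (Op : (V -> X -> R) -> V -> X -> R) (H : vop nu A Op).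
Implicit Types (F : nat -> V -> X -> R) (f : V -> X -> R).

(* The partial sums of [Phi_{n+1} = Op Phi_n] satisfy this recursion inside a strongly connected
   component, [F] collecting what flows in from the rest of the graph. *)
Fixpoint Srec F N : V -> X -> R :=
  if N is n.+1 then fun v x => Op (Srec F n) v x + F n.+1 v x else F 0%N.

Lemma Srec_mono F G : (forall N v x, F N v x <= G N v x) ->
  forall N v x, Srec F N v x <= Srec G N v x.
Proof.
move=> FG; elim=> [|N IH] v x /=; first exact: FG.
by apply: lerD => //; apply: (vop_mono H).
Qed.

Lemma SrecD F G N v x : Srec (fun N v x => F N v x + G N v x) N v x =
  Srec F N v x + Srec G N v x.
Proof.
elim: N v x => [|N IH] v x //=.
rewrite addrACA -(vopD H); congr (Op _ v x + _).
by apply/funext => w; apply/funext => y; exact: IH.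
Qed.

Lemma SrecN F N v x : Srec (fun N v x => - F N v x) N v x = - Srec F N v x.
Proof.
elim: N v x => [|N IH] v x //=.
rewrite opprD -(vopN H); congr (Op _ v x + _).
by apply/funext => w; apply/funext => y; exact: IH.
Qed.

Lemma Srec_bm F : (forall N v, bm (F N v)) -> forall N v, bm (Srec F N v).
Proof.
move=> bF; elim=> [|N IH] v //=; apply: bmD => //.
exact: (vop_bm H).
Qed.

(** A maximum principle: the second hypothesis makes [s] a supersolution, with room for the new
    source after [A] has acted on the old bound. *)
Lemma Srec_abs F (s : nat -> V -> R) : (forall v x, `|F 0%N v x| <= s 0%N v) ->
  (forall N v x, `|F N.+1 v x| <= s N.+1 v - \sum_w s N w * A w v) ->
  forall N v x, `|Srec F N v x| <= s N v.
Proof.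
move=> F0 Fs; elim=> [|N IH] v x //=.
apply: (le_trans (ler_normD _ _)); rewrite -lerBrDl.
apply: le_trans (Fs N v x) _; rewrite lerB//.
exact: (vop_abs H).
Qed.

(** [Srec F N] is the sum over [j] of the iterate of order [N - j] of [Op] applied to [F j], a
    convolution in time, and summation in time commutes with convolution. *)
Lemma Srec_sum F N v x : Srec (fun N v x => \sum_(j < N.+1) F j v x) N v x =
  \sum_(j < N.+1) Srec F j v x.
Proof.
elim: N v x => [|N IH] v x; first by rewrite big_ord1 /= big_ord1.
rewrite [RHS]big_ord_recl /= [in LHS]big_ord_recl /= addrCA; congr (_ + _).
rewrite big_split /=; congr (_ + _).
rewrite (_ : Srec _ N = fun v x => \sum_(j < N.+1) Srec F j v x); last first.
  by apply/funext => w; apply/funext => y; exact: IH.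
elim: N.+1 => [|n IHn]; first by rewrite big_ord0; under [in LHS]eq_fun do
  under eq_fun do rewrite big_ord0; exact: (vop0 H).
rewrite big_ord_recr /= -IHn -(vopD H); congr (Op _ v x).
by apply/funext => w; apply/funext => y; rewrite big_ord_recr.
Qed.

(** * Radius 1: invariant integral, Garsia's inequality and sources of polynomial order *)

Section Bistochastic.
Context (c h : V -> R) (c0 : forall v, 0 < c v) (h0 : forall v, 0 < h v).
Hypothesis cA : forall w, \sum_v c v * A v w = c w.
Hypothesis Ah : forall v, \sum_w A v w * h w = h v.

(** By [Ah] this integral is preserved by [Op], while [cA] makes the constants [c v] a fixed point
    of [Op]. They play the parts of the invariant measure and of the constant function 1 in an
    ordinary measure-preserving system. *)
Definition II f := \sum_v h v * EE nu (f v).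

Lemma II_Op f : (forall v, bm (f v)) -> II (Op f) = II f.
Proof.
move=> bf; rewrite /II; under eq_bigr do rewrite (vop_int H)// mulr_sumr.
rewrite exchange_big /=; apply: eq_bigr => v _.
by rewrite -[in RHS]Ah mulr_suml; apply: eq_bigr => w _; ring.
Qed.

Lemma II_le f g : (forall v, bm (f v)) -> (forall v, bm (g v)) ->
  (forall v, {ae nu, forall x, f v x <= g v x}) -> II f <= II g.
Proof.
move=> bf bg fg; apply: ler_sum => v _; rewrite ler_pM2l//; exact: EE_le_ae.
Qed.

Lemma IIB f g : (forall v, bm (f v)) -> (forall v, bm (g v)) ->
  II (fun v x => f v x - g v x) = II f - II g.
Proof.
move=> bf bg; rewrite /II -sumrB; apply: eq_bigr => v _; by rewrite EEB// mulrBr.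
Qed.

Lemma IID f g : (forall v, bm (f v)) -> (forall v, bm (g v)) ->
  II (fun v x => f v x + g v x) = II f + II g.
Proof.
move=> bf bg; rewrite /II -big_split; apply: eq_bigr => v _; by rewrite EED// mulrDr.
Qed.

Lemma II_eq0 f : (forall v, bm (f v)) -> (forall v, {ae nu, forall x, 0 <= f v x}) ->
  II f <= 0 -> forall v, {ae nu, forall x, f v x = 0}.
Proof.
move=> bf f0 If v; apply: EE_eq0 => //.
have E0 w : 0 <= h w * EE nu (f w).
  rewrite pmulr_rge0// -(EE_cst nu 0); apply: EE_le_ae => //; exact: bm_cst.
rewrite -(pmulr_rle0 _ (h0 v)); apply: le_trans If.
by rewrite /II (bigD1 v)//= lerDl; apply: sumr_ge0 => w _.
Qed.

Lemma dom_c f : (forall v, bm (f v)) ->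
  exists2 Q, 0 <= Q & forall v x, `|f v x| <= Q * c v.
Proof.
move=> bf; have [M M0 fM] := bm_unif bf.
have Mc v : 0 <= M / c v by rewrite divr_ge0// ltW.
exists (\sum_v M / c v) => [|v x]; first by apply: sumr_ge0.
apply: (le_trans (fM v x)); rewrite -ler_pdivrMr//.
by rewrite (bigD1 v)//= lerDl; apply: sumr_ge0.
Qed.

Lemma dom_c_seq F (b : nat -> R) (M : R) : (forall n, 0 < b n) ->
  (forall N v x, `|F N v x| <= M * b N) ->
  exists2 Q, 0 <= Q & forall N v x, `|F N v x| <= Q * b N * c v.
Proof.
move=> b0 FM.
have Mc v : 0 <= `|M| / c v by rewrite divr_ge0// ltW.
exists (\sum_v `|M| / c v) => [|N v x]; first by apply: sumr_ge0.
apply: (le_trans (FM N v x)); rewrite -ler_pdivrMr// [leRHS]mulrC [leLHS]mulrAC mulrC.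
rewrite ler_pM2r//; apply: (@le_trans _ _ (`|M| / c v)).
  by rewrite ler_pM2r ?invr_gt0// ler_norm.
by rewrite (bigD1 v)//= lerDl; apply: sumr_ge0.
Qed.

(** [Q * bk k.+1 N * c v] solves the recursion with source [Q * bk k N * c v] exactly: [cA] fixes
    [c], and Pascal's rule [bkS] gives the increment. *)
Lemma Srec_bk F k Q : (forall N v x, `|F N v x| <= Q * bk k N * c v) ->
  forall N v x, `|Srec F N v x| <= Q * bk k.+1 N * c v.
Proof.
move=> FQ; apply: Srec_abs => [v x|N v x].
  by rewrite bk_0 -(bk_0 k); exact: FQ.
under eq_bigr do rewrite -mulrA; rewrite -mulr_sumr cA bkS -mulrBl -mulrBr addrAC subrr add0r.
exact: FQ.
Qed.

(** [Op U - U] is nonnegative almost everywhere and has zero [II], and [h] is positive, so it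
    vanishes almost everywhere. *)
Lemma limsup_shift_eq (u : nat -> V -> X -> R) (M : R) (U := fun v x => limn_sup (fun n => u n v x)) :
  (forall n v, measurable_fun setT (u n v)) ->
  (forall n v x, `|u n v x| <= M) ->
  (forall v, {ae nu, forall x, U v x <= Op U v x}) ->
  forall v, {ae nu, forall x, Op U v x = U v x}.
Proof.
move=> mu uM le.
have bU v : bm (U v) by apply: (bm_limsup (M := M)).
have bOU : forall v, bm (Op U v) by exact: (vop_bm H).
have := II_eq0 (fun v => bmB (bOU v) (bU v)).
rewrite IIB// II_Op// subrr lexx => k v.
have {}k : {ae nu, forall x, Op U v x - U v x = 0}.
  by apply: k => // w; apply: filterS (le w) => x; rewrite subr_ge0.
by apply: filterS k => x /eqP; rewrite subr_eq0 => /eqP.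
Qed.

Section Ergodic.
Context (f : V -> X -> R) (bf : forall v, bm (f v)).

(** [Sn n] is the ergodic sum of [f], [Op f] and so on up to the [n]-th iterate; the normalization
    [bk 1 n] below is its number of terms, [n + 1]. *)
Definition Sn n := Srec (fun _ => f) n.
Definition fbar v x := limn_sup (fun n => Sn n v x / bk 1 n).

Lemma Sn_bm n v : bm (Sn n v).
Proof. exact: Srec_bm. Qed.

Lemma Sn_bnd : exists M, forall n v x, `|Sn n v x / bk 1 n| <= M.
Proof.
have [Q Q0 fQ] := dom_c bf.
exists (\sum_v Q * c v) => n v x.
rewrite normrM normfV (gtr0_norm (bk_gt0 _ _)) ler_pdivrMr ?bk_gt0//.
apply: (@le_trans _ _ (Q * bk 1 n * c v)).
  by apply: Srec_bk => N w y; rewrite bk0 mulr1.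
rewrite mulrAC ler_pM2r ?bk_gt0// (bigD1 v)//= lerDl.
by apply: sumr_ge0 => w _; rewrite mulr_ge0// ltW.
Qed.

Lemma fbar_bm v : bm (fbar v).
Proof.
have [M hM] := Sn_bnd; apply: (bm_limsup (M := M)) => // n.
have := Sn_bm n v => /(bmZ (bk 1 n)^-1)[+ _].
by congr (measurable_fun _ _); apply/funext => x; rewrite mulrC.
Qed.

Lemma fbar_inv v : {ae nu, forall x, Op fbar v x = fbar v x}.
Proof.
have [M hM] := Sn_bnd.
apply: (limsup_shift_eq (u := fun n v x => Sn n v x / bk 1 n) (M := M)) => //.
  move=> n w; have := Sn_bm n w => /(bmZ (bk 1 n)^-1)[+ _].
  by congr (measurable_fun _ _); apply/funext => x; rewrite mulrC.
move=> w.
suff : {ae nu, forall x, limn_sup (fun n => Sn n w x / bk 1 n) <= Op fbar w x + 0}.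
  by apply: filterS => x; rewrite addr0.
apply: (limsup_step H hM (bk_ratio 1) (r := fun n v x => f v x / bk 1 n.+1) (rl := fun _ _ => 0)).
- move=> v'; apply: aeW => x.
  apply: (eq_cvgn (v := fun n => f v' x * (bk 1 n.+1)^-1) (m := f v' x * 0)) => //; last by rewrite mulr0.
  by apply: cvgMl_tmp; have := bk_inv_cvg 0 (R := R); rewrite -cvg_shiftS.
- move=> n v' x; rewrite -[Sn n.+1 v' x]/(Op (Sn n) v' x + f v' x) -(vopZ H) mulrDl.
  congr (_ + _); rewrite mulrC -(vopZ H).
  congr (Op _ v' x); apply/funext => y; apply/funext => z.
  have := bk_neq0 1 n (R := R); have := bk_neq0 1 n.+1 (R := R).
  by move=> ? ?; field; apply/andP.
Qed.

(* Garsia's maximal argument: on [{m_{n+1} > 0}] one has [g = m_{n+1} - Op m_n]. *)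
Fixpoint garsia (g : V -> X -> R) n : V -> X -> R := fun v x =>
  Num.max 0 (if n is k.+1 then Op (garsia g k) v x + g v x else g v x).

(** The functions [garsia g n] increase with [n] and [II] is invariant, so
    [garsia g n.+1 - Op (garsia g n)] has nonnegative [II]; it is at most [g] cut off to where
    [garsia g n.+1] is positive. By hypothesis the cut-off disappears almost everywhere as [n]
    grows, and dominated convergence leaves [II g]. *)
Lemma garsia_int g : (forall v, bm (g v)) ->
  (forall v, {ae nu, forall x, exists n, 0 < Srec (fun _ => g) n v x}) -> 0 <= II g.
Proof.
move=> bg gp.
have bG n v : bm (garsia g n v).
  elim: n v => [|n IH] v /=; apply: bm_max => //; try exact: bm_cst.
  by apply: bmD => //; exact: (vop_bm H).
have G0 n v x : 0 <= garsia g n v x by case: n => [|n]; rewrite /= le_max lexx.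
have Gmono n v x : garsia g n v x <= garsia g n.+1 v x.
  elim: n v x => [|n IH] v x.
    rewrite /= ge_max le_max lexx/= le_max lerDr; apply/orP; right.
    by apply: (vop_pos H) => v' y; rewrite le_max lexx.
  rewrite [leLHS]/= [leRHS]/= ge_max le_max lexx/= le_max lerD2r; apply/orP; right.
  exact: (vop_mono H).
have Gle m n v x : (m <= n)%N -> garsia g m v x <= garsia g n v x.
  move=> /subnK <-; elim: (n - m)%N => // k IH; exact: le_trans IH (Gmono _ _ _).
have SG n v x : Srec (fun _ => g) n v x <= garsia g n v x.
  elim: n v x => [|n IH] v x /=; rewrite le_max ?lexx ?orbT// lerD2r; apply/orP; right.
  exact: (vop_mono H).
pose e n v x : R := (0 < garsia g n v x)%R%:R.
have be n v : bm (fun x => g v x * e n v x) by apply: bmM => //; exact: bm_pos.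
have Ie n : 0 <= II (fun v x => g v x * e n.+1 v x).
  apply: (@le_trans _ _ (II (garsia g n.+1) - II (Op (garsia g n)))).
    rewrite II_Op// subr_ge0; apply: II_le => // v; exact: aeW.
  rewrite -IIB//; last exact: (vop_bm H).
  apply: II_le => // v; first by apply: bmB => //; exact: (vop_bm H).
  apply: aeW => x; rewrite /e; have := vop_pos H (G0 n) v x.
  rewrite /=; case: (ltP 0 (Op (garsia g n) v x + g v x)) => [k _|_].
    by rewrite k mulr1 addrC addKr.
  by rewrite ltxx mulr0 sub0r oppr_le0.
have cvI : (fun n => II (fun v x => g v x * e n.+1 v x)) @ \oo --> II g.
  apply: cvgn_sum => v _; apply: cvgMl_tmp.
  have [M gM] := (bg v).2.
  apply: (EE_dct (M := M)); last 2 first.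
  - by case: (bg v).
  - apply: filterS (gp v) => x [n n0]; apply: cvg_near_cst.
    exists n => // k /= nk; rewrite /e (_ : 0 < _)%R ?mulr1//.
    by apply: (lt_le_trans n0); apply: (le_trans (SG n v x)); apply: Gle; exact: leqW.
  - by move=> n; case: (be n.+1 v).
  - move=> n x; rewrite normrM; apply: le_trans (gM x); rewrite ler_piMr//.
    by rewrite /e; case: (_ < _)%R; rewrite ?normr1 ?normr0.
rewrite -(cvg_lim _ cvI)//; apply: limr_ge; first by apply/cvg_ex; exists (II g).
exact: nearW.
Qed.

(** Garsia's inequality is applied to [f - fbar + e * c]. As [fbar] (almost everywhere) and [c] are
    fixed by [Op], its ergodic sums are [Sn n] minus [n + 1] times [fbar - e * c]. One of them must
    be positive, or else the upper limit [fbar] would be at most [fbar - e * c]. *)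
Lemma ergodic_le : II fbar <= II f.
Proof.
have Ic0 : 0 <= \sum_v h v * c v by apply: sumr_ge0 => v _; rewrite mulr_ge0// ltW.
have [M hM] := Sn_bnd.
have bfb := fbar_bm.
suff key e : 0 < e -> II fbar <= II f + e * \sum_v h v * c v.
  apply/ler_addgt0Pr => e e0.
  (* The added 1 keeps the denominator positive even when [V] is empty. *)
  have s0 : 0 < \sum_v h v * c v + 1 by rewrite ltr_wpDl.
  apply: le_trans (key (e / (\sum_v h v * c v + 1)) _) _; first by rewrite divr_gt0.
  by rewrite lerD2l mulrAC ler_pdivrMr// ler_pM2l// lerDl.
move=> e0.
pose g v x := f v x - fbar v x + e * c v.
have bffb v : bm (fun x => f v x - fbar v x) by exact: bmB.
have bg v : bm (g v) by apply: bmD => //; exact: bm_cst.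
have Ig : II g = II f - II fbar + e * \sum_v h v * c v.
  rewrite (IID bffb (fun v => bm_cst X (e * c v)))// IIB//; congr (_ + _).
  by rewrite /II mulr_sumr; apply: eq_bigr => v _; rewrite EE_cst; ring.
suff : 0 <= II g by rewrite Ig; lra.
apply: garsia_int => // v.
have Sg n : forall w, {ae nu, forall x, Srec (fun _ => g) n w x =
    Sn n w x - bk 1 n * fbar w x + bk 1 n * (e * c w)}.
  elim: n => [|n IH] w; first by apply: aeW => x /=; rewrite bk_0 !mul1r.
  have := vop_ae_eq H IH w.
  apply: filterS2 (fbar_inv w) => x fx /= ->.
  have E1 : Op (fun w x => bk 1 n * (e * c w)) w x = bk 1 n * (e * c w).
    rewrite (vop_cst H (fun w => bk 1 n * (e * c w))) -[in RHS]cA !mulr_sumr.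
    by apply: eq_bigr => v' _; ring.
  rewrite (vopD H (fun w x => Sn n w x - bk 1 n * fbar w x)) E1.
  rewrite (vopD H (Sn n)) (vopN H (fun w x => bk 1 n * fbar w x)).
  rewrite (vopZ H) fx -[Sn n.+1 w x]/(Op (Sn n) w x + f w x).
  by rewrite bkS bk0 /g; ring.
have : {ae nu, forall x, forall n, Srec (fun _ => g) n v x =
    Sn n v x - bk 1 n * fbar v x + bk 1 n * (e * c v)}.
  by apply: ae_foralln => n; exact: Sg.
apply: filterS => x Sx.
apply: contrapT => /forallNP no.
have : fbar v x <= fbar v x - e * c v.
  rewrite {1}/fbar; apply: limsup_le_near; first by exists M => n; exact: hM.
  apply: nearW => n; rewrite ler_pdivrMr ?bk_gt0//.
  have := no n; move/negP; rewrite -leNgt Sx; lra.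
have := mulr_gt0 e0 (c0 v); lra.
Qed.

End Ergodic.

Lemma Srec_bkS k f N v x : Srec (fun N v x => bk k.+1 N * f v x) N v x =
  \sum_(j < N.+1) Srec (fun N v x => bk k N * f v x) j v x.
Proof.
rewrite -Srec_sum; congr (Srec _ N v x).
by apply/funext => n; apply/funext => w; apply/funext => y; rewrite -bk_sum mulr_suml.
Qed.

(** Raising [k] by one replaces the sequence by its partial sums ([Srec_bkS]), and [stolz_limsup]
    shows that this does not increase the normalized upper limit. The case [k = 0] is the definition
    of [fbar]. *)
Lemma Srec_bk_limsup f k : (forall v, bm (f v)) -> forall v x,
  limn_sup (fun N => Srec (fun N v x => bk k N * f v x) N v x / bk k.+1 N) <= fbar f v x.
Proof.
move=> bf v x; have [Q Q0 fQ] := dom_c bf.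
have bd j : sbnd (fun N => Srec (fun N v x => bk j N * f v x) N v x / bk j.+1 N).
  exists (Q * c v) => n; rewrite normrM normfV (gtr0_norm (bk_gt0 _ _)) ler_pdivrMr ?bk_gt0//.
  rewrite mulrAC; apply: Srec_bk => N w y.
  by rewrite normrM (gtr0_norm (bk_gt0 _ _)) [Q * _]mulrC -mulrA ler_pM2l ?bk_gt0.
elim: k => [|k IH].
  rewrite /fbar /Sn (_ : (fun N => _) = (fun _ => f))//.
  by apply/funext => n; apply/funext => w; apply/funext => y; rewrite bk0 mul1r.
have E : (fun N => Srec (fun N v x => bk k.+1 N * f v x) N v x / bk k.+2 N) =
  (fun N => (\sum_(j < N.+1) Srec (fun N v x => bk k N * f v x) j v x) / bk k.+2 N).
  by apply/funext => N; rewrite Srec_bkS.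
rewrite E; apply: (@stolz_limsup _ k.+1 (fun j => Srec (fun N v x => bk k N * f v x) j v x)) => [|e e0]; first by rewrite -E; exact: bd.
have lt : limn_sup (fun N => Srec (fun N v x => bk k N * f v x) N v x / bk k.+1 N)
   < fbar f v x + e by apply: (le_lt_trans IH); rewrite ltrDl.
apply: filterS (limsup_lt_near (bd k) lt) => n.
by rewrite ltr_pdivrMr ?bk_gt0// => /ltW.
Qed.

Section CriticalSource.
Context (F : nat -> V -> X -> R) (Fl : V -> X -> R) (k : nat) (M : R).
Hypothesis mF : forall N v, measurable_fun setT (F N v).
Hypothesis FM : forall N v x, `|F N v x| <= M * bk k N.
Hypothesis bFl : forall v, bm (Fl v).
Hypothesis cFl : forall v, aecvg nu (fun N x => F N v x / bk k N) (Fl v).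

Definition ubar v x := limn_sup (fun N => Srec F N v x / bk k.+1 N).

Lemma ubar_bnd : exists Q, forall N v x, `|Srec F N v x / bk k.+1 N| <= Q.
Proof.
have [Q Q0 FQ] := dom_c_seq (bk_gt0 k) FM.
exists (\sum_v Q * c v) => N v x.
rewrite normrM normfV (gtr0_norm (bk_gt0 _ _)) ler_pdivrMr ?bk_gt0//.
apply: (@le_trans _ _ (Q * bk k.+1 N * c v)); first exact: Srec_bk.
rewrite mulrAC ler_pM2r ?bk_gt0// (bigD1 v)//= lerDl.
by apply: sumr_ge0 => w _; rewrite mulr_ge0// ltW.
Qed.

Lemma Srec_div_meas N v : measurable_fun setT (fun x => Srec F N v x / bk k.+1 N).
Proof.
have bF n w : bm (F n w) by split => //; eexists => x; exact: FM.
have := Srec_bm bF N v => /(bmZ (bk k.+1 N)^-1)[+ _].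
by congr (measurable_fun _ _); apply/funext => x; rewrite mulrC.
Qed.

Lemma ubar_bm v : bm (ubar v).
Proof.
have [Q FQ] := ubar_bnd; apply: (bm_limsup (M := Q)) => // n; exact: Srec_div_meas.
Qed.

(** From time [J] on, the source is at most [bk k N] times the tail supremum [G J], to which
    [Srec_bk_limsup] and [ergodic_le] apply. As [J] grows, [G J] converges boundedly to [Fl]. *)
Lemma ubar_II : II ubar <= II Fl.
Proof.
have nFM N v x : `|F N v x / bk k N| <= M.
  by rewrite normrM normfV (gtr0_norm (bk_gt0 _ _)) ler_pdivrMr ?bk_gt0.
have mFb N v : measurable_fun setT (fun x => F N v x / bk k N).
  by apply: measurable_funM => //; exact: measurable_cst.
pose G J v x := sups (fun N => F N v x / bk k N) J.
have bG J v : bm (G J v) by apply: (bm_sups (M := M)).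
have sFb v x : sbnd (fun N => F N v x / bk k N) by exists M.
suff key J : II ubar <= II (G J).
  have cvG : (fun J => II (G J)) @ \oo --> II Fl.
    apply: cvgn_sum => v _; apply: cvgMl_tmp; apply: (EE_dct (M := M)).
    - by move=> J; case: (bG J v).
    - move=> J x; rewrite ler_norml; apply/andP; split.
        by apply: le_trans (sups_ge (sFb v x) (leqnn J)); have := nFM J v x; rewrite ler_norml => /andP[].
      by apply: sups_le => m _; exact: le_trans (ler_norm _) (nFM m v x).
    - by case: (bFl v).
    - by apply: filterS (cFl v) => x /cvg_sups.
  rewrite -(cvg_lim _ cvG)//; apply: limr_ge; first by apply/cvg_ex; exists (II Fl).
  exact: nearW.
apply: le_trans (ergodic_le (bG J)).
apply: II_le => // v; [exact: ubar_bm|exact: fbar_bm|apply: aeW => x].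
apply: le_trans (Srec_bk_limsup k (bG J) v x).
have [Q Q0 FQ] := dom_c_seq (bk_gt0 k) FM.
have [P P0 GP] := dom_c (bG J).
have GP' n w y : `|bk k n * G J w y| <= P * bk k n * c w.
  by rewrite normrM (gtr0_norm (bk_gt0 _ _)) [P * _]mulrC -mulrA ler_pM2l ?bk_gt0.
pose K := (Q + P) * bk k J.
have K0 : 0 <= K by rewrite mulr_ge0 ?addr_ge0// ltW// bk_gt0.
have bkm n : (n <= J)%N -> bk k n <= bk k J :> R.
  by move=> /subnK <-; elim: (J - n)%N => // i IH; exact: le_trans IH (bk_leS _ _).
(* The comparison with [G J] may fail before time [J]. The defect is covered by [K * c], which [Op]
   leaves unchanged: it is added at most [J] times ([DJ]) and is negligible after division by
   [bk k.+1 n]. *)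
pose D n : V -> X -> R := fun v _ => if (n < J)%N then K * c v else 0.
have FGD n w y : F n w y <= bk k n * G J w y + D n w y.
  rewrite /D; case: ltnP => nJ.
    rewrite -lerBlDl; apply: (le_trans (ler_norm _)); apply: (le_trans (ler_normB _ _)).
    apply: (@le_trans _ _ ((Q + P) * bk k n * c w)); first by rewrite 2!mulrDl lerD.
    by rewrite ler_pM2r// ler_wpM2l ?addr_ge0// bkm// ltnW.
  by rewrite addr0 mulrC -ler_pdivrMr ?bk_gt0//; exact: sups_ge.
have DJ n w y : `|Srec D n w y| <= (minn n.+1 J)%:R * (K * c w).
  apply: (@Srec_abs D (fun n w => (minn n.+1 J)%:R * (K * c w))) => {n w y} [w y|n w y]; rewrite /D.
    case: ltnP => [J0|]; first by rewrite (minn_idPl J0) mul1r ger0_norm// mulr_ge0// ltW.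
    by rewrite normr0 => _; rewrite mulr_ge0// mulr_ge0// ltW.
  have -> : \sum_w0 (minn n.+1 J)%:R * (K * c w0) * A w0 w = (minn n.+1 J)%:R * (K * c w).
    by rewrite -[in RHS]cA !mulr_sumr; apply: eq_bigr => z _; ring.
  rewrite -mulrBl.
  case: ltnP => nJ.
    rewrite (minn_idPl nJ) (ger0_norm (mulr_ge0 K0 (ltW (c0 w)))).
    by rewrite -[n.+2]addn1 natrD addrAC subrr add0r mul1r.
  rewrite (minn_idPr (leqW nJ)) subrr mul0r normr0//.
have le n : Srec F n v x <= Srec (fun N v x => bk k N * G J v x) n v x + Srec D n v x.
  by rewrite -SrecD; apply: Srec_mono.
have [B FB] := ubar_bnd.
have bS : sbnd (fun N => Srec (fun N v x => bk k N * G J v x) N v x / bk k.+1 N).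
  exists (P * c v) => n; rewrite normrM normfV (gtr0_norm (bk_gt0 _ _)) ler_pdivrMr ?bk_gt0//.
  by rewrite mulrAC; exact: Srec_bk.
apply: limsup_le_eps => [|e e0]; first by exists B.
have e20 : 0 < e / 2 by lra.
have lt : forall a : R, a < a + e / 2 by move=> a; rewrite ltrDl.
have h1 := limsup_lt_near bS (lt _).
have cD : (fun n => (J%:R * (K * c v)) * (bk k.+1 n)^-1) @ \oo --> (0 : R).
  by rewrite -[X in _ --> X](mulr0 (J%:R * (K * c v))); apply: cvgMl_tmp; exact: bk_inv_cvg.
have h2 : \forall n \near \oo, J%:R * (K * c v) / bk k.+1 n < e / 2 by exact: (cvgr_lt _ cD).
apply: filterS2 h1 h2 => n h1 h2.
apply: (@le_trans _ _ ((Srec (fun N v x => bk k N * G J v x) n v x + Srec D n v x) / bk k.+1 n)).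
  by rewrite ler_pM2r ?invr_gt0 ?bk_gt0.
rewrite mulrDl; have : Srec D n v x / bk k.+1 n <= J%:R * (K * c v) / bk k.+1 n.
  rewrite ler_pM2r ?invr_gt0 ?bk_gt0//; apply: le_trans (ler_norm _) _.
  apply: le_trans (DJ n v x) _; apply: ler_wpM2r; first exact: mulr_ge0 K0 (ltW (c0 v)).
  by rewrite ler_nat geq_minr.
move: h1 h2; lra.
Qed.

End CriticalSource.

(** [ubar_II] for [F] and for [- F] bounds the integral of upper minus lower limit by
    [II Fl - II Fl]. The integrand is nonnegative, so the two limits agree almost everywhere. *)
Lemma critical_source (F : nat -> V -> X -> R) (Fl : V -> X -> R) (k : nat) (M : R) :
  (forall N v, measurable_fun setT (F N v)) -> (forall N v x, `|F N v x| <= M * bk k N) ->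
  (forall v, bm (Fl v)) -> (forall v, aecvg nu (fun N x => F N v x / bk k N) (Fl v)) ->
  exists G : V -> X -> R, (forall v, bm (G v)) /\
    (forall v, aecvg nu (fun N x => Srec F N v x / bk k.+1 N) (G v)).
Proof.
move=> mF FM bFl cFl.
exists (ubar F k); split; first by move=> v; apply: (@ubar_bm _ _ M).
pose F' N v x := - F N v x.
have mF' N v : measurable_fun setT (F' N v) by exact: measurable_funN.
have FM' N v x : `|F' N v x| <= M * bk k N by rewrite normrN.
have bFl' v : bm (fun x => - Fl v x) by exact: bmN.
have cFl' v : aecvg nu (fun N x => F' N v x / bk k N) (fun x => - Fl v x).
  apply: filterS (cFl v) => x cx.
  by apply: (eq_cvgn (cvgN cx)) => // n; rewrite /F' mulNr.
have I1 := ubar_II mF FM bFl cFl.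
have I2 := ubar_II mF' FM' bFl' cFl'.
have IN : II (fun v x => - Fl v x) = - II Fl.
  by rewrite /II -sumrN; apply: eq_bigr => v _; rewrite EEN// mulrN.
have [Q FQ] := ubar_bnd FM.
have sb v x : sbnd (fun N => Srec F N v x / bk k.+1 N) by exists Q.
have EN v x : ubar F' k v x = limn_sup (fun N => - (Srec F N v x / bk k.+1 N)).
  by congr limn_sup; apply/funext => N; rewrite /F' SrecN mulNr.
have b1 v : bm (ubar F k v) by apply: (ubar_bm mF FM).
have b2 v : bm (ubar F' k v) by apply: (ubar_bm mF' FM').
have := II_eq0 (fun v => bmD (b1 v) (b2 v)); rewrite IID// => z v.
have {}z : {ae nu, forall x, ubar F k v x + ubar F' k v x = 0}.
  apply: z; last by rewrite IN in I2; lra.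
  by move=> w; apply: aeW => x; rewrite EN; exact: limsup_ge0.
apply: filterS z => x z; apply: limsup_cvg => //.
by move: z; rewrite EN /ubar => ->.
Qed.

End Bistochastic.

Lemma subcritical_source (rho : R) (c : V -> R) (F : nat -> V -> X -> R) (Fl : V -> X -> R)
  (k : nat) (M : R) :
  0 <= rho < 1 -> (forall v, 0 < c v) -> (forall w, \sum_v c v * A v w = rho * c w) ->
  (forall N v, measurable_fun setT (F N v)) -> (forall N v x, `|F N v x| <= M * bk k N) ->
  (forall v, bm (Fl v)) -> (forall v, aecvg nu (fun N x => F N v x / bk k N) (Fl v)) ->
  exists G : V -> X -> R, (forall v, bm (G v)) /\
    (forall v, aecvg nu (fun N x => Srec F N v x / bk k N) (G v)).
Proof.
move=> /andP[rho0 rho1] c0 cA mF FM bFl cFl.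
have [Q Q0 FQ] := dom_c_seq c0 (bk_gt0 k) FM.
have rn0 : 1 - rho != 0 by rewrite subr_eq0 gt_eqF.
have rp : 0 < 1 - rho by rewrite subr_gt0.
have bF n w : bm (F n w) by split => //; eexists => x; exact: FM.
(* [Q / (1 - rho)] sums the geometric series of past contributions; monotonicity of [bk k] lets the
   older, smaller sources be compared with the latest one. *)
have Sb N v x : `|Srec F N v x| <= Q / (1 - rho) * bk k N * c v.
  apply: (@Srec_abs F (fun N v => Q / (1 - rho) * bk k N * c v)) => {N v x} [v x|N v x].
    apply: le_trans (FQ _ _ _) _; rewrite ler_pM2r// ler_pM2r ?bk_gt0//.
    by rewrite ler_pdivlMr// ler_piMr//; lra.
  have -> : \sum_w Q / (1 - rho) * bk k N * c w * A w v = Q / (1 - rho) * bk k N * (rho * c v).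
    by rewrite -cA mulr_sumr; apply: eq_bigr => w _; ring.
  apply: le_trans (FQ _ _ _) _.
  rewrite mulrA -mulrBl ler_pM2r//.
  have -> : Q * bk k N.+1 = Q / (1 - rho) * (bk k N.+1 - rho * bk k N.+1) by field.
  rewrite -[in leRHS](mulrA (Q / (1 - rho))) -mulrBr ler_wpM2l ?divr_ge0 ?(ltW rp)// lerB// [leLHS]mulrC.
  by rewrite ler_wpM2l// bk_leS.
pose U := \sum_v Q / (1 - rho) * c v.
have cU v : Q / (1 - rho) * c v <= U.
  rewrite /U (bigD1 v)//= lerDl; apply: sumr_ge0 => w _.
  by rewrite mulr_ge0 ?divr_ge0 ?(ltW rp) ?(ltW (c0 w)).
have uc N v x : `|Srec F N v x / bk k N| <= Q / (1 - rho) * c v.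
  rewrite normrM normfV (gtr0_norm (bk_gt0 _ _)) ler_pdivrMr ?bk_gt0//.
  by rewrite mulrAC; exact: Sb.
have uU N v x : `|Srec F N v x / bk k N| <= U by exact: le_trans (uc N v x) (cU v).
have ms N v : measurable_fun setT (fun x => Srec F N v x / bk k N).
  have := Srec_bm bF N v => /(bmZ (bk k N)^-1)[+ _].
  by congr (measurable_fun _ _); apply/funext => x; rewrite mulrC.
pose u1 v x := limn_sup (fun N => Srec F N v x / bk k N).
pose u2 v x := limn_sup (fun N => - (Srec F N v x / bk k N)).
exists u1; split; first by move=> v; apply: (bm_limsup (M := U)).
have sb v x : sbnd (fun N => Srec F N v x / bk k N) by exists U.
have cFS v : aecvg nu (fun N x => F N.+1 v x / bk k N.+1) (Fl v).
  by apply: filterS (cFl v) => x h; rewrite -cvg_shiftS in h.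
have step G n v x : Srec G n.+1 v x / bk k n.+1 =
    bk k n / bk k n.+1 * Op (fun w y => Srec G n w y / bk k n) v x + G n.+1 v x / bk k n.+1.
  rewrite -(vopZ H) /= mulrDl; congr (_ + _); rewrite mulrC -(vopZ H); congr (Op _ v x).
  apply/funext => y; apply/funext => z.
  have := bk_neq0 k n (R := R); have := bk_neq0 k n.+1 (R := R).
  by move=> ? ?; field; apply/andP.
have le1 v : {ae nu, forall x, u1 v x <= Op u1 v x + Fl v x}.
  by apply: (limsup_step H uU (bk_ratio k) cFS (step F)).
have le2 v : {ae nu, forall x, u2 v x <= Op u2 v x + - Fl v x}.
  apply: (limsup_step H (u := fun n v x => - (Srec F n v x / bk k n))
    (r := fun n v x => - (F n.+1 v x / bk k n.+1)) (rl := fun v x => - Fl v x) (M := U) _ (bk_ratio k)) => [n w x|w|n w x].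
  - by rewrite normrN.
  - by apply: filterS (cFS w) => x; exact: cvgN.
  - by rewrite step opprD (vopN H) mulrN.
have dstep v : {ae nu, forall x, u1 v x + u2 v x <= Op (fun v x => u1 v x + u2 v x) v x}.
  by apply: filterS2 (le1 v) (le2 v) => x; rewrite (vopD H); lra.
have dn n : forall v, {ae nu, forall x, u1 v x + u2 v x <= 2 * (Q / (1 - rho)) * (rho ^+ n * c v)}.
  elim: n => [|n IH] v.
    apply: aeW => x; rewrite expr0 mul1r.
    have a1 : u1 v x <= Q / (1 - rho) * c v.
      by apply: le_trans (ler_norm _) _; apply: limsup_abs.
    have a2 : u2 v x <= Q / (1 - rho) * c v.
      by apply: le_trans (ler_norm _) _; apply: limsup_abs => N; rewrite normrN.
    lra.
  apply: filterS2 (dstep v) (vop_ae_le H IH v) => x a1 a2; apply: le_trans a1 _.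
  apply: le_trans a2 _.
  rewrite (vop_cst H (fun w => 2 * (Q / (1 - rho)) * (rho ^+ n * c w))).
  have -> : \sum_w 2 * (Q / (1 - rho)) * (rho ^+ n * c w) * A w v =
      2 * (Q / (1 - rho)) * (rho ^+ n * (rho * c v)).
    by rewrite -cA !mulr_sumr; apply: eq_bigr => w _; ring.
  by rewrite exprSr -!mulrA.
move=> v.
have := ae_foralln (fun n => dn n v).
apply: filterS => x hx; apply: limsup_cvg => //.
have cz : (fun n => 2 * (Q / (1 - rho)) * (rho ^+ n * c v)) @ \oo --> (0 : R).
  rewrite -[X in _ --> X](mulr0 (2 * (Q / (1 - rho)))); apply: cvgMl_tmp.
  rewrite -[X in _ --> X](mul0r (c v)); apply: cvgMr_tmp.
  by apply: cvg_expr; rewrite ger0_norm.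
rewrite -(cvg_lim _ cz)//; apply: limr_ge; first by apply/cvg_ex; exists 0.
exact: nearW.
Qed.

End Sources.

(** * Perron-Frobenius vectors *)

Section PerronFrobenius.
Context (R : realType) (V : finType).
Implicit Types (B : V -> V -> R) (x y : V -> R).

Definition act B x : V -> R := fun w => \sum_v x v * B v w.

Lemma act_lin B (a : R) x y w :
  act B (fun v => a * x v + y v) w = a * act B x w + act B y w.
Proof. by rewrite /act mulr_sumr -big_split; apply: eq_bigr => v _; rewrite mulrDl mulrA. Qed.

(** Strong connectivity as an induction principle: a property that holds somewhere and propagates
    along arcs holds everywhere. *)
Definition irreducible B := forall P : V -> Prop, (exists v, P v) ->
  (forall v w, P v -> 0 < B v w -> P w) -> forall w, P w.

Lemma irreducible_tr B : irreducible B -> irreducible (fun v w => B w v).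
Proof.
move=> irr P [v Pv] cl w; apply: contrapT => nPw.
have : ~ P v; last by [].
apply: (irr (fun u => ~ P u)); first by exists w.
by move=> a b nPa Bab Pb; apply: nPa; exact: cl Pb Bab.
Qed.

Lemma irreducible_pos B y : (forall v w, 0 <= B v w) -> irreducible B ->
  (forall v, 0 <= y v) -> (exists v, 0 < y v) -> (forall w, act B y w <= y w) ->
  forall v, 0 < y v.
Proof.
move=> B0 irr y0 ex le; apply: irr => // v w yv Bvw.
apply: lt_le_trans (le w); rewrite /act (bigD1 v)//= ltr_wpDr ?mulr_gt0//.
by apply: sumr_ge0 => u _; rewrite mulr_ge0.
Qed.

Lemma limsup_act B (x : nat -> V -> R) M : (forall v w, 0 <= B v w) ->
  (forall n v, `|x n v| <= M) -> forall w e, 0 < e ->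
  \forall n \near \oo, act B (x n) w <= act B (fun v => limn_sup (fun n => x n v)) w + e.
Proof.
move=> B0 xM w e e0.
have S0 : 0 < 1 + \sum_v B v w by rewrite ltr_wpDr//; apply: sumr_ge0.
have d0 : 0 < e / (1 + \sum_v B v w) by rewrite divr_gt0.
set d := e / _ in d0.
have : \forall n \near \oo, forall v, x n v < limn_sup (fun n => x n v) + d.
  apply: filter_forall => v; apply: limsup_lt_near; first by exists M.
  by rewrite ltrDl.
apply: filterS => n h; apply: (@le_trans _ _ (\sum_v (limn_sup (fun n => x n v) + d) * B v w)).
  by apply: ler_sum => v _; rewrite ler_wpM2r// ltW.
under eq_bigr do rewrite mulrDl; rewrite big_split /= lerD2l -mulr_sumr /d.
by rewrite mulrAC ler_pdivrMr// ler_pM2l// lerDr.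
Qed.

(** The Collatz-Wielandt variational problem. Compactness of the simplex is replaced by upper
    limits: the coordinatewise upper limit of near-optimal probability vectors is a maximizer,
    because [B >= 0] makes [act B] compatible with upper limits ([limsup_act]). *)
Lemma collatz_max B : (forall v w, 0 <= B v w) -> V ->
  exists rho x, [/\ 0 <= rho, forall v, 0 <= x v, exists v, 0 < x v,
    forall w, rho * x w <= act B x w &
    forall r y, (forall v, 0 <= y v) -> (exists v, 0 < y v) ->
      (forall w, r * y w <= act B y w) -> r <= rho].
Proof.
move=> B0 v0.
pose E : set R := [set r | 0 <= r /\ exists x, [/\ forall v, 0 <= x v, \sum_v x v = 1 &
   forall w, r * x w <= act B x w]].
pose S := \sum_w \sum_v B v w.
have memE r y : (forall v, 0 <= y v) -> (exists v, 0 < y v) -> 0 <= r ->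
    (forall w, r * y w <= act B y w) -> E r.
  move=> y0 [v yv] r0 ry; split=> //.
  have s0 : 0 < \sum_v y v.
    by rewrite (bigD1 v)//= ltr_wpDr//; apply: sumr_ge0.
  exists (fun v => y v / \sum_v y v); split => [u||w].
  - by rewrite divr_ge0// ltW.
  - by rewrite -mulr_suml divff// gt_eqF.
  - rewrite mulrA; have -> : act B (fun v => y v / \sum_v y v) w = act B y w / \sum_v y v.
      by rewrite /act mulr_suml; apply: eq_bigr => u _; rewrite mulrAC.
    by rewrite ler_pM2r ?invr_gt0.
have Eub r : E r -> r <= S.
  move=> [r0 [x [x0 x1 rx]]]; rewrite -[r]mulr1 -x1 mulr_sumr.
  apply: (@le_trans _ _ (\sum_w act B x w)); first exact: ler_sum.
  apply: ler_sum => w _; apply: ler_sum => v _; rewrite ler_piMl// -x1.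
  by rewrite (bigD1 v)//= lerDl; apply: sumr_ge0.
have E0 : E 0.
  apply: (@memE 0 (fun=> 1)) => // w.
  by rewrite mul0r; apply: sumr_ge0 => v _; rewrite mulr_ge0.
have hE : has_sup E by split; [exists 0|exists S => r; exact: Eub].
pose rho := sup E.
have rho0 : 0 <= rho by apply: ub_le_sup => //; case: hE.
have /choice[x hx] : forall n : nat, exists x, [/\ forall v, 0 <= x v, \sum_v x v = 1 &
   forall w, (rho - n.+1%:R^-1) * x w <= act B x w].
  move=> n; have n0 : 0 < n.+1%:R^-1 :> R by rewrite invr_gt0 ltr0n.
  have [r [r0 [x [x0 x1 rx]]] lt] := sup_adherent n0 hE.
  by exists x; split => // w; apply: le_trans (rx w); rewrite ler_wpM2r// ltW.
have x01 n v : `|x n v| <= 1.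
  have [x0 x1 _] := hx n; rewrite ger0_norm// -x1 (bigD1 v)//= lerDl.
  by apply: sumr_ge0.
have sx v : sbnd (fun n => x n v) by exists 1.
pose xb v := limn_sup (fun n => x n v).
have xb0 v : 0 <= xb v.
  rewrite -(@cvg_limsup _ (fun=> 0) 0); last exact: cvg_cst.
  apply: eq_limsup_near => //; first by exists 0 => n; rewrite normr0.
  by apply: nearW => n; case: (hx n).
exists rho, xb; split => //.
- apply: contrapT => /forallNP no.
  have z v : xb v = 0 by apply/eqP; rewrite eq_le xb0 andbT leNgt; apply/negP.
  (* If all upper limits vanished, every coordinate would eventually be below [e] and the total mass
     at most one half instead of 1. *)
  pose e : R := (2 * #|V|%:R)^-1.
  have V0 : 0 < #|V|%:R :> R by rewrite ltr0n; apply/card_gt0P; exists v0.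
  have e0 : 0 < e by rewrite invr_gt0 mulr_gt0.
  have : \forall n \near \oo, forall v, x n v < e.
    apply: filter_forall => v; apply: limsup_lt_near => //.
    by move: (z v); rewrite /xb => ->.
  case=> N _ /(_ N (leqnn N)) /= lt.
  have [_ + _] := hx N; apply/eqP; rewrite lt_eqF//.
  apply: (@le_lt_trans _ _ (\sum_(v : V) e)); first by apply: ler_sum => v _; exact/ltW.
  rewrite sumr_const -mulr_natr /e invfM -mulrA mulVf ?gt_eqF//; lra.
- move=> w; have [->|rho_neq0] := eqVneq rho 0.
    by rewrite mul0r; apply: sumr_ge0 => v _; rewrite mulr_ge0.
  have rp : 0 < rho by rewrite lt_neqAle eq_sym rho_neq0.
  rewrite mulrC -ler_pdivlMr//; apply: limsup_le_eps => // e e0.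
  have re0 : 0 < rho * e / 2 by rewrite divr_gt0// mulr_gt0.
  have h1 := limsup_act B0 x01 w re0.
  have h2 : \forall n \near \oo, n.+1%:R^-1 < rho * e / 2 by exact: (cvgr_lt _ (@cvg_natV R)).
  apply: filterS2 h1 h2 => n h1 h2.
  rewrite -(ler_pM2l rp) mulrDr mulrCA divff// mulr1.
  have [x0 _ /(_ w)] := hx n; rewrite mulrBl => h3.
  have : n.+1%:R^-1 * x n w <= n.+1%:R^-1.
    by rewrite ler_piMr// (le_trans (ler_norm _)).
  move: h2 h3 (h1 : act B (x n) w <= act B xb w + rho * e / 2).
  move: (act B xb w) (act B (x n) w) (n.+1%:R^-1 * x n w) (n.+1%:R^-1) (rho * x n w) (rho * e).
  by move=> a b t s p q; lra.
- move=> r y y0 ey ry; have [r0|/ltW r0] := leP 0 r; last exact: le_trans r0 rho0.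
  by apply: ub_le_sup; [case: hE|exact: memE ry].
Qed.

(** If the maximizer [x] were not an eigenvector, the nonzero defect [act B x - rho x] would become
    positive everywhere under a power of the identity plus [B]; the same power applied to [x] would
    then beat [rho]. Positivity of [x] follows by irreducibility. *)
Theorem perron_frobenius B : (forall v w, 0 <= B v w) -> irreducible B -> V ->
  exists rho c, [/\ 0 <= rho, forall v, 0 < c v & forall w, act B c w = rho * c w].
Proof.
move=> B0 irr v0; have [rho [x [rho0 x0 [vx xv] rx rmax]]] := collatz_max B0 v0.
have eqx w : act B x w = rho * x w.
  apply/eqP; rewrite eq_le rx andbT leNgt; apply/negP => lt.
  pose N (z : V -> R) : V -> R := fun w => z w + act B z w.
  pose y n : V -> R := fun w => act B (iter n N x) w - rho * iter n N x w.
  have x0n n v : 0 <= iter n N x v.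
    elim: n v => [|n IH] v //=; rewrite addr_ge0//; apply: sumr_ge0 => u _.
    by rewrite mulr_ge0.
  have yS n u : y n.+1 u = y n u + act B (y n) u.
    rewrite /y iterS; set a := iter n N x.
    have -> : N a = (fun v => 1 * a v + act B a v) by apply/funext => v; rewrite mul1r.
    have -> : (fun w => act B a w - rho * a w) = (fun w => - rho * a w + act B a w).
      by apply/funext => v; rewrite addrC mulNr.
    rewrite !act_lin; ring.
  have y0n n u : 0 <= y n u.
    elim: n u => [|n IH] u; first by rewrite subr_ge0 rx.
    by rewrite yS addr_ge0//; apply: sumr_ge0 => v _; rewrite mulr_ge0.
  have ymono m n u : (m <= n)%N -> y m u <= y n u.
    move=> /subnK <-; elim: (n - m)%N => // i IH; apply: le_trans IH _.
    by rewrite addSn yS lerDl; apply: sumr_ge0 => v _; rewrite mulr_ge0.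
  have /choice[n hn] : forall u, exists n, 0 < y n u.
    apply: irr => [|v u [n yn] Bvu]; first by exists w, 0%N; rewrite subr_gt0.
    exists n.+1; rewrite yS ltr_wpDl// /act (bigD1 v)//= ltr_wpDr ?mulr_gt0//.
    by apply: sumr_ge0 => t _; rewrite mulr_ge0.
  pose m := (\sum_u n u)%N.
  have ym u : 0 < y m u.
    by apply: lt_le_trans (hn u) (ymono _ _ _ _); rewrite /m (bigD1 u)//= leq_addr.
  pose X := iter m N x.
  have X0 v : 0 <= X v by exact: x0n.
  (* [T^-1] is the gain over [rho]: with this [T], [X u / T <= y m u] holds at every [u]. *)
  pose T := 1 + \sum_u X u / y m u.
  have T0 : 0 < T by rewrite ltr_wpDr//; apply: sumr_ge0 => u _; rewrite divr_ge0// ltW.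
  have Xpos : exists v, 0 < X v.
    exists vx; rewrite /X; elim: (m) => [|k IH] //=; rewrite ltr_wpDr//.
    by apply: sumr_ge0 => u _; rewrite mulr_ge0.
  have : rho + T^-1 <= rho.
    apply: (rmax _ X) => // u.
    rewrite mulrDl -lerBrDl -/(y m u) mulrC ler_pdivrMr// mulrC -ler_pdivrMr//.
    rewrite /T (bigD1 u)//= addrCA lerDl addr_ge0//.
    by apply: sumr_ge0 => t _; rewrite divr_ge0// ltW.
  by rewrite gerDl leNgt invr_gt0 T0.
exists rho, x; split => // v.
apply: (irr (fun v => 0 < x v)) => [|u w xu Buw]; first by exists vx.
have : 0 < rho * x w.
  rewrite -eqx /act (bigD1 u)//= ltr_wpDr ?mulr_gt0//.
  by apply: sumr_ge0 => t _; rewrite mulr_ge0.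
by move=> h; rewrite lt_neqAle x0 andbT eq_sym; apply: contraTneq h => ->; rewrite mulr0 ltxx.
Qed.

(** * Radius 1 with a summable source: convergence by an energy argument *)

Section Energy.
Context (B : V -> V -> R) (B0 : forall v w, 0 <= B v w) (irr : irreducible B).
Context (loops : forall v, 0 < B v v).
Context (c h : V -> R) (c0 : forall v, 0 < c v) (h0 : forall v, 0 < h v).
Hypothesis cB : forall w, \sum_v c v * B v w = c w.
Hypothesis Bh : forall v, \sum_w B v w * h w = h v.
Context (y f : nat -> V -> R) (v0 : V).
Hypothesis y0 : forall n v, 0 <= y n v.
Hypothesis f0 : forall n v, 0 <= f n v.
Hypothesis yS : forall n w, y n.+1 w = act B (y n) w + f n w.
Context (M : R) (fM : forall N w, \sum_(n < N) f n w <= M).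

Let eta n := \sum_w h w * y n w.

Lemma etaS n : eta n.+1 = eta n + \sum_w h w * f n w.
Proof.
rewrite /eta; under eq_bigr do rewrite yS mulrDr; rewrite big_split /=; congr (_ + _).
rewrite /act; under eq_bigr do rewrite mulr_sumr; rewrite exchange_big /=.
apply: eq_bigr => v _; rewrite -[in RHS]Bh mulr_suml; apply: eq_bigr => w _; ring.
Qed.

Lemma eta_nd : nondecreasing_seq eta.
Proof.
apply/nondecreasing_seqP => n; rewrite etaS lerDl; apply: sumr_ge0 => w _.
by rewrite mulr_ge0// ltW.
Qed.

Lemma eta_ub n : eta n <= eta 0%N + \sum_w h w * M.
Proof.
have -> : eta n = eta 0%N + \sum_w h w * \sum_(j < n) f j w.
  elim: n => [|n IH]; first by rewrite big1 ?addr0// => w _; rewrite big_ord0 mulr0.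
  rewrite etaS IH -addrA; congr (_ + _); rewrite -big_split /=; apply: eq_bigr => w _.
  by rewrite big_ord_recr /= mulrDr.
by rewrite lerD2l; apply: ler_sum => w _; rewrite ler_pM2l.
Qed.

Lemma eta_cvg : eta @ \oo --> limn eta.
Proof.
apply: nondecreasing_is_cvgn; first exact: eta_nd.
by exists (eta 0%N + \sum_w h w * M) => _ [n _ <-]; exact: eta_ub.
Qed.

(* In the coordinates [z = y / c] the recursion reads [z_{n+1} = P z_n + g_n] with [P] stochastic.
   The [c h]-weighted square norm of [z_n] decreases, up to a summable error, by a quantity
   controlling [z_n v - P z_n w] along every edge [v -> w]; loops allow [P z_n w] to be
   replaced by [z_n w]. *)
Theorem energy_cvg : exists2 L : R, forall v, y ^~ v @ \oo --> L * c v &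
  forall n, \sum_w h w * y n w <= L * \sum_w c w * h w.
Proof.
pose m w := c w * h w.
have m0 w : 0 < m w by rewrite mulr_gt0.
pose p w v := c v * B v w / c w.
have cn w : c w != 0 by rewrite gt_eqF.
have p1 w : \sum_v p w v = 1 by rewrite -mulr_suml cB divff.
have p0 w v : 0 <= p w v by rewrite divr_ge0 ?mulr_ge0// ltW.
have mp v : \sum_w m w * p w v = m v.
  rewrite /m -[in RHS](Bh v) mulr_sumr; apply: eq_bigr => w _; rewrite /p; field; exact: cn.
pose z n w := y n w / c w.
pose g n w := f n w / c w.
pose Pz n w := \sum_v p w v * z n v.
have z0 n w : 0 <= z n w by rewrite divr_ge0// ltW.
have g0 n w : 0 <= g n w by rewrite divr_ge0// ltW.
have zS n w : z n.+1 w = Pz n w + g n w.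
  rewrite /z yS mulrDl; congr (_ + _); rewrite /act mulr_suml; apply: eq_bigr => v _.
  rewrite /p /z; field; by rewrite !cn.
have etaE n : eta n = \sum_w m w * z n w.
  apply: eq_bigr => w _; rewrite /m /z; field; exact: cn.
pose Et := eta 0%N + \sum_w h w * M.
pose Z := \sum_w Et / m w.
have Et0 : 0 <= Et.
  by apply: le_trans (eta_ub 0%N); apply: sumr_ge0 => w _; rewrite mulr_ge0// ltW.
have zZ n w : z n w <= Z.
  apply: (@le_trans _ _ (Et / m w)).
    rewrite ler_pdivlMr// mulrC; apply: le_trans (eta_ub n); rewrite etaE (bigD1 w)//= lerDl.
    by apply: sumr_ge0 => u _; rewrite mulr_ge0// ltW.
  by rewrite /Z (bigD1 w)//= lerDl; apply: sumr_ge0 => u _; rewrite divr_ge0// ltW.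
have Pz0 n w : 0 <= Pz n w by apply: sumr_ge0 => v _; rewrite mulr_ge0.
pose e n := \sum_w m w * z n w ^+ 2.
(* The variance lost when [z n] is averaged by [p], as [DE] records. *)
pose D n := \sum_w m w * \sum_v p w v * (z n v - Pz n w) ^+ 2.
have DE n : D n = e n - \sum_w m w * Pz n w ^+ 2.
  have -> : e n = \sum_w m w * \sum_v p w v * z n v ^+ 2.
    under [RHS]eq_bigr do rewrite mulr_sumr; rewrite exchange_big /=; apply: eq_bigr => v _.
    by rewrite -[in LHS]mp mulr_suml; apply: eq_bigr => w _; rewrite mulrA.
  rewrite -sumrB; apply: eq_bigr => w _; rewrite -mulrBr; congr (_ * _).
  have sq v : p w v * (z n v - Pz n w) ^+ 2 =
     p w v * z n v ^+ 2 - 2 * Pz n w * (p w v * z n v) + p w v * Pz n w ^+ 2 by ring.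
  rewrite (eq_bigr _ (fun v _ => sq v)) big_split /= sumrB -mulr_sumr -mulr_suml p1 -/(Pz n w); ring.
have eS n : e n.+1 <= e n - D n + 2 * Z * (eta n.+1 - eta n).
  have -> : eta n.+1 - eta n = \sum_w m w * g n w.
    rewrite etaS addrAC subrr add0r; apply: eq_bigr => w _; rewrite /m /g; field; exact: cn.
  rewrite DE subKr /e mulr_sumr -big_split /=; apply: ler_sum => w _.
  have -> : 2 * Z * (m w * g n w) = m w * (2 * Z * g n w) by ring.
  rewrite -mulrDr ler_pM2l// -lerBlDl zS.
  have -> : (Pz n w + g n w) ^+ 2 - Pz n w ^+ 2 = (Pz n w + (Pz n w + g n w)) * g n w by ring.
  rewrite ler_wpM2r// -zS; have := zZ n.+1 w; have := g0 n w; have := zS n w; lra.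
(* Subtracting [2 * Z * eta n] absorbs the energy brought in by the source, which makes [E]
   nonincreasing. *)
pose E n := e n - 2 * Z * eta n.
have Z0 : 0 <= Z by exact: le_trans (z0 0%N v0) (zZ 0%N v0).
have D0 n : 0 <= D n.
  apply: sumr_ge0 => w _; apply: mulr_ge0; [exact/ltW|apply: sumr_ge0 => v _].
  by rewrite mulr_ge0// sqr_ge0.
have ED n : D n <= E n - E n.+1 by rewrite /E; have := eS n; lra.
have cE : cvgn E.
  apply: nonincreasing_is_cvgn.
    by apply/nonincreasing_seqP => n; have := ED n; have := D0 n; lra.
  exists (- (2 * Z * Et)) => _ [n _ <-]; rewrite /E.
  have : 0 <= e n by apply: sumr_ge0 => w _; rewrite mulr_ge0 ?sqr_ge0// ltW.
  have : 2 * Z * eta n <= 2 * Z * Et by rewrite ler_wpM2l ?mulr_ge0// eta_ub.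
  lra.
have cD : D @ \oo --> (0 : R).
  apply: (@squeeze_cvgr _ _ _ _ (fun _ => 0) (fun n => E n - E n.+1)).
  - by apply: nearW => n; rewrite D0 ED.
  - exact: cvg_cst.
  - rewrite -[X in _ --> X](subrr (limn E)); apply: cvgB => //.
    by have := cE; rewrite -cvg_shiftS.
have edge v w : 0 < B v w -> (fun n => z n v - Pz n w) @ \oo --> (0 : R).
  move=> Bvw; have pp : 0 < m w * p w v by rewrite mulr_gt0// divr_gt0// mulr_gt0.
  apply: norm_cvg0.
  apply: (@squeeze_cvgr _ _ _ _ (fun _ => 0) (fun n => Num.sqrt (D n / (m w * p w v)))).
  - apply: nearW => n; rewrite normr_ge0/= -sqrtr_sqr ler_sqrt.
      rewrite ler_pdivlMr// mulrC /D (bigD1 w)//= (bigD1 v)//= mulrDr mulrA -addrA lerDl.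
      have s0 (Q : pred V) u : 0 <= \sum_(t | Q t) p u t * (z n t - Pz n u) ^+ 2.
        by apply: sumr_ge0 => t _; rewrite mulr_ge0// sqr_ge0.
      apply: addr_ge0; first by apply: mulr_ge0 => //; exact/ltW.
      by apply: sumr_ge0 => u _; apply: mulr_ge0 => //; exact/ltW.
    by rewrite divr_ge0// ltW.
  - exact: cvg_cst.
  - rewrite -[X in _ --> X](@sqrtr0 R); apply: (cvg_comp _ (@Num.sqrt R)); last exact: sqrt_continuous.
    have := cvgMr_tmp (b := (m w * p w v)^-1) cD; rewrite mul0r; exact.
pose Pr w : Prop := (fun n => z n w - z n v0) @ \oo --> (0 : R).
have all : forall w, Pr w.
  apply: irr => [|v u hv Bvu].
    exists v0; apply: (eq_cvgn (v := fun=> 0)) => //; first exact: cvg_cst.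
    by move=> n; rewrite subrr.
  apply: (eq_cvgn (v := fun n => (z n u - Pz n u) - (z n v - Pz n u) + (z n v - z n v0))
    (m := 0 - 0 + 0)) => [|n|]; [|by ring|by rewrite subrr addr0].
  by apply: cvgD => //; apply: cvgB; exact: edge.
have mm0 : \sum_w m w != 0.
  by rewrite gt_eqF// (bigD1 v0)//= ltr_wpDr//; apply: sumr_ge0 => w _; rewrite ltW.
(* All coordinates of [z] approach each other and [eta] is their [m]-weighted sum, so their common
   limit is that of [eta] divided by the total weight. *)
pose L := limn eta / \sum_w m w.
have z0c : z ^~ v0 @ \oo --> L.
  apply: (eq_cvgn (v := fun n => (eta n - \sum_w m w * (z n w - z n v0)) / \sum_w m w)
     (m := (limn eta - \sum_w m w * 0) / \sum_w m w)).
  - apply: cvgMr_tmp; apply: cvgB; first exact: eta_cvg.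
    by apply: cvgn_sum => w _; apply: cvgMl_tmp; exact: all.
  - move=> n; rewrite etaE -sumrB; under eq_bigr => w _ do rewrite -mulrBr opprB addrCA subrr addr0.
    by rewrite -mulr_suml mulrAC divff// mul1r.
  - by rewrite (_ : \sum_w m w * 0 = 0) ?subr0// big1// => w _; rewrite mulr0.
exists L => [v|n].
  apply: (eq_cvgn (v := fun n => (z n v - z n v0 + z n v0) * c v) (m := (0 + L) * c v)).
  - by apply: cvgMr_tmp; apply: cvgD => //; exact: all.
  - by move=> n; rewrite subrK /z divfK.
  - by rewrite add0r.
rewrite /L divfK//; apply: nondecreasing_cvgn_le; first exact: eta_nd.
by apply/cvg_ex; eexists; exact: eta_cvg.
Qed.

End Energy.
End PerronFrobenius.

(** * Growth along strongly connected components *)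

Section GrowthTypes.
Context {R : realType}.
Implicit Types (y : nat -> R).

(* After normalizing the spectral radius to 1, a level count is either summable
   ([kappa = 0]) or of exact order [n ^ k] ([kappa = k + 1]). *)
Definition growth y kappa := if kappa is k.+1
  then exists2 c, 0 < c & (fun n => y n / bk k n) @ \oo --> (c : R)
  else exists M, forall N, \sum_(n < N) y n <= M.

Lemma summable_cvg0 y M : (forall n, 0 <= y n) -> (forall N, \sum_(n < N) y n <= M) ->
  y @ \oo --> (0 : R).
Proof.
move=> y0 yM; have /cvg_series_cvg_0 : cvgn (series y); last exact.
apply: nondecreasing_is_cvgn.
  apply/nondecreasing_seqP => n; rewrite /series /= big_nat_recr//= lerDl; exact: y0.
by exists M => _ [n _ <-]; rewrite /series /= big_mkord.
Qed.

Lemma growth_lim y kappa k : (forall n, 0 <= y n) -> growth y kappa -> (kappa <= k.+1)%N ->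
  exists L : R, [/\ 0 <= L, (fun n => y n / bk k n) @ \oo --> L & kappa = k.+1 -> 0 < L].
Proof.
move=> y0; case: kappa => [[M yM] _|j [c c0 yc] jk].
  exists 0; split => //.
  apply: (@squeeze_cvgr _ _ _ _ (fun _ => 0) y); last exact: (summable_cvg0 y0 yM).
    by apply: nearW => n; rewrite divr_ge0 ?(ltW (bk_gt0 _ _))//= ler_pdivrMr ?bk_gt0// ler_peMr ?bk_ge1.
  exact: cvg_cst.
move: jk; rewrite ltnS leq_eqVlt => /orP[/eqP<-|jk].
  by exists c; split => //; exact: ltW.
exists 0; split => // [|[jk']]; last by rewrite jk' ltnn in jk.
apply: (eq_cvgn (v := fun n => y n / bk j n * (bk j n / bk k n)) (m := c * 0)).
- by apply: cvgM => //; exact: bk_low.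
- by move=> n; rewrite mulrA divfK ?bk_neq0.
- by rewrite mulr0.
Qed.

(** The index [kappa] is the order of the partial sums, which is why the summable type is case 0. *)
Lemma growth_sum y kappa : (forall n, 0 <= y n) -> growth y kappa ->
  exists M, forall N, \sum_(n < N.+1) y n <= M * bk kappa N.
Proof.
move=> y0; case: kappa => [[M yM]|k [c c0 yc]].
  by exists M => N; rewrite bk0 mulr1.
have [M hM] := cvg_sbnd yc; exists M => N.
rewrite -bk_sum mulr_sumr; apply: ler_sum => n _; rewrite -ler_pdivrMr ?bk_gt0//.
exact: le_trans (ler_norm _) (hM n).
Qed.

Lemma bk_leK k k' N : (k <= k')%N -> bk k N <= bk k' N :> R.
Proof.
move=> /subnK <-; elim: (k' - k)%N => // i IH; apply: le_trans IH _.
rewrite addSn -bk_sum big_ord_recr /= lerDr; apply: sumr_ge0 => j _; exact/ltW/bk_gt0.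
Qed.

End GrowthTypes.

(** * One strongly connected component driven by a source *)

Section Component.
Context d (X : measurableType d) (R : realType) (nu : probability X R) (V : finType).
Context (A : V -> V -> R) (Op : (V -> X -> R) -> V -> X -> R) (H : vop nu A Op).

Lemma ae_ex (P : X -> Prop) : {ae nu, forall x, P x} -> exists x, P x.
Proof.
move=> h; apply: contrapT => no; apply: (@ae_cst _ _ _ nu False).
by apply: filterS h => x Px; apply: no; exists x.
Qed.

Context (irr : irreducible A) (rho : R) (c h : V -> R).
Hypothesis rho0 : 0 <= rho.
Hypothesis c0 : forall v, 0 < c v.
Hypothesis h0 : forall v, 0 < h v.
Hypothesis cA : forall w, act A c w = rho * c w.
Hypothesis Ah : forall v, \sum_w A v w * h w = rho * h v.
Hypothesis loops : rho = 1 -> forall v, 0 < A v v.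
Context (y f : nat -> V -> R).
Hypothesis y0 : forall n v, 0 <= y n v.
Hypothesis f0 : forall n v, 0 <= f n v.
Hypothesis yS : forall n w, y n.+1 w = act A (y n) w + f n w.

Let A0 := vop_ge0 H.

(** Counts are run through the recursion as functions constant in [x]: the almost everywhere
    theorems then give their limits, read off at a single point in [det_of_aecvg]. The source is
    shifted by one, its entry 0 being the initial value. *)
Let Fc N : V -> X -> R := fun v _ => if N is n.+1 then f n v else y 0%N v.

Lemma Srec_cst N v x : Srec Op Fc N v x = y N v.
Proof.
elim: N v x => [|N IH] v x //=; rewrite yS; congr (_ + _).
rewrite (_ : Srec Op Fc N = fun v _ => y N v); first by rewrite (vop_cst H (y N)).
by apply/funext => w; apply/funext => z; exact: IH.
Qed.

Lemma h_act u : \sum_w h w * act A u w = rho * \sum_v h v * u v.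
Proof.
rewrite /act; under eq_bigr do rewrite mulr_sumr; rewrite exchange_big mulr_sumr /=.
apply: eq_bigr => v _; rewrite mulrA -Ah mulr_suml; apply: eq_bigr => w _; ring.
Qed.

Lemma hyS n : \sum_w h w * y n.+1 w = rho * (\sum_w h w * y n w) + \sum_w h w * f n w.
Proof.
by rewrite -h_act -big_split; apply: eq_bigr => w _; rewrite yS mulrDr.
Qed.

Section DetSource.
Context (k : nat) (fl : V -> R).
Hypothesis ffl : forall v, (fun n => f n v / bk k n) @ \oo --> fl v.

Lemma Fc_cvg v : aecvg nu (fun N x => Fc N v x / bk k N) (fun=> fl v).
Proof.
apply: aeW => x; rewrite -cvg_shiftS /=.
apply: (eq_cvgn (v := fun n => f n v / bk k n * (bk k n / bk k n.+1)) (m := fl v * 1)).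
- by apply: cvgM => //; exact: bk_ratio.
- by move=> n; rewrite mulrA divfK ?bk_neq0.
- by rewrite mulr1.
Qed.

Lemma Fc_bnd : exists M, forall N v x, `|Fc N v x| <= M * bk k N.
Proof.
have /choice[M hM] : forall v, exists M, forall N (x : X), `|Fc N v x / bk k N| <= M.
  move=> v; have [x hx] := ae_ex (Fc_cvg v).
  have [M hM] := cvg_sbnd hx; exists M => N x'; exact: hM.
exists (\sum_v `|M v|) => N v x; rewrite -ler_pdivrMr ?bk_gt0//.
have := hM v N x; rewrite normrM normfV (gtr0_norm (bk_gt0 _ _)) => /le_trans; apply.
apply: le_trans (ler_norm _) _; rewrite (bigD1 v)//= lerDl; exact: sumr_ge0.
Qed.

Lemma Fc_meas N v : measurable_fun setT (Fc N v).
Proof. exact: measurable_cst. Qed.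

Lemma det_of_aecvg kap : (exists G : V -> X -> R, (forall v, bm (G v)) /\
    (forall v, aecvg nu (fun N x => Srec Op Fc N v x / bk kap N) (G v))) ->
  exists g : V -> R, forall v, (fun n => y n v / bk kap n) @ \oo --> g v.
Proof.
case=> G [_ cG].
have [x hx] : exists x, forall v, (fun N => y N v / bk kap N) @ \oo --> G v x.
  apply: ae_ex; apply: filter_forall => v; apply: filterS (cG v) => x hx.
  by apply: eq_cvgn hx _ _ => // n; rewrite Srec_cst.
by exists (G ^~ x).
Qed.

Lemma lim_rec kap g fl' : (forall v, (fun n => y n v / bk kap n) @ \oo --> g v) ->
  (forall v, (fun n => f n v / bk kap n) @ \oo --> fl' v) ->
  forall w, g w = act A g w + fl' w.
Proof.
move=> yg ff w; have h1 : (fun n => y n.+1 w / bk kap n.+1) @ \oo --> g w.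
  by have := yg w; rewrite -cvg_shiftS.
apply: (cvg_unique _ h1) => //.
apply: (eq_cvgn (v := fun n => (act A (fun v => y n v / bk kap n) w + f n w / bk kap n)
   * (bk kap n / bk kap n.+1)) (m := (act A g w + fl' w) * 1)); last by rewrite mulr1.
  apply: cvgM; last exact: bk_ratio.
  by apply: cvgD => //; apply: cvgn_sum => v _; apply: cvgMr_tmp.
move=> n; have -> : act A (fun v => y n v / bk kap n) w = act A (y n) w / bk kap n.
  by rewrite /act mulr_suml; apply: eq_bigr => v _; rewrite mulrAC.
by rewrite -mulrDl mulrA divfK ?bk_neq0// yS.
Qed.

Lemma lim_ge0 kap g : (forall v, (fun n => y n v / bk kap n) @ \oo --> g v) -> forall v, 0 <= g v.
Proof.
move=> yg v; rewrite -(cvg_lim _ (yg v))//; apply: limr_ge; first by apply/cvg_ex; exists (g v).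
by apply: nearW => n; rewrite divr_ge0// ltW// bk_gt0.
Qed.

Hypothesis fl0 : forall v, 0 <= fl v.
Context (v0 : V) (flv0 : 0 < fl v0).

(** The limit satisfies [g = act A g + fl], so [g] is positive at [v0] and irreducibility spreads
    positivity. *)
Lemma det_subcritical : rho < 1 -> forall v, growth (y ^~ v) k.+1.
Proof.
move=> rho1; have [M FM] := Fc_bnd.
have rr : 0 <= rho < 1 by rewrite rho0.
have [g yg] := det_of_aecvg (subcritical_source H rr c0 cA Fc_meas FM (fun v => bm_cst X (fl v)) Fc_cvg).
have gE := lim_rec yg ffl; have g0 := lim_ge0 yg.
move=> v; exists (g v) => //.
apply: (irreducible_pos A0 irr g0) => [|w]; last by rewrite [leRHS]gE lerDl.
exists v0; rewrite gE ltr_wpDl//; apply: sumr_ge0 => w _; by rewrite mulr_ge0 ?A0.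
Qed.

(** At order [k + 1] the source is negligible, so the limit is a fixed vector, positive everywhere
    or zero. It is not zero because the [h]-weighted mass equals its initial value plus all that the
    source has brought in, which is of order [k + 1]. *)
Lemma det_critical : rho = 1 -> forall v, growth (y ^~ v) k.+2.
Proof.
move=> rho1; have [M FM] := Fc_bnd.
have cA' w : \sum_v c v * A v w = c w by have := cA w; rewrite rho1 mul1r.
have Ah' w : \sum_v A w v * h v = h w by rewrite Ah rho1 mul1r.
have [g yg] := det_of_aecvg (critical_source H c0 h0 cA' Ah' Fc_meas FM (fun v => bm_cst X (fl v)) Fc_cvg).
have f0' v : (fun n => f n v / bk k.+1 n) @ \oo --> (0 : R).
  apply: (eq_cvgn (v := fun n => f n v / bk k n * (bk k n / bk k.+1 n)) (m := fl v * 0)).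
  - by apply: cvgM => //; exact: bk_low.
  - by move=> n; rewrite mulrA divfK ?bk_neq0.
  - by rewrite mulr0.
have gE w : g w = act A g w by rewrite (lim_rec yg f0') addr0.
have g0 := lim_ge0 yg.
move=> v; exists (g v) => //.
apply: (irreducible_pos A0 irr g0) => [|w]; last by rewrite -gE.
pose hf := \sum_w h w * fl w.
have hf0 : 0 < hf.
  rewrite /hf (bigD1 v0)//= ltr_wpDr ?mulr_gt0//; apply: sumr_ge0 => w _.
  by rewrite mulr_ge0// ltW.
(* The sign is reversed because [stolz_limsup] bounds from above, while a lower bound on the mass is
   wanted. *)
pose a j := - \sum_w h w * (if j is n.+1 then f n w else y 0%N w).
have sa N : \sum_(j < N.+1) a j = - \sum_w h w * y N w.
  elim: N => [|N IH]; first by rewrite big_ord1.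
  by rewrite big_ord_recr /= IH /a hyS rho1 mul1r opprD.
have hg : (fun N => (\sum_(j < N.+1) a j) / bk k.+1 N) @ \oo --> - \sum_w h w * g w.
  apply: (eq_cvgn (v := fun N => - \sum_w h w * (y N w / bk k.+1 N))) => // [|n].
    by apply: cvgN; apply: cvgn_sum => w _; apply: cvgMl_tmp.
  by rewrite sa mulNr mulr_suml; congr (- _); apply: eq_bigr => w _; rewrite mulrA.
have hle : - \sum_w h w * g w <= - hf.
  rewrite -(cvg_limsup hg); apply: stolz_limsup; first exact: cvg_sbnd hg.
  move=> e e0.
  have ca : (fun n => a n.+1 / bk k n.+1) @ \oo --> - hf.
    apply: (eq_cvgn (v := fun n => - (\sum_w h w * (f n w / bk k n)) * (bk k n / bk k n.+1))
       (m := - hf * 1)); last by rewrite mulr1.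
      apply: cvgM; last exact: bk_ratio.
      by apply: cvgN; apply: cvgn_sum => w _; apply: cvgMl_tmp.
    move=> n; rewrite mulrA; congr (_ / _); rewrite /a mulNr; congr (- _).
    by rewrite mulr_suml; apply: eq_bigr => w _; rewrite -mulrA divfK ?bk_neq0.
  have [N _ hN] : \forall n \near \oo, a n.+1 / bk k n.+1 < - hf + e.
    by apply: (cvgr_lt _ ca); rewrite ltrDl.
  exists N.+1 => // -[//|n] /=; rewrite ltnS => /hN /=.
  by rewrite ltr_pdivrMr ?bk_gt0// => /ltW.
apply: contrapT => /forallNP no.
have : \sum_w h w * g w <= 0.
  by apply: sumr_le0 => w _; rewrite mulr_ge0_le0 ?(ltW (h0 w))// leNgt; apply/negP.
move: hle hf0; lra.
Qed.

End DetSource.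

Context (F : nat -> V -> X -> R) (Fl : V -> X -> R) (K : nat) (M : R).
Hypothesis mF : forall N v, measurable_fun setT (F N v).
Hypothesis FM : forall N v x, `|F N v x| <= M * bk K N.
Hypothesis bFl : forall v, bm (Fl v).
Hypothesis cFl : forall v, aecvg nu (fun N x => F N v x / bk K N) (Fl v).
Hypothesis Sy : forall N v x, `|Srec Op F N v x| <= \sum_(n < N.+1) y n v.
Hypothesis fK : if K is k.+1 then exists fl : V -> R,
   [/\ forall v, (fun n => f n v / bk k n) @ \oo --> fl v, forall v, 0 <= fl v &
     exists v, 0 < fl v]
  else forall v, exists M, forall N, \sum_(n < N) f n v <= M.
Hypothesis reach : (exists n v, 0 < y n v) -> rho <= 1.

(** Radius 1 raises the order [K] of the source by one, a smaller radius keeps it. For [K = 0] the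
    incoming counts are merely summable: at radius 1 the limits of the counts then come from
    [energy_cvg], below radius 1 summability is inherited. A component that is never reached carries
    no mass, so that its radius, possibly above 1, is harmless. *)
Lemma component_growth : exists kap, forall v, growth (y ^~ v) kap /\
  exists2 G, bm G & aecvg nu (fun N x => Srec Op F N v x / bk kap N) G.
Proof.
have [[n [v yv]]|no] := pselect (exists n v, 0 < y n v); last first.
  have yz n v : y n v = 0.
    apply/eqP; rewrite eq_le y0 andbT leNgt; apply/negP => yv.
    by apply: no; exists n, v.
  exists 0%N => v; split; first by exists 0 => N; rewrite big1.
  exists (fun=> 0); first exact: bm_cst.
  apply: aeW => x; apply: (eq_cvgn (v := fun=> 0)) => //; first exact: cvg_cst.
  move=> N; apply/eqP; rewrite bk0 divr1 -normr_le0; apply: le_trans (Sy N v x) _.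
  by rewrite big1.
have rho_le1 : rho <= 1 by apply: reach; exists n, v.
have fS0 : K = 0%N -> exists Mf, forall N w, \sum_(n < N) f n w <= Mf.
  move=> K0; move: fK; rewrite K0 => /choice[m hm].
  exists (\sum_v `|m v|) => N w; apply: le_trans (hm w N) _; apply: le_trans (ler_norm _) _.
  by rewrite (bigD1 w)//= lerDl; apply: sumr_ge0.
move: rho_le1; rewrite le_eqVlt => /orP[/eqP rho1|rho1].
  have cA' w : \sum_v c v * A v w = c w by have := cA w; rewrite rho1 mul1r.
  have Ah' w : \sum_v A w v * h v = h w by rewrite Ah rho1 mul1r.
  have [G [bG cG]] := critical_source H c0 h0 cA' Ah' mF FM bFl cFl.
  exists K.+1 => w; split; last by exists (G w).
  case EK : K => [|k]; last first.
    by move: fK; rewrite EK => -[fl [ffl fl0 [u flu]]]; exact: det_critical ffl fl0 _ flu rho1 w.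
  have [Mf hMf] := fS0 EK.
  have [L yL hL] := energy_cvg A0 irr (loops rho1) c0 h0 cA' Ah' w y0 f0 yS hMf.
  have ch0 : 0 < \sum_w c w * h w.
    rewrite (bigD1 w)//= ltr_wpDr ?mulr_gt0//; apply: sumr_ge0 => u _.
    by rewrite mulr_ge0// ltW.
  have L0 : 0 < L.
    rewrite -(pmulr_lgt0 _ ch0); apply: lt_le_trans (hL n).
    rewrite (bigD1 v)//= ltr_wpDr ?mulr_gt0//; apply: sumr_ge0 => u _.
    by rewrite mulr_ge0// ltW.
  exists (L * c w); first by rewrite mulr_gt0.
  by apply: eq_cvgn (yL w) _ _ => // k; rewrite bk0 divr1.
have rr : 0 <= rho < 1 by rewrite rho0.
have [G [bG cG]] := subcritical_source H rr c0 cA mF FM bFl cFl.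
exists K => w; split; last by exists (G w).
case EK : K => [|k]; last first.
  by move: fK; rewrite EK => -[fl [ffl fl0 [u flu]]]; exact: det_subcritical ffl fl0 _ flu rho1 w.
have [Mf hMf] := fS0 EK.
(* The accumulated [h]-weighted mass. Contraction by [rho] gives [Y <= rho * Y + C], hence the bound
   [C / (1 - rho)]. *)
pose Y N := \sum_(n < N) \sum_w h w * y n w.
have Y0 N : 0 <= Y N.
  by apply: sumr_ge0 => i _; apply: sumr_ge0 => u _; rewrite mulr_ge0// ltW.
pose C := \sum_w h w * y 0%N w + \sum_w h w * Mf.
have YS N : Y N.+1 <= rho * Y N.+1 + C.
  have YE : Y N.+1 = \sum_w h w * y 0%N w + rho * Y N + \sum_w h w * \sum_(n < N) f n w.
    elim: N => [|N IH].
      rewrite /Y big_ord1 big_ord0 mulr0 addr0 [X in _ = _ + X]big1 ?addr0// => u _.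
      by rewrite big_ord0 mulr0.
    rewrite {1}/Y big_ord_recr /= -/(Y N.+1) {1}IH hyS.
    rewrite [in RHS]/Y big_ord_recr /= -/(Y N) mulrDr.
    have -> : \sum_w h w * \sum_(i < N.+1) f i w =
        \sum_w h w * \sum_(i < N) f i w + \sum_w h w * f N w.
      by rewrite -big_split; apply: eq_bigr => u _; rewrite big_ord_recr /= mulrDr.
    ring.
  have b1 : rho * Y N <= rho * Y N.+1.
    rewrite ler_wpM2l// [leRHS]/Y big_ord_recr /= lerDl; apply: sumr_ge0 => u _.
    by rewrite mulr_ge0// ltW.
  have b2 : \sum_w h w * \sum_(n < N) f n w <= \sum_w h w * Mf.
    by apply: ler_sum => u _; rewrite ler_pM2l.
  move: b1 b2; rewrite {2}YE /C; lra.
exists (C / (1 - rho) / h w) => N; rewrite ler_pdivlMr// ler_pdivlMr ?subr_gt0//.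
have : (\sum_(n0 < N) y n0 w) * h w <= Y N.+1.
  rewrite /Y big_ord_recr /= mulr_suml -[leLHS]addr0 lerD//.
    apply: ler_sum => i _; rewrite (bigD1 w)//= mulrC lerDl; apply: sumr_ge0 => u _.
    by rewrite mulr_ge0// ltW.
  by apply: sumr_ge0 => u _; rewrite mulr_ge0// ltW.
move=> le; apply: (@le_trans _ _ (Y N.+1 * (1 - rho))).
  by rewrite ler_wpM2r// subr_ge0 ltW.
have := YS N; lra.
Qed.

End Component.

(** * Compression of an operator to a set of vertices *)

Section Subtype.
Context (R : realType) (V : finType) (C : {pred V}).

Definition ext0 (T : Type) (z : T) (f : {v in C} -> T) (v : V) : T :=
  if insub v is Some s then f s else z.

Lemma ext0_val T (z : T) f s : ext0 z f (val s) = f s.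
Proof. by rewrite /ext0 valK. Qed.

Lemma ext0_out T (z : T) f v : v \notin C -> ext0 z f v = z.
Proof. by move=> vC; rewrite /ext0 insubF//; exact/negbTE. Qed.

Lemma ext0_case T (z : T) (Q : T -> Prop) f v : Q z -> (forall s, Q (f s)) -> Q (ext0 z f v).
Proof. by move=> Qz Qf; rewrite /ext0; case: insubP. Qed.

Lemma sum_ext0 (u : {v in C} -> R) (a : V -> R) :
  \sum_v ext0 0 u v * a v = \sum_s u s * a (val s).
Proof.
rewrite (bigID (mem C)) /= [X in _ + X]big1 ?addr0; last first.
  by move=> v vC; rewrite ext0_out// mul0r.
by rewrite big_sub; apply: eq_bigr => s _; rewrite ext0_val.
Qed.

Context d (X : measurableType d) (nu : probability X R).
Context (A : V -> V -> R) (Op : (V -> X -> R) -> V -> X -> R) (H : vop nu A Op).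

Definition subA (s t : {v in C}) := A (val s) (val t).
(** What enters [C] from other vertices is left out here and returns as a source in the
    recursion. *)
Definition subOp (f : {v in C} -> X -> R) (t : {v in C}) := Op (ext0 (fun=> 0) f) (val t).

Lemma sub_vop : vop nu subA subOp.
Proof.
split.
- by move=> s t; exact: vop_ge0 H _ _.
- move=> a f g t x; rewrite /subOp -(vop_lin H); congr (Op _ _ x).
  apply/funext => v; rewrite /ext0; case: insubP => // _; apply/funext => z.
  by rewrite mulr0 addr0.
- move=> f g fg t x; apply: (vop_mono H) => v y; rewrite /ext0.
  by case: insubP => // *; exact: fg.
- move=> u t x; rewrite /subOp.
  rewrite (_ : ext0 _ _ = fun v _ => ext0 0 u v) ?(vop_cst H (ext0 0 u)) ?sum_ext0//.
  by apply/funext => v; apply/funext => y; rewrite /ext0; case: insubP.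
- move=> f mf t; apply: (vop_meas H) => v; apply: ext0_case => //; exact: measurable_cst.
- move=> f bf t; rewrite /subOp (vop_int H).
    rewrite /subA -(sum_ext0 (fun s => EE nu (f s)) (fun v => A v (val t))); apply: eq_bigr => v _; congr (_ * _).
    by rewrite /ext0; case: insubP => // _; rewrite EE_cst.
  by move=> v; apply: ext0_case => //; exact: bm_cst.
- move=> u g ug t; apply: (vop_cvg H (u := fun n => ext0 (fun=> 0) (u n))) => v.
  have [vC|vC] := boolP (v \in C); last first.
    apply: aeW => x; rewrite ext0_out//.
    by apply: (eq_cvgn (v := fun=> 0)) => [|n|//]; [exact: cvg_cst|rewrite ext0_out].
  have -> : v = val (exist (fun v => v \in C) v vC : {v in C}) by [].
  rewrite ext0_val; apply: filterS (ug (exist _ v vC)) => x hx.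
  by apply: eq_cvgn hx _ _ => // n; rewrite ext0_val.
Qed.

End Subtype.

(** * Induction along the condensation order *)

Section Graph.
Context d (X : measurableType d) (R : realType) (nu : probability X R) (V : finType).
Context (A : V -> V -> R) (Op : (V -> X -> R) -> V -> X -> R) (H : vop nu A Op).

Let A0 := vop_ge0 H.

Definition edge : rel V := fun v w => 0 < A v w.
Definition scc (w : V) : {pred V} := [pred u | connect edge w u && connect edge u w].

Lemma scc_refl w : w \in scc w.
Proof. by rewrite inE connect0. Qed.

Lemma scc_irreducible w : irreducible (subA (C := scc w) A).
Proof.
move=> P [s0 Ps0] cl t.
have key p : forall s : {u in scc w}, P s -> path edge (val s) p ->
    forall t : {u in scc w}, val t = last (val s) p -> P t.
  elim: p => [|y p IH] s Ps /=; first by move=> _ t' /val_inj ->.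
  move=> /andP[sy yp] t' t'E.
  have yC : y \in scc w.
    have := valP s; have := valP t'; rewrite !inE => /andP[_ tw] /andP[ws _].
    apply/andP; split; first exact: connect_trans ws (connect1 sy).
    by apply: connect_trans tw; rewrite (t'E : val t' = last y p); apply/connectP; exists p.
  by apply: (IH (exist _ y yC)) => //; exact: cl Ps _.
have /connectP[p pp tE] : connect edge (val s0) (val t).
  have := valP s0; have := valP t; rewrite !inE => /andP[wt _] /andP[_ sw].
  exact: connect_trans sw wt.
exact: key pp _ tE.
Qed.

(** Left and right eigenvectors come from two applications of [perron_frobenius]; evaluating the
    pairing of [act (subA A) c] with [h] in two ways shows that their eigenvalues agree. They are
    extended by 0 so that the statement avoids the subtype. *)
Lemma scc_pf w : exists rho (c h : V -> R), [/\ 0 <= rho,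
  forall u, u \in scc w -> 0 < c u /\ 0 < h u,
  forall u, u \in scc w -> \sum_(v in scc w) c v * A v u = rho * c u &
  forall v, v \in scc w -> \sum_(u in scc w) A v u * h u = rho * h v].
Proof.
have irr := @scc_irreducible w.
pose s0 : {u in scc w} := exist _ w (scc_refl w).
have AC0 (s t : {u in scc w}) : 0 <= subA A s t by exact: A0.
have [rho [c [rho0 c0 cA]]] := perron_frobenius AC0 irr s0.
have [rho' [h [_ h0 hA]]] := perron_frobenius (fun s t => AC0 t s) (irreducible_tr irr) s0.
have E : rho = rho'.
  have e1 : \sum_t act (subA A) c t * h t = rho * \sum_t c t * h t.
    by rewrite mulr_sumr; apply: eq_bigr => t _; rewrite cA mulrA.
  have e2 : \sum_t act (subA A) c t * h t = rho' * \sum_t c t * h t.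
    rewrite /act; under eq_bigr do rewrite mulr_suml.
    rewrite exchange_big mulr_sumr /=; apply: eq_bigr => s _.
    rewrite mulrCA -hA /act mulr_sumr; apply: eq_bigr => t _; ring.
  apply: (@mulIf _ (\sum_t c t * h t)); last by rewrite -e1 e2.
  rewrite gt_eqF// (bigD1 s0)//= ltr_wpDr ?mulr_gt0//.
  by apply: sumr_ge0 => t _; rewrite mulr_ge0// ltW.
exists rho, (ext0 0 c), (ext0 0 h); split => //.
- move=> u uC; have -> : u = val (exist _ u uC : {u in scc w}) by [].
  by rewrite !ext0_val.
- move=> u uC; have uE : u = val (exist _ u uC : {u in scc w}) by [].
  rewrite big_sub uE ext0_val -cA /act; apply: eq_bigr => s _; by rewrite ext0_val.
- move=> u uC; have uE : u = val (exist _ u uC : {u in scc w}) by [].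
  rewrite big_sub uE ext0_val E -hA /act; apply: eq_bigr => s _; by rewrite ext0_val mulrC.
Qed.

Context (l0 : V -> R) (F0 : V -> X -> R).
Hypothesis l0_ge0 : forall v, 0 <= l0 v.
Hypothesis mF0 : forall v, measurable_fun setT (F0 v).
Hypothesis F0l0 : forall v x, `|F0 v x| <= l0 v.

(* For the Markov graph, [lev n v] is the number of paths of length [n] from the base vertex to [v],
   and [Phi n v] the sum of [phi \o T_g] over the corresponding elements [g]. *)
Definition lev n := iter n (act A) l0.
Definition Phi n := iter n Op F0.
Definition SS N v x := \sum_(n < N.+1) Phi n v x.

Lemma lev_ge0 n v : 0 <= lev n v.
Proof.
elim: n v => [|n IH] v //=; apply: sumr_ge0 => u _; by rewrite mulr_ge0.
Qed.

Lemma Phi_lev n v x : `|Phi n v x| <= lev n v.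
Proof.
elim: n v x => [|n IH] v x /=; first exact: F0l0.
exact: (vop_abs H).
Qed.

Lemma Phi_meas n v : measurable_fun setT (Phi n v).
Proof. by elim: n v => [|n IH] v //=; apply: (vop_meas H). Qed.

Lemma SS_meas N v : measurable_fun setT (SS N v).
Proof. by apply: measurable_sum => n; exact: Phi_meas. Qed.

Lemma SS_abs N v x : `|SS N v x| <= \sum_(n < N.+1) lev n v.
Proof. by apply: le_trans (ler_norm_sum _ _ _) _; apply: ler_sum => n _; exact: Phi_lev. Qed.

Lemma SS_S N v x : SS N.+1 v x = Op (SS N) v x + F0 v x.
Proof.
rewrite /SS big_ord_recl /= addrC; congr (_ + _).
elim: N.+1 => [|n IH].
  rewrite big_ord0 -[LHS](vop0 H v x); congr (Op _ v x).
  by apply/funext => w; apply/funext => y; rewrite big_ord0.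
rewrite big_ord_recr /= IH -(vopD H); congr (Op _ v x).
by apply/funext => w; apply/funext => y; rewrite big_ord_recr.
Qed.

Definition good v kap := growth (lev ^~ v) kap /\
  exists2 G, bm G & aecvg nu (fun N x => SS N v x / bk kap N) G.

Lemma good_raise v kap K : good v kap -> (kap <= K)%N ->
  exists2 G, bm G & aecvg nu (fun N x => SS N v x / bk K N) G.
Proof.
move=> [_ [G bG cG]]; rewrite leq_eqVlt => /orP[/eqP <-|lt]; first by exists G.
exists (fun=> 0); first exact: bm_cst.
apply: filterS cG => x hx.
apply: (eq_cvgn (v := fun n => SS n v x / bk kap n * (bk kap n / bk K n)) (m := G x * 0)).
- by apply: cvgM => //; exact: bk_low.
- by move=> n; rewrite mulrA divfK ?bk_neq0.
- by rewrite mulr0.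
Qed.

Context (rho : V -> R) (c h : V -> V -> R).
Hypothesis rho0 : forall w, 0 <= rho w.
Hypothesis ch0 : forall w u, u \in scc w -> 0 < c w u /\ 0 < h w u.
Hypothesis cA : forall w u, u \in scc w -> \sum_(v in scc w) c w v * A v u = rho w * c w u.
Hypothesis Ah : forall w v, v \in scc w -> \sum_(u in scc w) A v u * h w u = rho w * h w v.
Hypothesis reach : forall w u n, u \in scc w -> 0 < lev n u -> rho w <= 1.
Hypothesis loops : forall v w, edge v w -> connect edge w v -> 0 < A w w.

Section Step.
Context (w : V).

Definition src : pred V := [pred v | (v \notin scc w) && [exists t in scc w, edge v t]].

Definition mask (T : Type) (z : T) (g : V -> T) v := if src v then g v else z.

Lemma act_split g (t : {u in scc w}) : act A g (val t) =
  act (subA A) (g \o val) t + act A (mask 0 g) (val t).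
Proof.
rewrite {1}/act (bigID (mem (scc w))) /= big_sub; congr (_ + _).
rewrite /act big_mkcond; apply: eq_bigr => v _; rewrite /mask /src /=.
case: (v \in scc w) => /=; first by rewrite mul0r.
case: ifPn => // /existsPn /(_ (val t)); rewrite (valP t) /= -leNgt => le.
have -> : A v (val t) = 0 by apply/eqP; rewrite eq_le le A0.
by rewrite !mulr0.
Qed.

(** [Op] is known only through its axioms. That vertices without an arc into the component
    contribute nothing follows from [vop_abs], whose bound weights them by vanishing entries of
    [A]. *)
Lemma Op_split G M (t : {u in scc w}) x : (forall v x, `|G v x| <= M) ->
  Op G (val t) x = subOp Op (G \o val) t x + Op (mask (fun=> 0) G) (val t) x.
Proof.
move=> GM; pose rest v x := if (v \in scc w) || src v then 0 else G v x.
have GE : G = fun v x => (ext0 (fun=> 0) (G \o (val : {u in scc w} -> V)) v x + mask (fun=> 0) G v x) + rest v x.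
  apply/funext => v; apply/funext => z; rewrite /rest /mask.
  have [vC|vC] := boolP (v \in scc w) => /=.
    have vE : v = val (exist _ v vC : {u in scc w}) by [].
    have /negbTE -> : ~~ src v by rewrite /src /= vC.
    by rewrite {2}vE ext0_val /= !addr0.
  by rewrite ext0_out// add0r; case: ifP; rewrite ?addr0 ?add0r.
rewrite {1}GE (vopD H (fun v x => ext0 _ _ v x + mask _ _ v x)) (vopD H (ext0 _ _)).
rewrite -[RHS]addr0; congr (_ + _).
apply/eqP; rewrite -normr_le0.
apply: le_trans (vop_abs H (u := fun v => if (v \in scc w) || src v then 0 else `|M|) _ _ _) _.
  move=> v z; rewrite /rest; case: ifP => _; rewrite ?normr0//.
  by apply: le_trans (GM v z) (ler_norm M).
rewrite big1// => v _; case: ifPn => [|]; first by rewrite mul0r.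
rewrite negb_or /src /= => /andP[-> /=] /existsPn /(_ (val t)); rewrite (valP t) /= -leNgt => le.
have -> : A v (val t) = 0 by apply/eqP; rewrite eq_le le A0.
by rewrite mulr0.
Qed.

Context (kap : V -> nat).
Hypothesis kapP : forall v, src v -> good v (kap v).

Let K := (\max_(v | src v) kap v)%N.

Let kapK v : src v -> (kap v <= K)%N.
Proof. by move=> sv; apply: leq_bigmax_cond. Qed.

Let y n (s : {u in scc w}) := lev n (val s).
Let f n (s : {u in scc w}) := act A (mask 0 (lev n)) (val s).
(** Chosen so that [SS] restricted to the component solves the recursion with source [F] ([SrecE]):
    the inflow at time [n.+1] comes from the partial sums up to [n], and by [SS_S] the term [F0]
    enters at every step. *)
Let F N (s : {u in scc w}) x := (if N is n.+1 then Op (mask (fun=> 0) (SS n)) (val s) x else 0)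
   + F0 (val s) x.

Let mask_ge0 n v : 0 <= mask 0 (lev n) v.
Proof. by rewrite /mask; case: ifP => // _; exact: lev_ge0. Qed.

Let f0 n s : 0 <= f n s.
Proof. by apply: sumr_ge0 => v _; rewrite mulr_ge0. Qed.

Let SrecE N s x : Srec (subOp Op) F N s x = SS N (val s) x.
Proof.
elim: N s x => [|N IH] s x /=; first by rewrite /F add0r /SS big_ord1.
rewrite SS_S /F addrA; congr (_ + _).
have [M SM] : exists M, forall v x, `|SS N v x| <= M.
  exists (\sum_v \sum_(n < N.+1) lev n v) => v z; apply: le_trans (SS_abs _ _ _) _.
  rewrite (bigD1 v)//= lerDl; apply: sumr_ge0 => u _; apply: sumr_ge0 => n _; exact: lev_ge0.
rewrite (Op_split _ _ SM); congr (subOp Op _ s x + _).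
by apply/funext => t; apply/funext => z; exact: IH.
Qed.

Let lev_bnd : exists2 M : V -> R, (forall v, 0 <= M v) & forall N v, src v ->
  \sum_(n < N.+1) lev n v <= M v * bk K N.
Proof.
have /choice[M hM] : forall v, exists M, src v -> forall N, \sum_(n < N.+1) lev n v <= M * bk (kap v) N.
  move=> v; case: (boolP (src v)) => [sv|_]; last by exists 0.
  by have [M hM] := growth_sum (lev_ge0 ^~ v) (kapP sv).1; exists M.
exists (fun v => `|M v|) => // N v sv; apply: le_trans (hM v sv N) _.
apply: (@le_trans _ _ (`|M v| * bk (kap v) N)).
  by rewrite ler_pM2r ?bk_gt0// ler_norm.
by rewrite ler_wpM2l// bk_leK// kapK.
Qed.

Let F_bnd : exists M, forall N s x, `|F N s x| <= M * bk K N.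
Proof.
have [M M0 hM] := lev_bnd.
exists (\sum_(s : {u in scc w}) (\sum_v M v * A v (val s) + l0 (val s))) => N s x.
have S0 (t : {u in scc w}) : 0 <= \sum_v M v * A v (val t) + l0 (val t).
  by rewrite addr_ge0//; apply: sumr_ge0 => v _; rewrite mulr_ge0.
apply: (@le_trans _ _ ((\sum_v M v * A v (val s) + l0 (val s)) * bk K N)); last first.
  by rewrite ler_pM2r ?bk_gt0// (bigD1 s)//= lerDl; apply: sumr_ge0 => t _; exact: S0.
rewrite /F mulrDl; apply: le_trans (ler_normD _ _) _; apply: lerD; last first.
  by apply: le_trans (F0l0 _ _) _; rewrite ler_peMr// bk_ge1.
case: N => [|n].
  by rewrite normr0 mulr_ge0 ?(ltW (bk_gt0 _ _))//; apply: sumr_ge0 => v _; rewrite mulr_ge0.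
apply: (@le_trans _ _ ((\sum_v M v * A v (val s)) * bk K n)); last first.
  by rewrite ler_wpM2l ?bk_leS//; apply: sumr_ge0 => v _; rewrite mulr_ge0.
rewrite mulr_suml.
have := vop_abs H (F := mask (fun=> 0) (SS n)) (u := fun v => M v * bk K n).
move=> /(_ _ (val s) x) h'; apply: le_trans (h' _) _; last first.
  by apply: ler_sum => v _; rewrite mulrAC.
move=> v z; rewrite /mask; case: ifP => sv; last by rewrite normr0 mulr_ge0// ltW// bk_gt0.
by apply: le_trans (SS_abs _ _ _) (hM _ _ sv).
Qed.

Let F_meas N s : measurable_fun setT (F N s).
Proof.
apply: measurable_funD => //; case: N => [|n]; first exact: measurable_cst.
apply: (vop_meas H) => v; rewrite /mask; case: ifP => _; [exact: SS_meas|exact: measurable_cst].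
Qed.

Let F_lim : exists2 Fl : {u in scc w} -> X -> R, (forall s, bm (Fl s)) &
  forall s, aecvg nu (fun N x => F N s x / bk K N) (Fl s).
Proof.
have /choice[Gl hG] : forall v, exists Gl, bm Gl /\
    aecvg nu (fun N x => mask (fun=> 0) (SS N) v x / bk K N) Gl.
  move=> v; rewrite /mask; have [sv|_] := boolP (src v); last first.
    exists (fun=> 0); split; first exact: bm_cst.
    apply: aeW => x; apply: (eq_cvgn (v := fun=> 0)) => // [|n]; first exact: cvg_cst.
    by rewrite mul0r.
  by have [G bG cG] := good_raise (kapP sv) (kapK sv); exists G.
have bF0 v : bm (F0 v) by split => //; exists (l0 v).
(* [F0] survives in the limit only for [K = 0], where [bk K] is the constant 1. *)
exists (fun s x => Op Gl (val s) x + (if K is 0%N then F0 (val s) x else 0)).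
  move=> s; apply: bmD; first by apply: (vop_bm H) => v; case: (hG v).
  by case: (K) => [|k]; [exact: bF0|exact: bm_cst].
move=> s; have := vop_cvg H (u := fun N v x => mask (fun=> 0) (SS N) v x / bk K N) (fun v => (hG v).2) (val s).
apply: filterS => x hx; rewrite -cvg_shiftS /=.
have cF : (fun n => F0 (val s) x / bk K n.+1) @ \oo --> (if K is 0%N then F0 (val s) x else 0).
  case: (K) => [|k].
    by apply: (eq_cvgn (v := fun=> F0 (val s) x)) => // [|n]; [exact: cvg_cst|rewrite bk0 divr1].
  have := cvgMl_tmp (a := F0 (val s) x) (bk_inv_cvg k); rewrite mulr0 -cvg_shiftS; exact.
apply: (eq_cvgn (v := fun n => Op (fun v x => mask (fun=> 0) (SS n) v x / bk K n) (val s) x *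
    (bk K n / bk K n.+1) + F0 (val s) x / bk K n.+1)
  (m := Op Gl (val s) x * 1 + (if K is 0%N then F0 (val s) x else 0))); last by rewrite mulr1.
  by apply: cvgD => //; apply: cvgM => //; exact: bk_ratio.
move=> n; rewrite /F mulrDl; congr (_ + _).
have -> : (fun v x => mask (fun=> 0) (SS n) v x / bk K n) =
    (fun v x => (bk K n)^-1 * mask (fun=> 0) (SS n) v x).
  by apply/funext => v; apply/funext => z; rewrite mulrC.
by rewrite (vopZ H) [_^-1 * _]mulrC mulrA divfK ?bk_neq0.
Qed.

Let fK : if K is k.+1 then exists fl : {u in scc w} -> R,
   [/\ forall v, (fun n => f n v / bk k n) @ \oo --> fl v, forall v, 0 <= fl v &
     exists v, 0 < fl v]
  else forall v, exists M, forall N, \sum_(n < N) f n v <= M.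
Proof.
case EK : K => [|k] => [s|].
  have [M M0 hM] := lev_bnd; exists (\sum_v M v * A v (val s)) => N.
  rewrite /f /act exchange_big /=; apply: ler_sum => v _; rewrite -mulr_suml ler_wpM2r//.
  have [sv|sv] := boolP (src v); last first.
    by rewrite big1// => i _; rewrite /mask (negbTE sv).
  rewrite (eq_bigr (fun i : 'I_N => lev i v)); last by move=> i _; rewrite /mask sv.
  have := hM N v sv; rewrite EK bk0 mulr1; apply: le_trans.
  by rewrite big_ord_recr /= lerDl lev_ge0.
have /choice[L hL] : forall v, exists L : R, [/\ 0 <= L,
    (fun n => mask 0 (lev n) v / bk k n) @ \oo --> L & src v -> kap v = k.+1 -> 0 < L].
  move=> v; rewrite /mask; have [sv|_] := boolP (src v); last first.
    exists 0; split => //; apply: (eq_cvgn (v := fun=> 0)) => // [|n]; first exact: cvg_cst.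
    by rewrite mul0r.
  have kk : (kap v <= k.+1)%N by rewrite -EK kapK.
  by have [L [L0 cL Lp]] := growth_lim (lev_ge0 ^~ v) (kapP sv).1 kk; exists L.
exists (fun s => act A L (val s)); split.
- move=> s; apply: (eq_cvgn (v := fun n => act A (fun v => mask 0 (lev n) v / bk k n) (val s))) => //.
    by apply: cvgn_sum => v _; apply: cvgMr_tmp; case: (hL v).
  by move=> n; rewrite /f /act mulr_suml; apply: eq_bigr => v _; rewrite mulrAC.
- by move=> s; apply: sumr_ge0 => v _; rewrite mulr_ge0//; case: (hL v).
have [v sv kv] : exists2 v, src v & kap v = k.+1.
  have cp : (0 < #|src|)%N.
    rewrite lt0n; apply/eqP => s0; move: EK; rewrite /K big_pred0// => v.
    exact: (card0_eq s0 v).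
  by have [v sv vE] := eq_bigmax_cond kap cp; exists v; rewrite // -vE.
have := sv => /andP[_ /existsP[t /andP[tC vt]]].
exists (exist _ t tC) => /=; rewrite /act (bigD1 v)//= ltr_wpDr//.
  by apply: sumr_ge0 => u _; rewrite mulr_ge0//; case: (hL u).
by rewrite mulr_gt0//; case: (hL v) => _ _; exact.
Qed.

Lemma growth_step : exists k, forall u, u \in scc w -> good u k.
Proof.
have [M FM] := F_bnd; have [Fl bFl cFl] := F_lim.
have yS n s : y n.+1 s = act (subA A) (y n) s + f n s by exact: act_split.
pose c' (s : {u in scc w}) := c w (val s); pose h' (s : {u in scc w}) := h w (val s).
have c0 s : 0 < c' s by case: (ch0 (valP s)).
have h0 s : 0 < h' s by case: (ch0 (valP s)).
have cA' s : act (subA A) c' s = rho w * c' s by rewrite -cA ?(valP s)// big_sub.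
have Ah' s : \sum_t subA A s t * h' t = rho w * h' s by rewrite /h' -(Ah (valP s)) [RHS]big_sub.
(* With radius 1 the eigenvector equation forces an arc into [s] from its own component, so [s] lies
   on a cycle and [loops] applies. *)
have loops' : rho w = 1 -> forall s : {u in scc w}, 0 < subA A s s.
  move=> rho1 s; have := cA (valP s); rewrite rho1 mul1r => cE.
  have [v vC vs] : exists2 v, v \in scc w & edge v (val s).
    apply: contrapT => no; have [+ _] := ch0 (valP s); rewrite -cE big1 ?ltxx// => v vC.
    have -> : A v (val s) = 0; last by rewrite mulr0.
    apply/eqP; rewrite eq_le A0 andbT leNgt; apply/negP => vs; apply: no; by exists v.
  apply: (loops vs); move: vC (valP s); rewrite !inE => /andP[wv _] /andP[_ sw].
  exact: connect_trans sw wv.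
have Sy N s x : `|Srec (subOp Op) F N s x| <= \sum_(n < N.+1) y n s.
  by rewrite SrecE; exact: SS_abs.
have reach' : (exists n s, 0 < y n s) -> rho w <= 1.
  by move=> [n [s ys]]; exact: reach (valP s) ys.
have y0 n s : 0 <= y n s by exact: lev_ge0.
have [k hk] := component_growth (sub_vop (scc w) H) (scc_irreducible (w := w)) (rho0 w)
  c0 h0 cA' Ah' loops' y0 f0 yS F_meas FM bFl cFl Sy fK reach'.
exists k => u uC; have [gr [G bG cG]] := hk (exist _ u uC); split => //.
by exists G => //; apply: filterS cG => x hx; apply: eq_cvgn hx _ _ => // N; rewrite SrecE.
Qed.

End Step.

(** Induction on the number of ancestors. A vertex feeding the component of [w] from outside has
    fewer: its ancestors are ancestors of [w], but [w] is not among them, or it would lie in the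
    component. *)
Lemma growth_all w : exists k, good w k.
Proof.
have [m] := ubnP #|[pred u | connect edge u w]|; elim: m w => // m IH w; rewrite ltnS => cm.
have /choice[kap hkap] : forall v, exists k, src w v -> good v k.
  move=> v; have [sv|_] := boolP (src w v); last by exists 0%N.
  have [|k hk] := IH v; last by exists k.
  apply: leq_trans cm; apply: proper_card; move: sv => /andP[vC /existsP[t /andP[tC vt]]].
  have vw : connect edge v w.
    by apply: connect_trans (connect1 vt) _; move: tC; rewrite inE => /andP[].
  apply/properP; split.
    by apply/fintype.subsetP => u; rewrite !inE => uv; exact: connect_trans uv vw.
  exists w; rewrite !inE ?connect0//; apply: contra vC => wv; by rewrite inE wv.
by have [k hk] := growth_step hkap; exists k; apply: hk; exact: scc_refl.
Qed.

End Graph.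

(** * Cesaro means of ratios *)

Section CesaroMeans.
Context {R : realType}.
Implicit Types (u v a s : nat -> R).

Definition cmean u N : R := N%:R^-1 * \sum_(n < N) u n.

Lemma cmean_cvg u (l : R) : u @ \oo --> l -> cmean u @ \oo --> l.
Proof.
move=> /cesaro; rewrite -[cmean u @ \oo --> l]cvg_shiftS.
by apply: cvg_trans; apply: near_eq_cvg; apply: nearW => n; rewrite /arithmetic_mean /cmean /series /= big_mkord.
Qed.

Lemma cmeanD u v N : cmean (fun n => u n + v n) N = cmean u N + cmean v N.
Proof. by rewrite /cmean big_split mulrDr. Qed.

Lemma cmeanZ (b : R) u N : cmean (fun n => b * u n) N = b * cmean u N.
Proof. by rewrite /cmean -mulr_sumr mulrCA. Qed.

(* Summation by parts; the coefficients come from the exact identity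
   [bk (k+1) n * (1 / bk k n - 1 / bk k (n+1)) = k / (k+1)]. *)
Lemma abel_bk a k N (t := fun n => (\sum_(j < n.+1) a j) / bk k.+1 n) :
  \sum_(n < N.+1) a n / bk k n =
  t N * (N + k.+1)%:R / k.+1%:R + k%:R / k.+1%:R * \sum_(n < N) t n.
Proof.
have k0 : k.+1%:R != 0 :> R by rewrite pnatr_eq0.
elim: N => [|N IH].
  by rewrite !big_ord1 big_ord0 mulr0 addr0 /t big_ord1 !bk_0 !divr1 add0n mulfK.
rewrite big_ord_recr IH [in RHS]big_ord_recr /=.
have E1 : t N.+1 * (N.+1 + k.+1)%:R / k.+1%:R = (\sum_(j < N.+1) a j + a N.+1) / bk k N.+1.
  rewrite /t big_ord_recr /=; have := bk_mulS k N.+1 (R := R).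
  have := bk_neq0 k N.+1 (R := R); have := bk_neq0 k.+1 N.+1 (R := R) => b1 b2 e.
  apply: (mulIf b2); rewrite divfK//.
  rewrite -!mulrA [_^-1 * bk _ _]mulrC [(N.+1 + k.+1)%:R * _]mulrA [_ * bk k N.+1]mulrC -e.
  by rewrite mulfK// mulVf ?mulr1.
have E2 : t N * N.+1%:R / k.+1%:R = (\sum_(j < N.+1) a j) / bk k N.+1.
  rewrite /t; have := bk_mulS k N (R := R); rewrite addnS -addSn -bk_succ.
  have := bk_neq0 k N.+1 (R := R); have := bk_neq0 k.+1 N (R := R) => b1 b2 e.
  apply: (mulIf b2); rewrite divfK//.
  rewrite -!mulrA [_^-1 * bk _ _]mulrC [N.+1%:R * _]mulrA [N.+1%:R * bk _ _]mulrC -e.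
  by rewrite mulfK// mulVf ?mulr1.
have kE : k%:R = k.+1%:R - 1 :> R by rewrite -natr1 addrK.
rewrite mulrDr E1 mulrDl -E2 addnS -addSn natrD kE.
field; rewrite nat1r k0 /=; exact: bk_neq0.
Qed.

(** In [abel_bk] the boundary term contributes [psi / k.+1] and the mean of the [t n] contributes
    the remaining fraction [k / k.+1] of [psi]. *)
Lemma cmean_bk a k (psi : R) :
  (fun N => (\sum_(n < N.+1) a n) / bk k.+1 N) @ \oo --> psi ->
  cmean (fun n => a n / bk k n) @ \oo --> psi.
Proof.
move=> cv; rewrite -cvg_shiftS; set t := fun N => _ in cv.
have k0 : k.+1%:R != 0 :> R by rewrite pnatr_eq0.
have cN (b : R) : (fun N : nat => b / N.+1%:R) @ \oo --> (0 : R).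
  by have := cvgMl_tmp (a := b) (@cvg_natV R); rewrite mulr0; exact.
apply: (eq_cvgn (v := fun N => t N / k.+1%:R * (1 + k%:R / N.+1%:R) +
    k%:R / k.+1%:R * (cmean t N.+1 - t N * N.+1%:R^-1))
  (m := psi / k.+1%:R * (1 + 0) + k%:R / k.+1%:R * (psi - psi * 0))).
- apply: cvgD; first by apply: cvgM; [exact: cvgMr_tmp|apply: cvgD; [exact: cvg_cst|exact: cN]].
  apply: cvgMl_tmp; apply: cvgB; first by have := cmean_cvg cv; rewrite -cvg_shiftS.
  by apply: cvgM => //; exact: cvg_natV.
- move=> N; rewrite /= /cmean abel_bk -/t [in RHS]big_ord_recr /= -/(t N) addnS -addSn natrD.
  have n0 : N.+1%:R != 0 :> R by rewrite pnatr_eq0.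
  set S := \sum_(i < N) _; set T := t N.
  by field; apply/andP.
- by rewrite mulr0 subr0 addr0 mulr1 -[k.+1]addn1 natrD; field; rewrite natr1 pnatr_eq0.
Qed.

(** As [a n / s n] is at most 1 in absolute value, exchanging [s n] for its equivalent [c * bk k n]
    changes the terms by a null sequence. Where [s n = 0] also [a n = 0], and both quotients are
    0. *)
Lemma cmean_ratio a s k (psi c : R) : 0 < c ->
  (fun N => (\sum_(n < N.+1) a n) / bk k.+1 N) @ \oo --> psi ->
  (fun n => s n / bk k n) @ \oo --> c -> (forall n, `|a n| <= s n) ->
  cmean (fun n => a n / s n) @ \oo --> psi / c.
Proof.
move=> c0 ca cs as_.
have d0 : (fun n => a n / s n - c^-1 * (a n / bk k n)) @ \oo --> (0 : R).
  apply: norm_cvg0.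
  apply: (@squeeze_cvgr _ _ _ _ (fun _ => 0) (fun n => `|1 - s n / bk k n / c|)).
  - apply: nearW => n; rewrite normr_ge0/=.
    have [s0|s0] := eqVneq (s n) 0.
      have -> : a n = 0 by apply/eqP; rewrite -normr_le0 -s0.
      by rewrite !mul0r mulr0 subr0 normr0.
    have -> : a n / s n - c^-1 * (a n / bk k n) = a n / s n * (1 - s n / bk k n / c).
      have := bk_neq0 k n (R := R) => b0; field; rewrite b0 s0 gt_eqF//.
    rewrite normrM ler_piMl// normrM normfV ler_pdivrMr ?normr_gt0// mul1r.
    exact: le_trans (as_ n) (ler_norm _).
  - exact: cvg_cst.
  - have : (fun n => 1 - s n / bk k n / c) @ \oo --> 1 - c / c.
      by apply: cvgB; [exact: cvg_cst|exact: cvgMr_tmp].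
    by rewrite divff ?gt_eqF// subrr => /cvg_norm; rewrite normr0.
apply: (eq_cvgn (v := fun N => cmean (fun n => a n / s n - c^-1 * (a n / bk k n)) N +
   c^-1 * cmean (fun n => a n / bk k n) N) (m := 0 + c^-1 * psi)).
- apply: cvgD; first exact: cmean_cvg.
  by apply: cvgMl_tmp; exact: cmean_bk.
- move=> N; rewrite -cmeanZ -cmeanD; congr (_ * _); apply: eq_bigr => n _.
  by rewrite subrK.
- by rewrite add0r mulrC.
Qed.

(** [(N + (q.-1 - r)) %/ q] is the number of [m] with [m * q + r < N]. *)
Lemma sum_residues u (q N : nat) : (0 < q)%N ->
  \sum_(n < N) u n = \sum_(r < q) \sum_(m < (N + (q.-1 - r)) %/ q) u (m * q + r)%N.
Proof.
move=> q0; elim: N => [|N IH].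
  rewrite big_ord0 big1// => r _; rewrite add0n divn_small ?big_ord0//.
  have := ltn_ord r; lia.
rewrite big_ord_recr /= IH.
pose r0 := Ordinal (ltn_pmod N q0).
have NE := divn_eq N q; have Nm := ltn_pmod N q0.
rewrite (bigD1 r0)//= [in RHS](bigD1 r0)//=.
have -> : ((N + (q.-1 - N %% q)) %/ q = N %/ q)%N.
  have -> : (N + (q.-1 - N %% q) = N %/ q * q + q.-1)%N by lia.
  by rewrite divnMDl// (@divn_small q.-1) ?addn0//; lia.
have -> : ((N.+1 + (q.-1 - N %% q)) %/ q = (N %/ q).+1)%N.
  have -> : (N.+1 + (q.-1 - N %% q) = (N %/ q).+1 * q)%N by rewrite mulSn; lia.
  by rewrite mulnK.
rewrite big_ord_recr /= -NE addrAC; congr (_ + _).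
apply: eq_bigr => r rr0; have rq := ltn_ord r.
have rN : (r : nat) <> (N %% q)%N by move=> e; move: rr0; rewrite -val_eqE /= e eqxx.
suff -> : ((N.+1 + (q.-1 - r)) %/ q = (N + (q.-1 - r)) %/ q)%N by [].
have [lt|ge] := ltnP r (N %% q).
  have -> : (N.+1 + (q.-1 - r) = (N %/ q).+1 * q + (N %% q - r))%N.
    by rewrite mulSn; lia.
  have -> : (N + (q.-1 - r) = (N %/ q).+1 * q + (N %% q - r).-1)%N.
    by rewrite mulSn; lia.
  rewrite !divnMDl// (@divn_small (N %% q - r)) ?(@divn_small (N %% q - r).-1)//; lia.
have -> : (N.+1 + (q.-1 - r) = (N %/ q) * q + (N %% q + q - r))%N by lia.
have -> : (N + (q.-1 - r) = (N %/ q) * q + (N %% q + q - r).-1)%N by lia.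
rewrite !divnMDl// (@divn_small (N %% q + q - r)) ?(@divn_small (N %% q + q - r).-1)//; lia.
Qed.

(** Each residue class has density [q^-1], which is [cM] in the proof. *)
Lemma cmean_residues u q (l : nat -> R) : (0 < q)%N ->
  (forall r, (r < q)%N -> cmean (fun m => u (m * q + r)%N) @ \oo --> l r) ->
  cmean u @ \oo --> (\sum_(r < q) l r) / q%:R.
Proof.
move=> q0 cl.
have qn : q%:R != 0 :> R by rewrite pnatr_eq0 -lt0n.
have cM r : (fun N => ((N + r) %/ q)%:R / N%:R) @ \oo --> (q%:R^-1 : R).
  apply/cvgrPdist_le => e e0.
  have [K _ hK] : \forall N \near \oo, (q + r)%:R * N.+1%:R^-1 <= e.
    by apply: (cvgr_le _ (cvgMl_tmp (a := (q + r)%:R) (@cvg_natV R))); rewrite mulr0.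
  exists K.+1 => // -[//|N] /=; rewrite ltnS => KN; apply: le_trans (hK _ KN).
  have n0 : 0 < N.+1%:R :> R by rewrite ltr0n.
  have nn : N.+1%:R != 0 :> R by rewrite gt_eqF.
  have -> : q%:R^-1 - ((N.+1 + r) %/ q)%:R / N.+1%:R =
     (N.+1%:R - ((N.+1 + r) %/ q * q)%:R) / q%:R / N.+1%:R :> R.
    by rewrite natrM; field; apply/andP.
  rewrite normrM [`|N.+1%:R^-1|]normfV (gtr0_norm n0) ler_pM2r ?invr_gt0//.
  rewrite normrM normfV normr_nat ler_pdivrMr ?ltr0n//.
  have -> : N.+1%:R - ((N.+1 + r) %/ q * q)%:R = ((N.+1 + r) %% q)%:R - r%:R :> R.
    by apply/eqP; rewrite subr_eq addrAC -natrD addnC -divn_eq natrD addrK.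
  apply: le_trans (ler_normB _ _) _; rewrite !normr_nat -natrD -natrM ler_nat.
  have := ltn_pmod (N.+1 + r) q0; nia.
rewrite mulr_suml.
apply: (eq_cvgn (v := fun N => \sum_(r < q) cmean (fun m => u (m * q + r)%N) ((N + (q.-1 - r)) %/ q) *
   (((N + (q.-1 - r)) %/ q)%:R / N%:R)) (m := \sum_(r < q) l r / q%:R)) => //.
  apply: cvgn_sum => r _; apply: cvgM => //.
  have := cl r (ltn_ord r); apply: cvg_comp.
  move=> P [K _ hK]; exists (K * q)%N => // N /= KN; apply: hK => /=.
  by rewrite leq_divRL//; apply: leq_trans KN (leq_addr _ _).
move=> N; rewrite /cmean (sum_residues u N q0) mulr_sumr; apply: eq_bigr => r _.
set n := (_ %/ _)%N; have [->|n0] := eqVneq n 0%N.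
  by rewrite big_ord0 !mulr0 mul0r.
by rewrite mulrACA mulVf ?pnatr_eq0// mul1r mulrC.
Qed.

End CesaroMeans.

(** * Totals over all vertices when the reached radii are at most 1 *)

Section Normalized.
Context d (X : measurableType d) (R : realType) (nu : probability X R) (V : finType).
Context (A : V -> V -> R) (Op : (V -> X -> R) -> V -> X -> R) (H : vop nu A Op).
Context (l0 : V -> R) (F0 : V -> X -> R).
Hypothesis l0_ge0 : forall v, 0 <= l0 v.
Hypothesis mF0 : forall v, measurable_fun setT (F0 v).
Hypothesis F0l0 : forall v x, `|F0 v x| <= l0 v.

Definition stot n := \sum_v lev A l0 n v.
Definition atot n x := \sum_v Phi Op F0 n v x.

Lemma atot_stot n x : `|atot n x| <= stot n.
Proof.
apply: le_trans (ler_norm_sum _ _ _) _; apply: ler_sum => v _; exact: (Phi_lev H).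
Qed.

Lemma stot_ge0 n : 0 <= stot n.
Proof. by apply: sumr_ge0 => v _; exact: (lev_ge0 H). Qed.

(** The total takes the largest order among the vertices. If a component of radius 1 is reached,
    that order is not 0: the [h]-weighted mass of the component never decreases and is positive at
    some time, so its counts cannot all be summable. *)
Lemma total_growth (rho : V -> R) (c h : V -> V -> R) :
  (forall w, 0 <= rho w) -> (forall w u, u \in scc A w -> 0 < c w u /\ 0 < h w u) ->
  (forall w u, u \in scc A w -> \sum_(v in scc A w) c w v * A v u = rho w * c w u) ->
  (forall w v, v \in scc A w -> \sum_(u in scc A w) A v u * h w u = rho w * h w v) ->
  (forall w u n, u \in scc A w -> 0 < lev A l0 n u -> rho w <= 1) ->
  (forall v w, edge A v w -> connect (edge A) w v -> 0 < A w w) ->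
  exists K, [/\ growth stot K,
    exists2 G, bm G & aecvg nu (fun N x => (\sum_(n < N.+1) atot n x) / bk K N) G &
    (exists w u n, [/\ u \in scc A w, 0 < lev A l0 n u & rho w = 1]) -> (0 < K)%N].
Proof.
move=> rho0 ch0 cA Ah reach loops.
have /choice[kap kapP] := growth_all H l0_ge0 mF0 F0l0 rho0 ch0 cA Ah reach loops.
pose K := (\max_v kap v)%N.
have kapK v : (kap v <= K)%N by apply: leq_bigmax_cond.
have lev0 n v : 0 <= lev A l0 n v by exact: (lev_ge0 H).
exists K; split.
- case EK : K => [|k].
    have /choice[M hM] : forall v, exists M, forall N, \sum_(n < N) lev A l0 n v <= M.
      move=> v; have [+ _] := kapP v.
      by have := kapK v; rewrite EK leqn0 => /eqP ->.
    exists (\sum_v M v) => N; rewrite exchange_big /=; apply: ler_sum => v _; exact: hM.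
  have /choice[L hL] : forall v, exists L : R, [/\ 0 <= L,
      (fun n => lev A l0 n v / bk k n) @ \oo --> L & kap v = k.+1 -> 0 < L].
    by move=> v; apply: growth_lim (kapP v).1 _ => //; rewrite -EK.
  exists (\sum_v L v); last first.
    apply: (eq_cvgn (v := fun n => \sum_v lev A l0 n v / bk k n)) => // [|n].
      by apply: cvgn_sum => v _; case: (hL v).
    by rewrite /stot mulr_suml.
  have cp : (0 < #|V|)%N.
    rewrite lt0n; apply/eqP => V0; move: EK; rewrite /K big_pred0// => v.
    exact: (card0_eq V0 v).
  have [v vE] := bigop.eq_bigmax kap cp.
  rewrite (bigD1 v)//= ltr_wpDr//; first by apply: sumr_ge0 => u _; case: (hL u).
  by case: (hL v) => _ _; apply; rewrite -EK /K vE.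
- have /choice[G hG] : forall v, exists G, bm G /\ aecvg nu (fun N x => SS Op F0 N v x / bk K N) G.
    by move=> v; have [G bG cG] := good_raise (kapP v) (kapK v); exists G.
  exists (fun x => \sum_v G v x); first by apply: bm_sum => v; case: (hG v).
  have : {ae nu, forall x, forall v, (fun N => SS Op F0 N v x / bk K N) @ \oo --> G v x}.
    by apply: filter_forall => v; case: (hG v).
  apply: filterS => x hx.
  apply: (eq_cvgn (v := fun N => \sum_v SS Op F0 N v x / bk K N)) => // [|N].
    by apply: cvgn_sum => v _; exact: hx.
  by rewrite /atot /SS exchange_big /= mulr_suml.
- move=> [w [u [n [uC lu rho1]]]]; rewrite lt0n; apply/eqP => K0.
  pose eta m := \sum_(v in scc A w) h w v * lev A l0 m v.
  have eta_nd : nondecreasing_seq eta.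
    apply/nondecreasing_seqP => m; rewrite /eta.
    have -> : \sum_(v in scc A w) h w v * lev A l0 m v =
        \sum_(v in scc A w) \sum_(t in scc A w) lev A l0 m v * A v t * h w t.
      apply: eq_bigr => v vC; rewrite -[h w v]mul1r -rho1 -(Ah w v vC) mulr_suml.
      by apply: eq_bigr => t _; ring.
    rewrite exchange_big /=; apply: ler_sum => t tC.
    rewrite -mulr_suml mulrC ler_wpM2l ?(ltW (ch0 _ _ tC).2)// /act.
    rewrite [leRHS](bigID (mem (scc A w))) /= lerDl; apply: sumr_ge0 => v _.
    by rewrite mulr_ge0// (vop_ge0 H).
  have eta0 : eta @ \oo --> (0 : R).
    apply: (eq_cvgn (v := eta) (m := \sum_(v in scc A w) h w v * 0)) => //; last first.
      by rewrite big1// => v _; rewrite mulr0.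
    apply: cvgn_sum => v _; apply: cvgMl_tmp.
    have [+ _] := kapP v; have := kapK v; rewrite K0 leqn0 => /eqP -> [M hM].
    exact: summable_cvg0 hM.
  have : eta n <= 0.
    rewrite -(cvg_lim _ eta0)//; apply: nondecreasing_cvgn_le => //.
    by apply/cvg_ex; exists 0.
  rewrite leNgt => /negP; apply.
  rewrite /eta (bigD1 u)//= ltr_wpDr ?mulr_gt0 ?(ch0 _ _ uC).2//.
  by apply: sumr_ge0 => v /andP[vC _]; rewrite mulr_ge0// ltW// (ch0 _ _ vC).2.
Qed.

Lemma total_ratio K : growth stot K.+1 ->
  (exists2 G, bm G & aecvg nu (fun N x => (\sum_(n < N.+1) atot n x) / bk K.+1 N) G) ->
  {ae nu, forall x, exists l : R, cmean (fun n => atot n x / stot n) @ \oo --> l}.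
Proof.
move=> [c c0 cs] [G _ cG]; apply: filterS cG => x hx; exists (G x / c).
exact: cmean_ratio c0 hx cs (atot_stot^~ x).
Qed.

End Normalized.

(** * Multiples and powers of operators, and removal of periodicity *)

Section VopAlgebra.
Context d (X : measurableType d) (R : realType) (nu : probability X R) (V : finType).
Implicit Types (A B : V -> V -> R) (Op : (V -> X -> R) -> V -> X -> R).

Lemma vop_scale A Op (b : R) : 0 <= b -> vop nu A Op ->
  vop nu (fun v w => b * A v w) (fun F w x => b * Op F w x).
Proof.
move=> b0 H; split.
- by move=> v w; rewrite mulr_ge0// (vop_ge0 H).
- by move=> a F G w x; rewrite (vop_lin H); ring.
- by move=> F G FG w x; rewrite ler_wpM2l// (vop_mono H).
- by move=> u w x; rewrite (vop_cst H) mulr_sumr; apply: eq_bigr => v _; ring.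
- move=> F mF w; apply: measurable_funM; [exact: measurable_cst|exact: (vop_meas H)].
- move=> F bF w; rewrite EEZ ?(vop_int H)//; last exact: (vop_bm H).
  by rewrite mulr_sumr; apply: eq_bigr => v _; ring.
- by move=> u G uG w; apply: filterS (vop_cvg H uG w) => x; exact: cvgMl_tmp.
Qed.

Definition mid : V -> V -> R := fun v w => (v == w)%:R.
Definition mmul A B : V -> V -> R := fun v w => \sum_u A v u * B u w.
Fixpoint mpow A n : V -> V -> R := if n is m.+1 then mmul (mpow A m) A else mid.

Lemma act_mid (u : V -> R) : act mid u = u.
Proof.
apply/funext => w; rewrite /act /mid (bigD1 w)//= eqxx mulr1 big1 ?addr0// => v /negbTE ->.
by rewrite mulr0.
Qed.

Lemma act_mmul A B (u : V -> R) : act (mmul A B) u = act B (act A u).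
Proof.
apply/funext => w; rewrite /act; under eq_bigr do rewrite mulr_sumr; rewrite exchange_big /=.
by apply: eq_bigr => t _; rewrite mulr_suml; apply: eq_bigr => v _; rewrite mulrA.
Qed.

Lemma act_mpow A n (u : V -> R) : act (mpow A n) u = iter n (act A) u.
Proof. by elim: n => [|n IH] /=; rewrite ?act_mid// act_mmul IH. Qed.

Lemma vop_id : vop nu mid id.
Proof.
split => //.
- by move=> u w _; rewrite -[RHS]/(act mid u w) act_mid.
- by move=> F bF w; rewrite -[RHS]/(act mid (fun v => EE nu (F v)) w) act_mid.
Qed.

Lemma vop_comp A B Op1 Op2 : vop nu A Op1 -> vop nu B Op2 ->
  vop nu (mmul A B) (fun F => Op2 (Op1 F)).
Proof.
move=> H1 H2; split.
- by move=> v w; apply: sumr_ge0 => u _; rewrite mulr_ge0// ?(vop_ge0 H1)// (vop_ge0 H2).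
- move=> a F G w x; rewrite -(vop_lin H2); congr (Op2 _ w x).
  by apply/funext => v; apply/funext => y; exact: (vop_lin H1).
- by move=> F G FG w x; apply: (vop_mono H2); exact: (vop_mono H1).
- move=> u w x; rewrite -[RHS]/(act (mmul A B) u w) act_mmul -[RHS](vop_cst H2 (act A u) w x).
  congr (Op2 _ w x); apply/funext => v; apply/funext => y; exact: (vop_cst H1).
- by move=> F mF w; apply: (vop_meas H2); exact: (vop_meas H1).
- move=> F bF w; rewrite (vop_int H2); last exact: (vop_bm H1).
  rewrite -[RHS]/(act (mmul A B) (fun v => EE nu (F v)) w) act_mmul.
  by apply: eq_bigr => v _; rewrite (vop_int H1).
- move=> u G uG w; apply: (vop_cvg H2 (u := fun n => Op1 (u n))); exact: (vop_cvg H1).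
Qed.

Lemma vop_iter A Op n : vop nu A Op -> vop nu (mpow A n) (iter n Op).
Proof.
move=> H; elim: n => [|n IH]; first exact: vop_id.
exact: (vop_comp IH H).
Qed.

Lemma mpow_ge0 A n v w : (forall v w, 0 <= A v w) -> 0 <= mpow A n v w.
Proof.
move=> A0; elim: n w => [|n IH] w /=; first by rewrite /mid ler0n.
by apply: sumr_ge0 => u _; rewrite mulr_ge0.
Qed.

Lemma mpow_pos A a b u v w : (forall v w, 0 <= A v w) ->
  0 < mpow A a u v -> 0 < mpow A b v w -> 0 < mpow A (a + b) u w.
Proof.
move=> A0 h; elim: b w => [|b IH] w /=.
  by rewrite /mid addn0; case: eqVneq => [<- _|_]; rewrite ?h// ltxx.
rewrite addnS /= => hs.
have [t ht] : exists t, 0 < mpow A b v t * A t w.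
  apply: contrapT => /forallNP no; move: hs; rewrite /mmul big1 ?ltxx// => t _.
  by apply/eqP; rewrite eq_le mulr_ge0 ?mpow_ge0// andbT leNgt; apply/negP.
have hb : 0 < mpow A b v t.
  rewrite lt_neqAle mpow_ge0// andbT eq_sym; apply: contraTneq ht => ->; by rewrite mul0r ltxx.
have hA : 0 < A t w.
  rewrite lt_neqAle A0 andbT eq_sym; apply: contraTneq ht => ->; by rewrite mulr0 ltxx.
rewrite /mmul (bigD1 t)//= ltr_wpDr ?mulr_gt0 ?IH//.
by apply: sumr_ge0 => s _; rewrite mulr_ge0// mpow_ge0.
Qed.

Lemma connect_mpow A q v w : (forall v w, 0 <= A v w) -> connect (edge (mpow A q)) v w ->
  exists n, 0 < mpow A n v w.
Proof.
move=> A0 /connectP[p pp ->]; elim: p v pp => [|u p IH] v /=.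
  by exists 0%N; rewrite /= /mid eqxx.
by move=> /andP[vu /IH[n hn]]; exists (q + n)%N; exact: mpow_pos hn.
Qed.

(** Each vertex on a cycle picks a return time, the others pick 1, and [q] is the product of all
    picks, hence a multiple of every chosen return time. *)
Lemma exists_loops A : (forall v w, 0 <= A v w) -> exists2 q, (0 < q)%N &
  forall v w, edge (mpow A q) v w -> connect (edge (mpow A q)) w v -> 0 < mpow A q w w.
Proof.
move=> A0.
have /choice[nn hn] : forall v, exists n, (0 < n)%N /\
    ((exists2 m, (0 < m)%N & 0 < mpow A m v v) -> 0 < mpow A n v v).
  move=> v; have [[m m0 hm]|no] := pselect (exists2 m, (0 < m)%N & 0 < mpow A m v v).
    by exists m.
  by exists 1%N.
exists (\prod_v nn v)%N; first by rewrite prodn_gt0// => v; case: (hn v).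
move=> v w vw /(connect_mpow A0)[b hb].
have hw : 0 < mpow A (nn w) w w.
  case: (hn w) => _; apply; exists (b + \prod_v nn v)%N; last exact: mpow_pos vw.
  by rewrite addn_gt0 prodn_gt0 ?orbT// => t; case: (hn t).
rewrite (bigD1 w)//= mulnC; elim: (\prod_(_ | _) _)%N => [|k IH]; first by rewrite /= /mid eqxx.
by rewrite mulSn; exact: mpow_pos IH.
Qed.

End VopAlgebra.

Section Scaling.
Context d (X : measurableType d) (R : realType) (V : finType).
Context (A : V -> V -> R) (Op : (V -> X -> R) -> V -> X -> R) (b : R).

Lemma lev_scale l0 n v : lev (fun v w => b * A v w) l0 n v = b ^+ n * lev A l0 n v.
Proof.
elim: n v => [|n IH] v /=; first by rewrite mul1r.
by rewrite /act exprS mulr_sumr; apply: eq_bigr => u _; rewrite -/(lev _ _ n) IH; ring.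
Qed.

Lemma Phi_scale (nu : probability X R) F0 n v x : vop nu A Op ->
  Phi (fun F w x => b * Op F w x) F0 n v x = b ^+ n * Phi Op F0 n v x.
Proof.
move=> H; elim: n v x => [|n IH] v x /=; first by rewrite mul1r.
rewrite exprS -mulrA; congr (_ * _); rewrite -(vopZ H); congr (Op _ v x).
by apply/funext => w; apply/funext => y; exact: IH.
Qed.

End Scaling.

(** * Normalization of the radius and convergence of the ratios *)

Section Main.
Context d (X : measurableType d) (R : realType) (nu : probability X R) (V : finType).

(** Dividing [A] by the largest radius [lam] of a reached component multiplies numerator and
    denominator at level [n] by the same power, so the ratios do not change. Unreached components
    may have larger radius and are left out of the maximum. *)
Lemma cesaro_loops (A : V -> V -> R) (Op : (V -> X -> R) -> V -> X -> R) (H : vop nu A Op)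
  (l0 : V -> R) (F0 : V -> X -> R) :
  (forall v, 0 <= l0 v) -> (forall v, measurable_fun setT (F0 v)) ->
  (forall v x, `|F0 v x| <= l0 v) ->
  (forall v w, edge A v w -> connect (edge A) w v -> 0 < A w w) ->
  (forall n, stot A l0 n = 0 \/ 1 <= stot A l0 n) ->
  {ae nu, forall x, exists l : R, cmean (fun n => atot Op F0 n x / stot A l0 n) @ \oo --> l}.
Proof.
move=> l0_ge0 mF0 F0l0 loops ints.
have /choice[t ht] : forall w, exists t : R * ((V -> R) * (V -> R)), [/\ 0 <= t.1,
  forall u, u \in scc A w -> 0 < t.2.1 u /\ 0 < t.2.2 u,
  forall u, u \in scc A w -> \sum_(v in scc A w) t.2.1 v * A v u = t.1 * t.2.1 u &
  forall v, v \in scc A w -> \sum_(u in scc A w) A v u * t.2.2 u = t.1 * t.2.2 v].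
  by move=> w; have [rho [c [h P]]] := scc_pf H w; exists (rho, (c, h)).
pose rho w := (t w).1; pose c w := (t w).2.1; pose h w := (t w).2.2.
have rho0 w : 0 <= rho w by case: (ht w).
have ch0 w u : u \in scc A w -> 0 < c w u /\ 0 < h w u by case: (ht w) => _ + _ _; exact.
have cA w u : u \in scc A w -> \sum_(v in scc A w) c w v * A v u = rho w * c w u.
  by case: (ht w) => _ _ + _; exact.
have Ah w v : v \in scc A w -> \sum_(u in scc A w) A v u * h w u = rho w * h w v.
  by case: (ht w) => _ _ _; exact.
pose Rch w := `[< exists u n, u \in scc A w /\ 0 < lev A l0 n u >].
(* If no reached component has positive radius there is nothing to divide by. Totals that are
   summable are then eventually below 1, hence 0 by [ints], and division by 0 makes the ratios 0. *)
have [[w0 Rw0 rw0]|no] := pselect (exists2 w, Rch w & 0 < rho w); last first.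
  have reach w u n : u \in scc A w -> 0 < lev A l0 n u -> rho w <= 1.
    move=> uC lu; rewrite leNgt; apply/negP => r1; apply: no; exists w.
      by apply/asboolP; exists u, n.
    exact: lt_trans r1.
  have [[|K] [gs cG _]] := total_growth H l0_ge0 mF0 F0l0 rho0 ch0 cA Ah reach loops.
    case: gs => M hM; have s0 := summable_cvg0 (stot_ge0 H l0_ge0) hM.
    apply: aeW => x; exists 0; apply: cmean_cvg; apply: cvg_near_cst.
    have : \forall n \near \oo, stot A l0 n < 1 by exact: (cvgr_lt _ s0).
    apply: filterS => n s1; case: (ints n) => [->|]; first by rewrite invr0 mulr0.
    by rewrite leNgt s1.
  exact: (total_ratio H F0l0 gs cG).
have [w1 Rw1 max] : exists2 w, Rch w & forall u, Rch u -> rho u <= rho w.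
  by case: (Order.TotalTheory.arg_maxP rho Rw0) => w Pw hw; exists w.
pose lam := rho w1.
have lam0 : 0 < lam by exact: lt_le_trans rw0 (max _ Rw0).
pose A' v w := lam^-1 * A v w.
have H' : vop nu A' (fun F w x => lam^-1 * Op F w x) by apply: vop_scale; rewrite ?invr_ge0 ?ltW.
have edgeE : edge A' = edge A.
  by apply/funext => v; apply/funext => w; rewrite /edge /A' pmulr_rgt0 ?invr_gt0.
have sccE : scc A' = scc A by rewrite /scc edgeE.
pose rho' w := lam^-1 * rho w.
have rho0' w : 0 <= rho' w by rewrite mulr_ge0// invr_ge0 ltW.
have ln0 : lam != 0 by rewrite gt_eqF.
have levp n v : (0 < lev A' l0 n v) = (0 < lev A l0 n v).
  by rewrite lev_scale pmulr_rgt0// exprn_gt0// invr_gt0.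
have [|||||K [gs cG Kp]] := @total_growth _ _ _ _ _ A' _ H' l0 F0 l0_ge0 mF0 F0l0 rho' c h rho0'.
- by move=> w u; rewrite sccE; exact: ch0.
- move=> w u; rewrite sccE => uC; rewrite /rho' -mulrA -(cA _ _ uC) mulr_sumr.
  by apply: eq_bigr => v _; rewrite /A'; ring.
- move=> w v; rewrite sccE => vC; rewrite /rho' -mulrA -(Ah _ _ vC) mulr_sumr.
  by apply: eq_bigr => u _; rewrite /A'; ring.
- move=> w u n; rewrite sccE levp => uC lu; rewrite /rho' mulrC ler_pdivrMr// mul1r.
  by apply: max; apply/asboolP; exists u, n.
- move=> v w; rewrite edgeE => vw wv; rewrite /A' mulr_gt0 ?invr_gt0//; exact: loops vw wv.
have {Kp} K0 : (0 < K)%N.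
  apply: Kp; have /asboolP[u [n [uC lu]]] := Rw1; exists w1, u, n.
  by rewrite sccE levp /rho' mulVf.
case: K K0 gs cG => // K _ gs cG.
have := total_ratio H' F0l0 gs cG.
apply: filterS => x [l hl]; exists l; apply: eq_cvgn hl _ _ => // N.
congr (_ * _); apply: eq_bigr => n _.
have -> : stot A' l0 n = lam^-1 ^+ n * stot A l0 n.
  by rewrite /stot mulr_sumr; apply: eq_bigr => v _; rewrite lev_scale.
have -> : atot (fun F w x => lam^-1 * Op F w x) F0 n x = lam^-1 ^+ n * atot Op F0 n x.
  by rewrite /atot mulr_sumr; apply: eq_bigr => v _; rewrite (Phi_scale _ _ _ _ _ H).
by rewrite -mulf_div divff ?mul1r// expf_neq0// invr_eq0.
Qed.

Theorem cesaro_vop (A : V -> V -> R) (Op : (V -> X -> R) -> V -> X -> R) (H : vop nu A Op)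
  (l0 : V -> R) (F0 : V -> X -> R) :
  (forall v, 0 <= l0 v) -> (forall v, measurable_fun setT (F0 v)) ->
  (forall v x, `|F0 v x| <= l0 v) ->
  (forall n, stot A l0 n = 0 \/ 1 <= stot A l0 n) ->
  {ae nu, forall x, exists l : R, cmean (fun n => atot Op F0 n x / stot A l0 n) @ \oo --> l}.
Proof.
move=> l0_ge0 mF0 F0l0 ints.
have [q q0 loops] := exists_loops (vop_ge0 H).
have levE r m : lev (mpow A q) (lev A l0 r) m = lev A l0 (m * q + r).
  have levD a b : lev A l0 (a + b) = iter a (act A) (lev A l0 b) by rewrite /lev iterD.
  elim: m => [|m IH]; first by rewrite mul0n.
  by rewrite mulSn -addnA levD -IH [LHS]/= act_mpow.
have PhiE r m : Phi (iter q Op) (Phi Op F0 r) m = Phi Op F0 (m * q + r).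
  have PhiD a b : Phi Op F0 (a + b) = iter a Op (Phi Op F0 b) by rewrite /Phi iterD.
  elim: m => [|m IH]; first by rewrite mul0n.
  by rewrite mulSn -addnA PhiD -IH.
have key : {ae nu, forall x, forall r : 'I_q, exists l : R,
    cmean (fun m => atot Op F0 (m * q + r) x / stot A l0 (m * q + r)) @ \oo --> l}.
  apply: filter_forall => r.
  have sE m : stot (mpow A q) (lev A l0 r) m = stot A l0 (m * q + r) by rewrite /stot levE.
  have := cesaro_loops (vop_iter q H) (lev_ge0 H l0_ge0 r) (Phi_meas H mF0 r)
    (Phi_lev H F0l0 r) loops.
  have ints' n : stot (mpow A q) (lev A l0 r) n = 0 \/ 1 <= stot (mpow A q) (lev A l0 r) n.
    by rewrite sE.
  move=> /(_ ints'); apply: filterS => x [l hl]; exists l.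
  apply: eq_cvgn hl _ _ => // N; congr (_ * _); apply: eq_bigr => n _.
  by rewrite sE /atot PhiE.
apply: filterS key => x /choice[l hl].
pose l' r := if insub r is Some r' then l r' else 0.
exists ((\sum_(r < q) l' r) / q%:R); apply: cmean_residues => // r rq.
have -> : l' r = l (Ordinal rq) by rewrite /l' insubT.
exact: (hl (Ordinal rq)).
Qed.

End Main.

(** * Spheres as paths of the Markov graph *)

Section Transport.
Context d (X : measurableType d) (R : realType) (nu : probability X R) (tau : X -> X).
Hypothesis mtau : measurable_fun setT tau.
Hypothesis nutau : forall A, measurable A -> nu (tau @^-1` A) = nu A.

Lemma ae_transport (P : X -> Prop) : {ae nu, forall x, P x} -> {ae nu, forall x, P (tau x)}.
Proof.
move=> [N [mN N0 PN]]; exists (tau @^-1` N); split.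
- by rewrite -[_ @^-1` _]setTI; exact: mtau.
- by rewrite nutau.
- by move=> x /= nP; apply: PN => /=.
Qed.

Lemma ge0_integral_transport (f : X -> \bar R) : measurable_fun setT f -> (forall x, (0 <= f x)%E) ->
  (\int[nu]_x f (tau x) = \int[nu]_x f x)%E.
Proof.
move=> mf f0.
have := @ge0_integral_pushforward _ _ _ _ R tau mtau nu setT f.
rewrite preimage_setT => /(_ measurableT mf (fun y _ => f0 y)) <-.
by apply: eq_measure_integral => A mA _; exact: nutau.
Qed.

Lemma EE_transport (f : X -> R) : bm f -> EE nu (f \o tau) = EE nu f.
Proof.
move=> bf; rewrite /EE /Rintegral; congr fine.
have := @integral_pushforward _ _ _ _ R tau mtau nu setT (EFin \o f).
rewrite preimage_setT => <- //.
- by apply: eq_measure_integral => A mA _; exact: nutau.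
- by apply/measurable_EFinP; case: bf.
- apply: (@bm_int _ _ _ nu (f \o tau)); case: bf => mf [M fM]; split; last by exists M => x; exact: fM.
  exact: measurableT_comp.
Qed.

End Transport.

Section GraphOperator.
Context d (X : measurableType d) (R : realType) (nu : probability X R).
Context (V E : finType) (src tgt : E -> V) (tau : E -> X -> X).
Hypothesis mtau : forall e, measurable_fun setT (tau e).
Hypothesis nutau : forall e A, measurable A -> nu (tau e @^-1` A) = nu A.

Definition gmx (v w : V) : R := \sum_(e | tgt e == w) (src e == v)%:R.
Definition gop (F : V -> X -> R) (w : V) (x : X) : R :=
  \sum_(e | tgt e == w) F (src e) (tau e x).

Lemma sum_gmx (u : V -> R) w : \sum_(e | tgt e == w) u (src e) = \sum_v u v * gmx v w.
Proof.
rewrite /gmx; under [RHS]eq_bigr do rewrite mulr_sumr; rewrite exchange_big /=.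
apply: eq_bigr => e _; rewrite (bigD1 (src e))//= eqxx mulr1 big1 ?addr0// => v /negbTE.
by rewrite eq_sym => ->; rewrite mulr0.
Qed.

Lemma EE_sum (I : Type) (r : seq I) (P : pred I) (F : I -> X -> R) : (forall i, bm (F i)) ->
  EE nu (fun x => \sum_(i <- r | P i) F i x) = \sum_(i <- r | P i) EE nu (F i).
Proof.
move=> bF; elim: r => [|i r IH].
  by rewrite big_nil; under [X in EE _ X]eq_fun do rewrite big_nil; rewrite EE_cst.
rewrite big_cons -IH; under [X in EE _ X]eq_fun do rewrite big_cons.
case: (P i) => //; rewrite EED//; elim: r {IH} => [|j r IH].
  by under eq_fun do rewrite big_nil; exact: bm_cst.
by under eq_fun do rewrite big_cons; case: (P j) => //; exact: bmD.
Qed.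

Lemma gop_vop : vop nu gmx gop.
Proof.
split.
- by move=> v w; apply: sumr_ge0 => e _; rewrite ler0n.
- move=> a F G w x; rewrite /gop mulr_sumr -big_split; exact: eq_bigr.
- by move=> F G FG w x; apply: ler_sum.
- by move=> u w x; rewrite -sum_gmx.
- move=> F mF w; rewrite /gop; under eq_fun do rewrite big_mkcond /=.
  apply: measurable_sum => e; case: (tgt e == w); last exact: measurable_cst.
  by apply: measurableT_comp.
- move=> F bF w; rewrite -(sum_gmx (fun v => EE nu (F v))) EE_sum.
    by apply: eq_bigr => e _; exact: (EE_transport (mtau e) (nutau e) (bF _)).
  move=> e; case: (bF (src e)) => mF [M FM]; split; last by exists M => x; exact: FM.
  exact: measurableT_comp.
- move=> u G uG w.
  have : {ae nu, forall x, forall e, (fun n => u n (src e) (tau e x)) @ \oo --> G (src e) (tau e x)}.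
    apply: filter_forall => e.
    exact: (ae_transport (mtau e) (nutau e) (uG (src e))).
  by apply: filterS => x hx; apply: cvgn_sum => e _; exact: hx.
Qed.

End GraphOperator.

(** * Paths enumerated by length and end vertex *)

Section Paths.
Context (V E : finType) (src tgt : E -> V) (v0 : V).

(** Paths grow by their last arc, to match the iteration of [gop]. *)
Fixpoint paths n (w : V) : seq (seq E) :=
  if n is m.+1 then [seq rcons p e | e <- [seq e <- enum E | tgt e == w], p <- paths m (src e)]
  else if w == v0 then [:: [::]] else [::].

Lemma path_from_rcons p e : path_from src tgt v0 (rcons p e) =
  path_from src tgt v0 p && (src e == last v0 (map tgt p)).
Proof.
case: p => [|a p] /=; first by rewrite andbT.
rewrite rcons_path andbA; congr (_ && _); rewrite eq_sym; congr (_ == _).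
by elim: p a => //=.
Qed.

Lemma mem_paths n w p : (p \in paths n w) =
  [&& path_from src tgt v0 p, size p == n & last v0 (map tgt p) == w].
Proof.
elim: n w p => [|n IH] w p /=.
  have [->|wv] := eqVneq w v0.
    by case: p => [|a p]; rewrite inE /= ?eqxx ?andbF.
  by rewrite in_nil; case: p => [|a p] /=; rewrite ?andbF//= eq_sym (negbTE wv).
apply/allpairsPdep/idP => [[e [q [+ + ->]]]|].
  rewrite mem_filter mem_enum andbT => /eqP tw.
  rewrite IH => /and3P[pq /eqP sq /eqP lq].
  by rewrite path_from_rcons pq lq eqxx size_rcons sq eqxx map_rcons last_rcons tw eqxx.
case/lastP: p => [|q e]; first by rewrite andbF.
rewrite path_from_rcons size_rcons map_rcons last_rcons eqSS.
move=> /and3P[/andP[pq sl] sq tw]; exists e, q; split => //.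
  by rewrite mem_filter tw mem_enum.
by rewrite IH pq sq eq_sym.
Qed.

Lemma paths_uniq n w : uniq (paths n w).
Proof.
elim: n w => [|n IH] w /=; first by case: ifP.
apply: allpairs_uniq_dep.
- by rewrite filter_uniq// enum_uniq.
- by move=> e _; exact: IH.
- by move=> [e p] [f q] /= _ _ /eqP; rewrite eqseq_rcons => /andP[/eqP-> /eqP->].
Qed.

Definition all_paths n : seq (seq E) := [seq p | w <- enum V, p <- paths n w].

Lemma mem_all_paths n p : (p \in all_paths n) = path_from src tgt v0 p && (size p == n).
Proof.
apply/allpairsPdep/idP => [[w [q [_ + ->]]]|/andP[pp sp]].
  by rewrite mem_paths => /and3P[-> -> _].
by exists (last v0 (map tgt p)), p; rewrite mem_enum mem_paths pp sp eqxx.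
Qed.

Lemma all_paths_uniq n : uniq (all_paths n).
Proof.
apply: allpairs_uniq_dep; first exact: enum_uniq.
- by move=> w _; exact: paths_uniq.
- move=> [w p] [w' q] /allpairsPdep[a [b [_ + ->]]] /allpairsPdep[a' [b' [_ + ->]]] /= e.
  rewrite e !mem_paths => /and3P[_ _ /eqP <-].
  by move=> /and3P[_ _ /eqP <-].
Qed.

End Paths.

Section MarkovAverages.
Context (G : Type) (mul : G -> G -> G) (one : G).
Hypothesis mulA : forall a b c, mul a (mul b c) = mul (mul a b) c.
Hypothesis mul1g : forall a, mul one a = a.
Hypothesis mulg1 : forall a, mul a one = a.
Context (O : seq G).
Context (V E : finType) (src tgt : E -> V) (v0 : V) (lab : E -> G).
Hypothesis surj : forall g : G, exists p, path_from src tgt v0 p /\ wprod mul one (map lab p) = g.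
Hypothesis inj : forall p q, path_from src tgt v0 p -> path_from src tgt v0 q ->
  wprod mul one (map lab p) = wprod mul one (map lab q) -> p = q.
Hypothesis len : forall p, path_from src tgt v0 p ->
  wlen_is mul one O (wprod mul one (map lab p)) (size p).

Lemma wprod_rcons w a : wprod mul one (rcons w a) = mul (wprod mul one w) a.
Proof.
elim: w => [|b w IH] /=; first by rewrite mulg1 mul1g.
by rewrite IH mulA.
Qed.

Lemma wlen_uniq g m n : wlen_is mul one O g m -> wlen_is mul one O g n -> m = n.
Proof.
move=> /andP[gm /allP am] /andP[gn /allP an].
apply/eqP; rewrite eqn_leq; apply/andP; split; rewrite leqNgt; apply/negP => lt.
  by have := am n; rewrite mem_iota /= add0n lt gn => /(_ isT).
by have := an m; rewrite mem_iota /= add0n lt gm => /(_ isT).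
Qed.

(** Paths of length [n] represent exactly the elements of length [n], word length being unique
    ([wlen_uniq]), and without repetition by [inj]. *)
Lemma sphere_paths n : perm_eq (sphere mul one O n)
  [seq (wprod mul one (map lab p) : {classic G}) | p <- all_paths src tgt v0 n].
Proof.
apply: uniq_perm.
- by rewrite filter_uniq// undup_uniq.
- rewrite map_inj_in_uniq ?all_paths_uniq// => p q.
  by rewrite !mem_all_paths => /andP[pp _] /andP[pq _]; exact: inj.
- move=> g; rewrite mem_filter mem_undup.
  apply/andP/mapP => [[gn _]|[p + ->]].
    have [p [pp pg]] := surj g; exists p => //.
    rewrite mem_all_paths pp /=; apply/eqP; apply: wlen_uniq gn.
    by rewrite -pg; exact: len.
  rewrite mem_all_paths => /andP[pp /eqP <-].
  by have := len pp => h; split => //; case/andP: h.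
Qed.

Context d (X : measurableType d) (R : realType) (nu : probability X R) (T : G -> X -> X).
Hypothesis actT : mp_action mul one nu T.

Let tau e := T (lab e).

(** Since [T] turns products into compositions, appending an arc to a path inserts its map
    innermost, and this is where [gop] puts [tau e]. *)
Lemma gop_Phi phi n v x :
  Phi (gop src tgt tau) (fun v x => if v == v0 then phi x else 0) n v x =
  \sum_(p <- paths src tgt v0 n v) phi (T (wprod mul one (map lab p)) x) :> R.
Proof.
case: actT => T1 TM _ _.
elim: n v x => [|n IH] v x /=.
  by case: ifP => _; rewrite ?big_nil// big_seq1 /= T1.
rewrite big_allpairs_dep big_filter big_enum_cond /=; apply: eq_bigr => e _.
rewrite -/(Phi _ _ n) IH; apply: eq_bigr => p _.
by rewrite map_rcons wprod_rcons TM.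
Qed.

Lemma gmx_lev n v : lev (gmx R src tgt) (fun v => (v == v0)%:R) n v =
  (size (paths src tgt v0 n v))%:R :> R.
Proof.
elim: n v => [|n IH] v /=; first by case: ifP.
rewrite /act -(sum_gmx src tgt (fun v => iter _ _ _ v)).
rewrite size_allpairs_dep /= sumnE !big_map big_filter big_enum_cond /= natr_sum.
by apply: eq_bigr => e _; rewrite -IH.
Qed.

Lemma gmx_stot n : stot (gmx R src tgt) (fun v => (v == v0)%:R) n =
  (size (sphere mul one O n))%:R :> R.
Proof.
rewrite (perm_size (sphere_paths n)) size_map size_allpairs_dep sumnE big_map big_enum natr_sum.
by apply: eq_bigr => v _; rewrite gmx_lev.
Qed.

Lemma gop_atot phi n x : atot (gop src tgt tau) (fun v x => if v == v0 then phi x else 0) n x =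
  \sum_(g <- sphere mul one O n) phi (T g x) :> R.
Proof.
rewrite (perm_big _ (sphere_paths n)) big_map /= big_allpairs_dep big_enum /=.
by apply: eq_bigr => v _; rewrite gop_Phi.
Qed.

Lemma cesaro_sphE phi N x : cesaro_sph mul one O T phi N x =
  cmean (fun n => atot (gop src tgt tau) (fun v x => if v == v0 then phi x else 0) n x /
    stot (gmx R src tgt) (fun v => (v == v0)%:R) n) N :> R.
Proof.
congr (_ * _); apply: eq_bigr => n _; rewrite gop_atot gmx_stot /sph_avg.
by case: (sphere mul one O n) => [|g s]; [rewrite invr0 mulr0|rewrite mulrC].
Qed.

(** The bound 1 lets the indicator of [v0] serve as initial mass, so that [stot] is exactly the
    sphere size, an integer and hence 0 or at least 1. *)
Lemma cesaro_sph_cvg1 (phi : X -> R) : measurable_fun setT phi -> (forall x, `|phi x| <= 1) ->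
  {ae nu, forall x, exists l : R, (fun N => cesaro_sph mul one O T phi N x) @ \oo --> l}.
Proof.
case: (actT) => _ _ mT nuT mphi phi1.
have H := gop_vop src tgt (fun e => mT (lab e)) (fun e => nuT (lab e)).
have l0_ge0 v : 0 <= (v == v0)%:R :> R by rewrite ler0n.
have mF0 v : measurable_fun setT (fun x => if v == v0 then phi x else 0).
  by case: (v == v0) => //; exact: measurable_cst.
have F0l0 v x : `|if v == v0 then phi x else 0| <= (v == v0)%:R.
  by case: (v == v0); rewrite ?normr0.
have ints n : stot (gmx R src tgt) (fun v => (v == v0)%:R) n = 0 \/
    1 <= stot (gmx R src tgt) (fun v => (v == v0)%:R) n :> R.
  by rewrite gmx_stot; case: (size _) => [|k]; [left|right; rewrite ler1n].
apply: filterS (cesaro_vop H l0_ge0 mF0 F0l0 ints) => x [l hl]; exists l.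
by apply: eq_cvgn hl _ _ => // N; exact: cesaro_sphE.
Qed.

End MarkovAverages.

(** * From bounded to p-integrable functions *)

Lemma cvge0P (R : realType) (u : nat -> \bar R) : (forall n, (0 <= u n)%E) ->
  (u @ \oo --> 0%E <-> forall e : R, 0 < e -> \forall n \near \oo, (u n <= e%:E)%E).
Proof.
move=> u0; split=> [/fine_cvgP[fu /cvgrPdist_le cu] e e0|ue].
  near=> n; have fn : u n \is a fin_num by near: n.
  rewrite -(fineK fn) lee_fin; apply: le_trans (ler_norm _) _.
  by rewrite -normrN -[- _]add0r; near: n; exact: cu.
apply/fine_cvgP; split.
  near=> n; rewrite ge0_fin_numE //; apply: (@le_lt_trans _ _ 1%:E); last exact: ltry.
  by near: n; exact: ue.
apply/cvgrPdist_le => e e0; near=> n.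
have un : (u n <= e%:E)%E by near: n; exact: ue.
have fn : u n \is a fin_num by rewrite ge0_fin_numE // (le_lt_trans un) // ltry.
rewrite sub0r normrN ger0_norm ?fine_ge0 //=.
by rewrite -lee_fin fineK.
Unshelve. all: by end_near. Qed.

Section LpNorm.
Context d (X : measurableType d) (R : realType) (nu : probability X R) (p : R).
Hypothesis p1 : 1 <= p.
Implicit Types (f g h : X -> R).
Local Notation "''Np' [ f ]" := (Lnorm nu p%:E (EFin \o f)) (format "''Np' [ f ]").

Let p0 : 0 < p. Proof. exact: lt_le_trans p1. Qed.

Lemma measurable_powR_abs f : measurable_fun setT f ->
  measurable_fun setT (fun x => (`|f x| `^ p)%:E).
Proof.
move=> mf; apply/measurable_EFinP.
apply: (@measurableT_comp _ _ _ _ _ _ (@powR R ^~ p)) => //.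
exact: measurableT_comp.
Qed.

Lemma LnormE f : 'Np[f] = ((\int[nu]_x (`|f x| `^ p)%:E) `^ p^-1)%E.
Proof. by rewrite unlock. Qed.

Lemma Lnorm_le f g : measurable_fun setT f -> measurable_fun setT g ->
  (forall x, `|f x| <= `|g x|) -> ('Np[f] <= 'Np[g])%E.
Proof.
move=> mf mg fg; rewrite !LnormE; apply: gt0_ler_poweR.
- by rewrite invr_ge0 ltW.
- by rewrite in_itv /= leey andbT; apply: integral_ge0 => x _; rewrite lee_fin powR_ge0.
- by rewrite in_itv /= leey andbT; apply: integral_ge0 => x _; rewrite lee_fin powR_ge0.
apply: ge0_le_integral => //.
- exact: measurable_powR_abs.
- exact: measurable_powR_abs.
- by move=> x _; rewrite lee_fin ge0_ler_powR ?nnegrE // ltW.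
Qed.

Lemma LnormD f g : measurable_fun setT f -> measurable_fun setT g ->
  ('Np[fun x => (f x + g x)%R] <= 'Np[f] + 'Np[g])%E.
Proof. by move=> mf mg; exact: minkowski_EFin. Qed.

Lemma LnormZl (a : R) f : 0 <= a -> measurable_fun setT f ->
  'Np[fun x => (a * f x)%R] = (a%:E * 'Np[f])%E.
Proof.
move=> a0 mf; rewrite !LnormE.
under eq_integral do rewrite normrM powRM // EFinM.
rewrite ge0_integralZl_EFin //; last exact: measurable_powR_abs.
rewrite poweRM ?lee_fin ?powR_ge0 //; last by apply: integral_ge0 => x _; rewrite lee_fin powR_ge0.
by rewrite poweR_EFin -powRrM mulfV ?gt_eqF // powRr1 // ger0_norm.
Qed.

Lemma Lnorm_subC f g : 'Np[fun x => (f x - g x)%R] = 'Np[fun x => (g x - f x)%R].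
Proof. by rewrite !LnormE; under eq_integral do rewrite distrC. Qed.

Lemma Lnorm_sum (I : Type) (r : seq I) (F : I -> X -> R) :
  (forall i, measurable_fun setT (F i)) ->
  ('Np[fun x => (\sum_(i <- r) F i x)%R] <= \sum_(i <- r) 'Np[F i])%E.
Proof.
move=> mF; elim: r => [|i r IH].
  under eq_Lnorm do rewrite /= big_nil.
  by rewrite big_nil -[X in (_ <= X)%E](Lnorm0 nu (p := p%:E)) // gt_eqF.
under eq_Lnorm do rewrite /= big_cons.
rewrite big_cons; apply: le_trans (leeD (lexx _) IH).
by apply: LnormD => //; exact: measurable_sum.
Qed.

Lemma Lnorm_comp (tau : X -> X) f : measurable_fun setT tau ->
  (forall A, measurable A -> nu (tau @^-1` A) = nu A) -> measurable_fun setT f ->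
  'Np[f \o tau] = 'Np[f].
Proof.
move=> mtau nutau mf; rewrite !LnormE; congr (_ `^ _)%E.
rewrite -(ge0_integral_transport mtau nutau (f := fun x => (`|f x| `^ p)%:E)) //.
exact: measurable_powR_abs.
Qed.

Lemma Lnorm_dct (u : nat -> X -> R) h :
  (forall n, measurable_fun setT (u n)) -> measurable_fun setT h -> ('Np[h] < +oo)%E ->
  {ae nu, forall x, u ^~ x @ \oo --> (0 : R)} ->
  {ae nu, forall x, forall n, `|u n x| <= `|h x|} ->
  (fun n => 'Np[u n]) @ \oo --> 0%E.
Proof.
move=> mu mh hfin uc uh.
have pI : p^-1 != 0 by rewrite invr_neq0 // gt_eqF.
have [_ _ cI] : [/\ nu.-integrable setT (fun=> 0%E : \bar R),
  [sequence (\int[nu]_x `|(`|u n x| `^ p)%:E - 0|)%E]_n @ \oo --> 0%E &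
  [sequence (\int[nu]_x (`|u n x| `^ p)%:E)%E]_n @ \oo --> (\int[nu]_x (0 : \bar R))%E].
  apply: (@dominated_convergence _ _ _ nu setT measurableT (fun n x => (`|u n x| `^ p)%:E)
    (fun=> 0%E) (fun x => (`|h x| `^ p)%:E)) => //.
  - by move=> n; exact: measurable_powR_abs.
  - apply: filterS uc => x ux _; apply/cvg_EFin; first exact: nearW.
    apply: (@squeeze_cvgr _ _ _ _ (fun=> 0) (fun n => `|u n x|)); last 2 first.
    + exact: cvg_cst.
    + by rewrite -(normr0 R); exact: cvg_norm.
    near=> n; rewrite powR_ge0 /=.
    (* Once the absolute value is at most 1, [p >= 1] bounds its [p]-th power by itself. The value 0
       is treated apart because [ger_powR] asks for a positive base. *)
    have un1 : `|u n x| <= 1.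
      by rewrite -normrN -[- _]add0r; near: n; move/cvgrPdist_le : ux; apply.
    have [->|un0] := eqVneq `|u n x| 0; first by rewrite powR0 // gt_eqF.
    rewrite -[leRHS]powRr1 //; apply: ger_powR => //.
    by rewrite lt_neqAle eq_sym un0 normr_ge0 un1.
  - apply/integrableP; split; first exact: measurable_powR_abs.
    apply: (lty_poweRy pI); move: hfin; rewrite LnormE.
    suff -> : (\int[nu]_x `|(`|h x| `^ p)%:E| = \int[nu]_x (`|h x| `^ p)%:E)%E by [].
    by apply: eq_integral => x _; rewrite gee0_abs ?lee_fin ?powR_ge0.
  - apply: filterS uh => x hx n _; rewrite gee0_abs ?lee_fin ?powR_ge0 //.
    by rewrite ge0_ler_powR ?nnegrE // ltW.
rewrite integral0 in cI.
apply/cvge0P => [n|e e0]; first exact: Lnorm_ge0.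
have ep0 : 0 < e `^ p by exact: powR_gt0.
have I0 n : (0 <= \int[nu]_x (`|u n x| `^ p)%:E)%E.
  by apply: integral_ge0 => x _; rewrite lee_fin powR_ge0.
have cI' := (cvge0P I0).1 cI _ ep0.
near=> n; rewrite LnormE -[e]powRr1 ?(ltW e0) // -(mulfV (lt0r_neq0 p0)) powRrM -poweR_EFin.
apply: gt0_ler_poweR; [by rewrite invr_ge0 ltW|by rewrite in_itv /= leey andbT| |by near: n].
by rewrite in_itv /= leey andbT lee_fin ltW.
Unshelve. all: by end_near. Qed.

End LpNorm.

Lemma mean_le (R : realType) (n : nat) (r : R) : 0 <= r -> n%:R^-1 * (n%:R * r) <= r.
Proof.
move=> r0; case: n => [|n]; first by rewrite mul0r mulr0.
by rewrite mulrA mulVf ?mul1r // pnatr_eq0.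
Qed.

Lemma norm_mean (R : realType) (I : Type) (s : seq I) (a : I -> R) (M : R) : 0 <= M ->
  (forall i, `|a i| <= M) -> `|(size s)%:R^-1 * \sum_(i <- s) a i| <= M.
Proof.
move=> M0 aM; rewrite normrM ger0_norm ?invr_ge0 ?ler0n //.
apply: le_trans (mean_le (size s) M0); rewrite ler_wpM2l ?invr_ge0 ?ler0n //.
apply: le_trans (ler_norm_sum _ _ _) _; apply: le_trans (ler_sum _ (fun i _ => aM i)) _.
by rewrite big_const_seq count_predT iter_addr addr0 mulr_natl.
Qed.

Lemma Lnorm_mean d (X : measurableType d) (R : realType) (nu : probability X R) (p : R)
    (I : Type) (s : seq I) (F : I -> X -> R) (r : \bar R) : 1 <= p -> (0 <= r)%E ->
  (forall i, measurable_fun setT (F i)) ->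
  (forall i, ('N[nu]_(p%:E)[EFin \o F i] <= r)%E) ->
  ('N[nu]_(p%:E)[EFin \o (fun x => (size s)%:R^-1 * \sum_(i <- s) F i x)%R] <= r)%E.
Proof.
move=> p1 r0 mF Fr.
have [->|roo] := eqVneq r +oo%E; first by rewrite leey.
have fr : r \is a fin_num by rewrite ge0_fin_numE // ltey.
rewrite LnormZl //; last exact: measurable_sum.
apply: (@le_trans _ _ ((size s)%:R^-1%:E * \sum_(i <- s) r)%E).
  rewrite lee_wpmul2l ?lee_fin ?invr_ge0 ?ler0n //.
  by apply: le_trans (Lnorm_sum _ _ _ _) _ => //; exact: lee_sum.
rewrite -(fineK fr) sumEFin -EFinM lee_fin big_const_seq count_predT iter_addr addr0.
by rewrite -[fine r *+ _]mulr_natl mean_le ?fine_ge0.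
Qed.

Lemma Lnorm_bounded d (X : measurableType d) (R : realType) (nu : probability X R) (p : R)
    (f : X -> R) : 1 <= p -> bm f -> ('N[nu]_(p%:E)[EFin \o f] < +oo)%E.
Proof.
move=> p1 [mf [M fM]].
apply: (@le_lt_trans _ _ ('N[nu]_(p%:E)[EFin \o cst M])%E).
  by apply: Lnorm_le => // x; exact: le_trans (fM x) (ler_norm _).
rewrite LnormE; apply: poweR_lty.
under eq_integral do rewrite /cst /=.
rewrite integral_cst // -[X in (_ * X)%E]/(nu setT).
apply: (@le_lt_trans _ _ ((`|M| `^ p)%:E * 1)%E); last by rewrite mule1 ltry.
by apply: lee_wpmul2l; [rewrite lee_fin powR_ge0|exact: probability_le1].
Qed.

Section SphereAverages.
Context (G : Type) (mul : G -> G -> G) (one : G) (O : seq G).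
Context d (X : measurableType d) (R : realType) (nu : probability X R) (T : G -> X -> X).
Hypothesis actT : mp_action mul one nu T.
Implicit Types (f g : X -> R).
Local Notation avg := (@sph_avg G mul one O X R T).
Local Notation ces := (@cesaro_sph G mul one O X R T).

Let mT a : measurable_fun setT (T a). Proof. by case: actT. Qed.
Let nuT a A : measurable A -> nu (T a @^-1` A) = nu A.
Proof. by case: actT => _ _ _; exact. Qed.

Lemma sph_avgE f n x :
  avg f n x = (size (sphere mul one O n))%:R^-1 * \sum_(g <- sphere mul one O n) f (T g x).
Proof. by rewrite /sph_avg; case: sphere => //; rewrite big_nil mulr0. Qed.

Lemma cesaro_sphE_iota f N x :
  ces f N x = (size (iota 0 N))%:R^-1 * \sum_(n <- iota 0 N) avg f n x.
Proof. by rewrite size_iota /cesaro_sph -(big_mkord xpredT (fun n => avg f n x)) /index_iota subn0. Qed.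

Lemma sph_avg_measurable f n : measurable_fun setT f -> measurable_fun setT (avg f n).
Proof.
move=> mf; rewrite (funext (sph_avgE f n)); apply: measurable_funM => //.
by apply: measurable_sum => g; exact: measurableT_comp.
Qed.

Lemma cesaro_sph_measurable f N : measurable_fun setT f -> measurable_fun setT (ces f N).
Proof.
move=> mf; apply: measurable_funM => //.
by apply: measurable_sum => n; exact: sph_avg_measurable.
Qed.

Lemma cesaro_sphB f g N x : ces (fun x => f x - g x) N x = ces f N x - ces g N x.
Proof.
rewrite /cesaro_sph -mulrBr -sumrB; congr (_ * _); apply: eq_bigr => n _.
by rewrite !sph_avgE -mulrBr -sumrB.
Qed.

Lemma cesaro_sphZ (a : R) f N x : ces (fun x => a * f x) N x = a * ces f N x.
Proof.
rewrite /cesaro_sph mulrCA [a * \sum_(n < N) _]mulr_sumr; congr (_ * _); apply: eq_bigr => n _.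
by rewrite !sph_avgE -mulr_sumr mulrCA.
Qed.

Lemma cesaro_sph_le f g N x : (forall x, f x <= g x) -> ces f N x <= ces g N x.
Proof.
move=> fg; rewrite ler_wpM2l ?invr_ge0 ?ler0n //; apply: ler_sum => n _.
by rewrite !sph_avgE ler_wpM2l ?invr_ge0 ?ler0n //; apply: ler_sum.
Qed.

Lemma cesaro_sph_ge0 f N x : (forall x, 0 <= f x) -> 0 <= ces f N x.
Proof.
move=> f0; rewrite mulr_ge0 ?invr_ge0 ?ler0n //; apply: sumr_ge0 => n _.
by rewrite sph_avgE mulr_ge0 ?invr_ge0 ?ler0n //; apply: sumr_ge0.
Qed.

Lemma cesaro_sph_abs f (M : R) N x : 0 <= M -> (forall x, `|f x| <= M) -> `|ces f N x| <= M.
Proof.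
move=> M0 fM; rewrite cesaro_sphE_iota; apply: norm_mean => // n.
by rewrite sph_avgE; exact: norm_mean.
Qed.

(** Minkowski's inequality, for the mean over [n] and for the mean over each sphere, and invariance
    of [nu] under every [T g]. *)
Lemma Lnorm_cesaro (p : R) f N : 1 <= p -> measurable_fun setT f ->
  ('N[nu]_(p%:E)[EFin \o ces f N] <= 'N[nu]_(p%:E)[EFin \o f])%E.
Proof.
move=> p1 mf; rewrite (funext (cesaro_sphE_iota f N)).
apply: Lnorm_mean => [//||n|n]; [exact: Lnorm_ge0|exact: sph_avg_measurable|].
rewrite (funext (sph_avgE f n)).
apply: Lnorm_mean => [//||g|g]; [exact: Lnorm_ge0|exact: measurableT_comp|].
by rewrite -(Lnorm_comp p (@mT g) (@nuT g) mf).
Qed.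

Lemma cesaro_sph_ae f g : {ae nu, forall x, f x = g x} ->
  {ae nu, forall x, forall N, ces f N x = ces g N x}.
Proof.
move=> fg; have H (s : seq G) : {ae nu, forall x, \sum_(h <- s) f (T h x) = \sum_(h <- s) g (T h x)}.
  elim: s => [|h s IH]; first by apply: nearW => x; rewrite !big_nil.
  have hx := ae_transport (@mT h) (@nuT h) fg.
  by apply: filterS2 hx IH => x h1 h2; rewrite !big_cons h1 h2.
have := ae_foralln (fun n => H (sphere mul one O n)).
apply: filterS => x hx N; congr (_ * _); apply: eq_bigr => n _.
by rewrite !sph_avgE hx.
Qed.

End SphereAverages.

(** * Norm convergence of monotone sequences bounded in L^p *)

Section MonotoneLp.
Context d (X : measurableType d) (R : realType) (nu : probability X R) (p : R).
Hypothesis p1 : 1 <= p.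
Variable u : nat -> X -> R.
Hypotheses (mu : forall k, measurable_fun setT (u k)) (u0 : forall k x, 0 <= u k x).
Hypothesis und : forall x, nondecreasing_seq (u ^~ x).
Variable C : \bar R.
Hypotheses (Cfin : (C < +oo)%E) (uC : forall k, ('N[nu]_(p%:E)[EFin \o u k] <= C)%E).

Let p0 : 0 < p. Proof. exact: lt_le_trans p1. Qed.
Let h k x : \bar R := (`|u k x| `^ p)%:E.
Let L x : \bar R := limn (h ^~ x).

Let mh k : measurable_fun setT (h k). Proof. exact: measurable_powR_abs. Qed.
Let h0 k x : (0 <= h k x)%E. Proof. by rewrite lee_fin powR_ge0. Qed.
Let hnd x : nondecreasing_seq (h ^~ x).
Proof.
move=> m n mn; rewrite lee_fin !ger0_norm // ge0_ler_powR ?nnegrE //; first exact: ltW.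
exact: und.
Qed.
Let hL x : h ^~ x @ \oo --> L x. Proof. exact: ereal_nondecreasing_is_cvgn. Qed.
Let L0 x : (0 <= L x)%E.
Proof. by apply: lime_ge; [exact: ereal_nondecreasing_is_cvgn|exact: nearW]. Qed.
Let mL : measurable_fun setT L. Proof. 
by apply: (emeasurable_fun_cvg h) => // x _; exact: hL.
Qed.

Let intL : (\int[nu]_x L x < +oo)%E.
Proof.
have C0 : (0 <= C)%E by apply: le_trans (uC 0); exact: Lnorm_ge0.
apply: (@le_lt_trans _ _ (C `^ p)%E); last exact: poweR_lty.
have cI : (\int[nu]_x h k x)%E @[k --> \oo] --> (\int[nu]_x L x)%E.
  by apply: cvg_monotone_convergence => // k x _; exact: h0.
apply: cvge_to_le cI _; apply: nearW => k.
rewrite -[X in (X <= _)%E](@powR_Lnorm _ _ _ nu (EFin \o u k)) ?gt_eqF //.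
apply: gt0_ler_poweR; [exact: ltW|by rewrite in_itv /= leey Lnorm_ge0| |exact: uC].
by rewrite in_itv /= leey C0.
Qed.

(* [fine] gives the junk value 0 on the null set where [L] is infinite. *)
Let v x := fine (L x) `^ p^-1.

(** Monotone convergence of the [p]-th powers makes the pointwise limit [p]-integrable; as it bounds
    the sequence from above almost everywhere, it dominates the differences and [Lnorm_dct]
    applies. *)
Lemma Lnorm_monotone_limit : exists v : X -> R,
  [/\ measurable_fun setT v, ('N[nu]_(p%:E)[EFin \o v] < +oo)%E &
      (fun k => 'N[nu]_(p%:E)[EFin \o (fun x => u k x - v x)%R])%E @ \oo --> 0%E].
Proof.
have mv : measurable_fun setT v.
  apply: (@measurableT_comp _ _ _ _ _ _ (@powR R ^~ p^-1)) => //.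
  by apply: measurableT_comp mL; exact: fine_measurable.
have v0 x : 0 <= v x by exact: powR_ge0.
have vp x : (`|v x| `^ p = fine (L x))%R.
  by rewrite ger0_norm // /v -powRrM mulVf ?gt_eqF // powRr1 // fine_ge0.
have vfin : ('N[nu]_(p%:E)[EFin \o v] < +oo)%E.
  rewrite LnormE; apply: poweR_lty; apply: le_lt_trans intL.
  apply: ge0_le_integral => //; first exact: measurable_powR_abs.
  by move=> x _; rewrite vp; case: (L x) (L0 x) => [r|//|//]; rewrite ?leey.
exists v; split => //.
have finL : {ae nu, forall x, L x \is a fin_num}.
  have /(integrable_ae measurableT) : nu.-integrable setT L.
    apply/integrableP; split => //; under eq_integral do rewrite gee0_abs //.
    exact: intL.
  by apply: filterS => x; apply.
have ulev x k : L x \is a fin_num -> u k x <= v x.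
  move=> fL; have hk : (h k x <= L x)%E.
    apply: lime_ge; first exact: ereal_nondecreasing_is_cvgn.
    by near=> n; apply: hnd; near: n; exact: nbhs_infty_ge.
  rewrite -[u k x]ger0_norm // -[`|u k x|]powRr1 // -(mulfV (lt0r_neq0 p0)) powRrM.
  rewrite ge0_ler_powR ?nnegrE ?powR_ge0 ?invr_ge0 ?(ltW p0) ?fine_ge0 //.
  by rewrite -lee_fin fineK.
apply: (@Lnorm_dct _ _ _ _ _ p1 _ v) => //.
- by move=> k; exact: measurable_funB.
- apply: filterS finL => x fL.
  have cu : cvgn (u ^~ x).
    by apply: nondecreasing_is_cvgn => //; exists (v x) => _ [k _ <-]; exact: ulev.
  set m := limn (u ^~ x).
  have um k : u k x <= m by exact: nondecreasing_cvgn_le.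
  suff -> : v x = m by rewrite -(subrr m); apply: cvgB; [exact: cu|exact: cvg_cst].
  apply/eqP; rewrite eq_le; apply/andP; split; last first.
    by apply: limr_le => //; apply: nearW => k; exact: ulev.
  have m0 : 0 <= m by apply: le_trans (um 0).
  rewrite -[m]powRr1 // -(mulfV (lt0r_neq0 p0)) powRrM.
  rewrite ge0_ler_powR ?nnegrE ?powR_ge0 ?invr_ge0 ?(ltW p0) ?fine_ge0 //.
  rewrite -lee_fin fineK //; apply: lime_le; first exact: ereal_nondecreasing_is_cvgn.
  by apply: nearW => k; rewrite lee_fin ger0_norm // ge0_ler_powR ?nnegrE // ltW.
- apply: filterS finL => x fL k; rewrite distrC ger0_norm ?subr_ge0 ?ulev //.
  by rewrite ger0_norm // gerBl.
Unshelve. all: by end_near. Qed.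

End MonotoneLp.

Section BoundedToLp.
Context (G : Type) (mul : G -> G -> G) (one : G) (O : seq G).
Context d (X : measurableType d) (R : realType) (nu : probability X R) (T : G -> X -> X).
Hypothesis actT : mp_action mul one nu T.
Local Notation ces := (@cesaro_sph G mul one O X R T).
Hypothesis cvg_unit : forall phi : X -> R, measurable_fun setT phi ->
  (forall x, `|phi x| <= 1) -> {ae nu, forall x, exists l : R, (ces phi ^~ x) @ \oo --> l}.

Lemma cvg_bounded (phi : X -> R) (M : R) : measurable_fun setT phi ->
  (forall x, `|phi x| <= M) -> {ae nu, forall x, exists l : R, (ces phi ^~ x) @ \oo --> l}.
Proof.
(* The maximum with 1 keeps the scaling factor invertible. *)
move=> mphi phiM; pose M1 := Num.max M 1.
have M10 : 0 < M1 by rewrite lt_max ltr01 orbT.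
have H := @cvg_unit (fun x => M1^-1 * phi x).
apply: filterS (H _ _) => [x [l hl]||x].
- exists (M1 * l); apply: eq_cvgn (cvgMl_tmp (a := M1) hl) _ _ => // N.
  by rewrite /= cesaro_sphZ mulrA mulfV ?mul1r // gt_eqF.
- exact: measurable_funM.
- rewrite normrM gtr0_norm ?invr_gt0 // ler_pdivrMl // mulr1.
  by apply: le_trans (phiM x) _; rewrite le_max lexx.
Qed.

Lemma cvg_essentially_bounded (phi : X -> R) (M : R) : measurable_fun setT phi ->
  {ae nu, forall x, `|phi x| <= M} ->
  {ae nu, forall x, exists l : R, (ces phi ^~ x) @ \oo --> l}.
Proof.
move=> mphi phiM; pose phi' x := if `|phi x| <= M then phi x else 0.
have mphi' : measurable_fun setT phi'.
  apply: measurable_fun_ifT => //; apply: measurable_fun_ler => //.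
  exact: measurableT_comp.
have H1 : {ae nu, forall x, exists l : R, (ces phi' ^~ x) @ \oo --> l}.
  apply: (@cvg_bounded _ (Num.max M 0)) => // x; rewrite /phi'.
  by case: ifP => h; rewrite le_max ?h // normr0 lexx orbT.
have : {ae nu, forall x, phi x = phi' x}.
  by apply: filterS phiM => x h; rewrite /phi' h.
move/(cesaro_sph_ae O actT) => H2; apply: filterS2 H1 H2 => x [l hl] e.
by exists l; apply: eq_cvgn hl _ _.
Qed.

(** The limits [w k] of the averages of the truncations increase with [k], because averaging is
    monotone, and have norm at most that of [phi], because it contracts; so they converge in norm to
    some [psi]. The error splits into the truncation, the convergence for a fixed truncation, and
    the distance from [w k] to [psi]. *)
Lemma Lp_cvg_ge0 (p : R) (phi : X -> R) : 1 <= p -> measurable_fun setT phi ->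
  (forall x, 0 <= phi x) -> ('N[nu]_(p%:E)[EFin \o phi] < +oo)%E ->
  exists psi : X -> R,
    [/\ measurable_fun setT psi, ('N[nu]_(p%:E)[EFin \o psi] < +oo)%E &
        (fun N => 'N[nu]_(p%:E)[EFin \o (fun x => ces phi N x - psi x)%R])%E @ \oo --> 0%E].
Proof.
move=> p1 mphi phi0 phifin.
pose tr k x := Num.min (phi x) k%:R; pose C k N := ces (tr k) N.
(* An upper limit is defined at every point, so [w k] is measurable and monotone in [k] everywhere,
   although it is a limit only almost everywhere. *)
pose w k x := limn_sup (C k ^~ x).
have mtr k : measurable_fun setT (tr k) by exact: measurable_minr.
have tr0 k x : 0 <= tr k x by rewrite le_min phi0 ler0n.
have trk k x : `|tr k x| <= k%:R by rewrite ger0_norm // ge_min lexx orbT.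
have trphi k x : tr k x <= phi x by rewrite ge_min lexx.
have mC k N : measurable_fun setT (C k N) by exact: (cesaro_sph_measurable O actT).
have Ck k N x : `|C k N x| <= k%:R by apply: cesaro_sph_abs => //; exact: trk.
have sC k x : sbnd (C k ^~ x) by exists k%:R.
have bw k : bm (w k) by exact: bm_limsup (mC k) (Ck k).
have mw k : measurable_fun setT (w k) by case: (bw k).
have wk k x : `|w k x| <= k%:R by exact: limsup_abs.
have w0 k x : 0 <= w k x.
  have s0 : sbnd (fun=> 0 : R) by exists 0 => n; rewrite normr0.
  rewrite -(cvg_limsup (@cvg_cst _ (0 : R) _ \oo _)); apply: eq_limsup_near => //.
  by apply: nearW => N; exact: cesaro_sph_ge0.
have wnd x : nondecreasing_seq (w ^~ x).
  move=> m n mn; apply: eq_limsup_near => //; apply: nearW => N; apply: cesaro_sph_le => y.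
  by rewrite le_min ge_min lexx /= ge_min ler_nat mn orbT.
have Cw k : (fun N => 'N[nu]_(p%:E)[EFin \o (fun x => C k N x - w k x)%R])%E @ \oo --> 0%E.
  apply: (@Lnorm_dct _ _ _ _ _ p1 _ (fun=> (k%:R + k%:R))) => //.
  - by move=> N; exact: measurable_funB.
  - by apply: Lnorm_bounded => //; exact: bm_cst.
  - apply: filterS (cvg_bounded (mtr k) (trk k)) => x [l hl].
    by rewrite /w (cvg_limsup hl) -(subrr l); apply: cvgB; [exact: hl|exact: cvg_cst].
  - apply: nearW => x N; rewrite [leRHS]ger0_norm ?addr_ge0 ?ler0n //.
    by apply: le_trans (ler_normB _ _) _; rewrite lerD.
have wphi k : ('N[nu]_(p%:E)[EFin \o w k] <= 'N[nu]_(p%:E)[EFin \o phi])%E.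
  apply/lee_addgt0Pr => e e0.
  have /(cvge0P (fun N => Lnorm_ge0 _ _ _)).1 /(_ e e0) [N _ /(_ N (leqnn N)) hN] := Cw k.
  apply: (@le_trans _ _ ('N[nu]_(p%:E)[EFin \o (fun x => C k N x + (w k x - C k N x))%R])%E).
    by rewrite le_eqVlt; apply/orP; left; apply/eqP/eq_Lnorm => x /=; rewrite addrC subrK.
  apply: le_trans (LnormD _ _ _ _) _ => //; first exact: measurable_funB.
  apply: leeD; last by rewrite Lnorm_subC.
  apply: le_trans (Lnorm_cesaro O actT N p1 (mtr k)) _.
  by apply: Lnorm_le => // x; rewrite !ger0_norm.
have [psi [mpsi psifin wpsi]] := Lnorm_monotone_limit p1 mw w0 wnd phifin wphi.
exists psi; split => //.
have trcvg : (fun k => 'N[nu]_(p%:E)[EFin \o (fun x => phi x - tr k x)%R])%E @ \oo --> 0%E.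
  apply: (@Lnorm_dct _ _ _ _ _ p1 _ phi) => //.
  - by move=> k; exact: measurable_funB.
  - apply: nearW => x; apply/cvgrPdist_le => e e0; near=> k.
    have phik : phi x <= k%:R by near: k; exact: nbhs_infty_ger.
    by rewrite /tr min_l // subrr subr0 normr0 ltW.
  - by apply: nearW => x k; rewrite !ger0_norm ?subr_ge0 // gerBl.
apply/cvge0P => [N|e e0]; first exact: Lnorm_ge0.
have e3 : 0 < e / 3 by rewrite divr_gt0.
have [k [hk1 hk2]] : exists k, ('N[nu]_(p%:E)[EFin \o (fun x => phi x - tr k x)%R] <= (e / 3)%:E)%E
    /\ ('N[nu]_(p%:E)[EFin \o (fun x => w k x - psi x)%R] <= (e / 3)%:E)%E.
  near \oo => k; exists k; split; near: k.
    exact: (cvge0P (fun N => Lnorm_ge0 _ _ _)).1 trcvg _ e3.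
  exact: (cvge0P (fun N => Lnorm_ge0 _ _ _)).1 wpsi _ e3.
have := (cvge0P (fun N => Lnorm_ge0 _ _ _)).1 (Cw k) _ e3.
apply: filterS => N hN.
have mB : measurable_fun setT (fun x => phi x - tr k x) by exact: measurable_funB.
have mcB := cesaro_sph_measurable O actT N mB.
have mCw : measurable_fun setT (fun x => C k N x - w k x) by exact: measurable_funB.
have mwp : measurable_fun setT (fun x => w k x - psi x) by exact: measurable_funB.
rewrite (eq_Lnorm _ _ (g := EFin \o (fun x => ces (fun x => phi x - tr k x) N x +
  ((C k N x - w k x) + (w k x - psi x)))%R)); last first.
  by move=> x /=; rewrite cesaro_sphB -/(C k N x); congr (_%:E); ring.
rewrite (_ : e%:E = (e / 3)%:E + ((e / 3)%:E + (e / 3)%:E))%E; last first.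
  by rewrite -!EFinD; congr (_%:E); field.
apply: (le_trans (LnormD nu p1 mcB (measurable_funD mCw mwp))).
apply: leeD; first exact: le_trans (Lnorm_cesaro O actT N p1 mB) hk1.
exact: (le_trans (LnormD nu p1 mCw mwp) (leeD hN hk2)).
Unshelve. all: by end_near. Qed.

Lemma Lp_cvg (p : R) (phi : X -> R) : 1 <= p -> measurable_fun setT phi ->
  ('N[nu]_(p%:E)[EFin \o phi] < +oo)%E ->
  exists psi : X -> R,
    [/\ measurable_fun setT psi, ('N[nu]_(p%:E)[EFin \o psi] < +oo)%E &
        (fun N => 'N[nu]_(p%:E)[EFin \o (fun x => ces phi N x - psi x)%R])%E @ \oo --> 0%E].
Proof.
move=> p1 mphi phifin.
have mpos : measurable_fun setT (phi^\+) by exact: measurable_funrpos.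
have mneg : measurable_fun setT (phi^\-) by exact: measurable_funrneg.
have pos0 x : 0 <= phi^\+ x by exact: funrpos_ge0.
have neg0 x : 0 <= phi^\- x by exact: funrneg_ge0.
have [||f1 [mf1 f1fin c1]] := @Lp_cvg_ge0 p (phi^\+) p1 mpos => //.
  apply: le_lt_trans phifin; apply: Lnorm_le => // x; rewrite ger0_norm //.
  by rewrite /funrpos ge_max ler_norm normr_ge0.
have [||f2 [mf2 f2fin c2]] := @Lp_cvg_ge0 p (phi^\-) p1 mneg => //.
  apply: le_lt_trans phifin; apply: Lnorm_le => // x; rewrite ger0_norm //.
  by rewrite /funrneg ge_max -normrN ler_norm normr_ge0.
have mB (g1 g2 : X -> R) : measurable_fun setT g1 -> measurable_fun setT g2 ->
    measurable_fun setT (fun x => g1 x - g2 x) by exact: measurable_funB.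
have mN (g1 : X -> R) : measurable_fun setT g1 -> measurable_fun setT (fun x => - g1 x).
  exact: measurableT_comp.
have LB (g1 g2 : X -> R) : measurable_fun setT g1 -> measurable_fun setT g2 ->
    ('N[nu]_(p%:E)[EFin \o (fun x => g1 x - g2 x)%R] <=
     'N[nu]_(p%:E)[EFin \o g1] + 'N[nu]_(p%:E)[EFin \o g2])%E.
  move=> mg1 mg2; apply: le_trans (LnormD nu p1 mg1 (mN _ mg2)) _; apply: leeD => //.
  by apply: Lnorm_le => //; [exact: mN|move=> x; rewrite normrN].
exists (fun x => f1 x - f2 x); split; first exact: mB.
  by apply: le_lt_trans (LB _ _ mf1 mf2) _; rewrite lte_add_pinfty.
apply/cvge0P => [N|e e0]; first exact: Lnorm_ge0.
have e2 : 0 < e / 2 by rewrite divr_gt0.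
have h1 := (cvge0P (fun N => Lnorm_ge0 _ _ _)).1 c1 _ e2.
have h2 := (cvge0P (fun N => Lnorm_ge0 _ _ _)).1 c2 _ e2.
apply: filterS2 h1 h2 => N h1 h2.
rewrite (eq_Lnorm _ _ (g := EFin \o (fun x => (ces phi^\+ N x - f1 x) -
  (ces phi^\- N x - f2 x))%R)); last first.
  move=> x /=; congr (_%:E).
  rewrite (_ : ces phi N x = ces phi^\+ N x - ces phi^\- N x); first ring.
  rewrite -cesaro_sphB; congr (ces _ N x); apply/funext => y.
  by rewrite -[in LHS](funrposBneg phi).
rewrite [e]splitr EFinD; apply: le_trans (LB _ _ _ _) (leeD h1 h2).
  by apply: mB => //; exact: (cesaro_sph_measurable O actT).
by apply: mB => //; exact: (cesaro_sph_measurable O actT).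
Qed.

End BoundedToLp.

Theorem theorem1 (G : Type) (mul : G -> G -> G) (one : G)
  (mulA : forall a b c, mul a (mul b c) = mul (mul a b) c)
  (mul1g : forall a, mul one a = a) (mulg1 : forall a, mul a one = a)
  (O : seq G) (genO : generates mul one O) (markovO : is_markov mul one O)
  (d : measure_display) (X : measurableType d) (R : realType)
  (nu : probability X R) (T : G -> X -> X) (actT : mp_action mul one nu T) :
  (forall (p : R) (phi : X -> R), 1 <= p ->
     measurable_fun setT phi -> ('N[nu]_(p%:E)[EFin \o phi] < +oo)%E ->
     exists psi : X -> R,
       [/\ measurable_fun setT psi, ('N[nu]_(p%:E)[EFin \o psi] < +oo)%E &
           (fun N => 'N[nu]_(p%:E)[EFin \o (fun x => cesaro_sph mul one O T phi N x - psi x)%R])%E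
             @ \oo --> 0%E])
  /\
  (forall phi : X -> R, measurable_fun setT phi ->
     (exists M : R, {ae nu, forall x, `|phi x| <= M}) ->
     {ae nu, forall x, exists l : R,
        (fun N => cesaro_sph mul one O T phi N x) @ \oo --> l}).
Proof.
case: markovO => V [E [src [tgt [v0 [lab [_ surj inj len]]]]]].
have cvg_unit := cesaro_sph_cvg1 mulA mul1g mulg1 surj inj len actT.
split=> [p phi p1 mphi phifin|phi mphi [M phiM]].
  exact: Lp_cvg.
exact: cvg_essentially_bounded phiM.
Qed.
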